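(* Let $G\in\mathbb{C}^{m\times m}$ be positive definite. Then $\mathcal{H}_G$ is a de Branges space $\mathcal{B}(\mathfrak{E})$ with respect to $\mathbb{D}$ if and only if $G$ is a block Toeplitz matrix. Moreover, in this case the matrix polynomials $E_\pm$ in $\mathfrak{E}=\begin{bmatrix}E_-&E_+\end{bmatrix}$ may be specified by the formulas $$E_{+}(\lambda)=\frac{1-\lambda\overline{\alpha}}{(1-|\alpha|^2)^{1/2}}F(\lambda)\mathfrak{z}_\alpha\quad\text{and}\quad E_{-}(\lambda)=\frac{\lambda-\alpha}{(1-|\alpha|^2)^{1/2}}F(\lambda)\mathfrak{z}_{\alpha_\circ},$$ where $\alpha_\circ=1/\overline{\alpha}$ is the reflection of $\alpha$ with respect to $\mathbb{T}$ and $\alpha$ is any point in $\mathbb{D}\setminus\{0\}$.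
   Context: $\mathbb{D}$ is the open unit disc and $\mathbb{T}$ the unit circle. $p,n\ge 1$ are fixed integers, $m=(n+1)p$, and $F(\lambda)=\begin{bmatrix}I_p&\lambda I_p&\cdots&\lambda^nI_p\end{bmatrix}$ for $\lambda\in\mathbb{C}$. $G$ is viewed as a block matrix with blocks $g_{ij}\in\mathbb{C}^{p\times p}$, $i,j=0,\ldots,n$; it is block Toeplitz if $g_{ij}$ depends only on $i-j$. $\Gamma=G^{-1}$. $\mathcal{H}_G=\{Fu:\,u\in\mathbb{C}^m\}$ is the Hilbert space of $p\times 1$ vector polynomials with inner product $\langle Fu,Fv\rangle_{\mathcal{H}_G}=v^*Gu$; it is a reproducing kernel Hilbert space with reproducing kernel $K_\omega(\lambda)=F(\lambda)\Gamma F(\omega)^*$. For $\beta\in\mathbb{C}$, $\mathfrak{z}_\beta=\Gamma F(\beta)^*(F(\beta)\Gamma F(\beta)^* )^{-1/2}\in\mathbb{C}^{m\times p}$. A $p\times 2p$ entire matrix valued function $\mathfrak{E}=\begin{bmatrix}E_-&E_+\end{bmatrix}$ with $p\times p$ blocks $E_\pm$ is a de Branges matrix with respect to $\mathbb{D}$ if $\det E_+(\lambda)\neq 0$ for $\lambda\in\mathbb{D}$ and $E_+^{-1}E_-$ is a $p\times p$ inner function on $\mathbb{D}$ (holomorphic and contractive in $\mathbb{D}$ with unitary boundary values a.e. on $\mathbb{T}$). The associated de Branges space with respect to $\mathbb{D}$ is $\mathcal{B}(\mathfrak{E})=\{\text{entire } p\times 1\text{ vector valued } f:\ E_+^{-1}f\in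 H_2^p\ominus E_+^{-1}E_-H_2^p\}$, where $H_2^p=H_2^p(\mathbb{D})$ is the vector Hardy space, with inner product $\langle f,g\rangle_{\mathcal{B}(\mathfrak{E})}=\frac{1}{2\pi}\int_0^{2\pi}g(e^{it})^*(E_+(e^{it})E_+(e^{it})^* )^{-1}f(e^{it})\,dt$; its reproducing kernel is $\frac{E_+(\lambda)E_+(\omega)^*-E_-(\lambda)E_-(\omega)^*}{1-\lambda\overline{\omega}}$ for $\lambda\overline{\omega}\ne1$. ''$\mathcal{H}_G$ is a de Branges space $\mathcal{B}(\mathfrak{E})$'' means that $\mathcal{H}_G=\mathcal{B}(\mathfrak{E})$ as Hilbert spaces (equivalently, as reproducing kernel Hilbert spaces with the same kernel) for some such $\mathfrak{E}$. *)

(* Defs.v *)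
From HB Require Import structures.
From mathcomp Require Import all_boot all_order all_algebra.
From mathcomp Require Import complex.
From mathcomp Require Import all_classical all_reals all_analysis.

Set Implicit Arguments.
Unset Strict Implicit.
Unset Printing Implicit Defensive.

Import Order.TTheory GRing.Theory Num.Theory.
Import numFieldNormedType.Exports.

Local Open Scope classical_set_scope.
Local Open Scope ring_scope.
Local Open Scope sesquilinear_scope.

(* Functions of a complex variable are total functions on R[i]; a function    *)
(* on the disc D = {z | `|z| < 1} is represented by any total extension, and  *)
(* its values outside D are never used. R[i]^o is R[i] seen as a normed space *)
(* over itself, so that [derivable] below is complex differentiability.       *)

Section PositiveMatrices.
Variable C : numClosedFieldType.

(* The order of C only compares numbers with a real difference, so these      *)
(* conditions say in particular that the quadratic form is real-valued.       *)
Definition posdefmx k (A : 'M[C]_k) : Prop :=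
  A^t* = A /\ forall u : 'cV[C]_k, u != 0 -> 0 < (u^t* *m A *m u) 0 0.

Definition contractivemx k l (S : 'M[C]_(k, l)) : Prop :=
  forall v : 'cV[C]_l,
    ((S *m v)^t* *m (S *m v)) 0 0 <= (v^t* *m v) 0 0.

(* A = P^* diag(d) P with P unitary when A is hermitian; see [sqrtmx_posdef]. *)
Definition sqrtmx k (A : 'M[C]_k) : 'M[C]_k :=
  (spectralmx A)^t* *m diag_mx (map_mx sqrtC (spectral_diag A))
    *m spectralmx A.

Lemma trmxC_mul k l q (A : 'M[C]_(k, l)) (B : 'M[C]_(l, q)) :
  (A *m B)^t* = B^t* *m A^t*.
Proof. by rewrite trmx_mul map_mxM. Qed.

Lemma diag_form k (d : 'rV[C]_k) (w : 'cV[C]_k) :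
  (w^t* *m diag_mx d *m w) 0 0 = \sum_i d 0 i * `|w i 0| ^+ 2.
Proof.
rewrite mul_mx_diag mxE; apply: eq_bigr => i _.
by rewrite !mxE normCK mulrC mulrA mulrC [RHS]mulrC mulrA mulrC mulrA.
Qed.

Lemma sqrtmx_posdef k (A : 'M[C]_k) :
  posdefmx A -> posdefmx (sqrtmx A) /\ sqrtmx A *m sqrtmx A = A.
Proof.
move=> [Ah Apos]; set P := spectralmx A; set d := spectral_diag A.
have PU : P \is unitarymx by exact: spectral_unitarymx.
have PPt : P *m P^t* = 1%:M by apply/unitarymxP.
have PtP : P^t* *m P = 1%:M.
  by rewrite -(invmx_unitary PU) mulVmx // spectral_unit.
have AE : A = P^t* *m diag_mx d *m P.
  rewrite -(invmx_unitary PU); apply/orthomx_spectralP/normalmxP.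
  by rewrite Ah.
have form u e : u^t* *m (P^t* *m diag_mx e *m P) *m u
    = (P *m u)^t* *m diag_mx e *m (P *m u) :> 'M[C]_1.
  by rewrite trmxC_mul !mulmxA.
have d_gt0 i : 0 < d 0 i.
  pose u : 'cV[C]_k := P^t* *m delta_mx i 0.
  have Pu : P *m u = delta_mx i 0 by rewrite mulmxA PPt mul1mx.
  have u0 : u != 0.
    apply/eqP => u0; move: Pu; rewrite u0 mulmx0 => /matrixP/(_ i 0)/eqP.
    by rewrite !mxE !eqxx eq_sym oner_eq0.
  have := Apos _ u0; rewrite [in X in X -> _]AE form Pu diag_form.
  rewrite (bigD1 i) //= big1 ?addr0 => [|j /negPf ji]; last first.
    by rewrite mxE ji normr0 expr0n mulr0.
  by rewrite mxE !eqxx normr1 expr1n mulr1.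
pose e : 'rV[C]_k := map_mx sqrtC d.
have e_gt0 i : 0 < e 0 i by rewrite mxE sqrtC_gt0.
split; [split|] => [|u u0|]; rewrite /sqrtmx -/P -/d -/e.
- rewrite !trmxC_mul trmxCK mulmxA; congr (_ *m _ *m _).
  rewrite tr_diag_mx map_diag_mx; congr diag_mx; apply/rowP => i.
  by rewrite [LHS]mxE; apply: geC0_conj; exact: ltW.
- rewrite form diag_form.
  have : P *m u != 0.
    by apply: contraNneq u0 => Pu0; rewrite -(mul1mx u) -PtP -mulmxA Pu0 mulmx0.
  move=> /cV0Pn[i wi]; rewrite (bigD1 i) //= ltr_wpDr //.
    by apply: sumr_ge0 => j _; rewrite mulr_ge0 ?exprn_ge0 // ltW.
  by rewrite mulr_gt0 // exprn_gt0 // normr_gt0.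
- rewrite !mulmxA -(mulmxA _ P) PPt mulmx1 -(mulmxA _ _ (diag_mx e)) mulmx_diag.
  rewrite [in RHS]AE; congr (_ *m diag_mx _ *m _); apply/rowP => i.
  by rewrite !mxE -expr2 sqrtCK.
Qed.

End PositiveMatrices.

Section DeBranges.
Variable R : realType.
Local Notation C := R[i].

Definition expi (t : R) : C := (cos t +i* sin t)%C.

Definition circle_pt (r t : R) : C := (r%:C)%C * expi t.

(* (1 / 2pi) \int_0^{2pi} phi t dt for a complex-valued phi *)
Definition circle_mean (phi : R -> C) : C :=
  let mean (h : R -> R) : R :=
    (2 * pi)^-1 * \int[@lebesgue_measure R]_(t in `[0, 2 * pi]) h t in
  (mean (fun t => complex.Re (phi t)) +i* mean (fun t => complex.Im (phi t)))%C.

Definition unit_disc : set C := [set z | `|z| < 1].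

Definition holomorphic_on k l (U : set C) (A : C -> 'M[C]_(k, l)) : Prop :=
  forall z, U z -> forall i j,
    derivable (fun w : C^o => A w i j : C^o) z 1.

Definition entire k l (A : C -> 'M[C]_(k, l)) : Prop := holomorphic_on setT A.

(* The boundary values are the radial limits. *)
Definition inner_function k (S : C -> 'M[C]_k) : Prop :=
  [/\ holomorphic_on unit_disc S,
      forall z, unit_disc z -> contractivemx (S z)
    & {ae @lebesgue_measure R, forall t : R, 0 <= t <= 2 * pi ->
        exists U : 'M[C]_k, U \is unitarymx /\
          forall i j,
            (S (circle_pt r t) i j : C^o) @[r --> 1^'-] --> (U i j : C^o)} ].

(* The vector Hardy space H_2^k of the disc, by bounded integral means. *)
Definition hardy2 k (f : C -> 'cV[C]_k) : Prop :=
  holomorphic_on unit_disc f /\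
  exists M : R, forall r : R, 0 <= r < 1 ->
    (((2 * pi)^-1)%:E * \int[@lebesgue_measure R]_(t in `[0%R, (2 * pi)%R])
      (complex.Re (((f (circle_pt r t))^t* *m f (circle_pt r t)) 0 0))%:E
     <= M%:E)%E.

(* For f and g in H_2^k the inner product <f, g> (the integral of g^* f over  *)
(* the boundary) is the limit of the means of g^* f over circles of radius    *)
(* r < 1.                                                                     *)
Definition hardy2_orthogonal k (f g : C -> 'cV[C]_k) : Prop :=
  (circle_mean (fun t => ((g (circle_pt r t))^t* *m f (circle_pt r t)) 0 0)
     : C^o) @[r --> 1^'-] --> (0 : C^o).

(* H_2^k minus (orthogonally) S H_2^k *)
Definition model_space k (S : C -> 'M[C]_k) : set (C -> 'cV[C]_k) :=
  [set h | hardy2 h /\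
     forall g, hardy2 g -> hardy2_orthogonal h (fun z => S z *m g z)].

Section DeBrangesMatrix.
Variables (p : nat) (E : C -> 'M[C]_(p, p + p)).

Definition Eminus (z : C) : 'M[C]_p := lsubmx (E z).
Definition Eplus (z : C) : 'M[C]_p := rsubmx (E z).

Definition deBranges_matrix : Prop :=
  [/\ entire E,
      forall z, unit_disc z -> \det (Eplus z) != 0
    & inner_function (fun z => invmx (Eplus z) *m Eminus z) ].

Definition deBranges_space : set (C -> 'cV[C]_p) :=
  [set f | entire f /\
     model_space (fun z => invmx (Eplus z) *m Eminus z)
                 (fun z => invmx (Eplus z) *m f z)].

Definition deBranges_inner (f g : C -> 'cV[C]_p) : C :=
  circle_mean (fun t =>
    ((g (expi t))^t* *m invmx (Eplus (expi t) *m (Eplus (expi t))^t*)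
       *m f (expi t)) 0 0).

End DeBrangesMatrix.

Section HG.
Variables p n : nat.

(* The size \sum_(j < n.+1) p, equal to n.+1 * p, is the one over which the   *)
(* library's block operations [\mxrow] and [submxblock] are defined.          *)
Local Notation m := (\sum_(j < n.+1) p)%N.

Definition Frow (z : C) : 'M[C]_(p, m) := \mxrow_(j < n.+1) (z ^+ j)%:M.

Definition block_toeplitz (G : 'M[C]_m) : Prop :=
  forall i j k l : 'I_n.+1, i%:Z - j%:Z = k%:Z - l%:Z ->
    submxblock G i j = submxblock G k l.

Definition Fpoly (u : 'cV[C]_m) (z : C) : 'cV[C]_p := Frow z *m u.

Definition HG_space : set (C -> 'cV[C]_p) := range Fpoly.

(* H_G = B(E) as Hilbert spaces: same functions, same inner product. *)
Definition HG_is_deBranges (G : 'M[C]_m) (E : C -> 'M[C]_(p, p + p)) : Prop :=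
  HG_space = deBranges_space E /\
  forall u v : 'cV[C]_m,
    deBranges_inner E (Fpoly u) (Fpoly v) = (v^t* *m G *m u) 0 0.

Definition frakz (G : 'M[C]_m) (b : C) : 'M[C]_(m, p) :=
  invmx G *m (Frow b)^t*
    *m invmx (sqrtmx (Frow b *m invmx G *m (Frow b)^t*)).

Definition Eplus_of (G : 'M[C]_m) (a z : C) : 'M[C]_p :=
  ((1 - z * a^*) / sqrtC (1 - `|a| ^+ 2)) *: (Frow z *m frakz G a).

Definition Eminus_of (G : 'M[C]_m) (a z : C) : 'M[C]_p :=
  ((z - a) / sqrtC (1 - `|a| ^+ 2)) *: (Frow z *m frakz G (a^*)^-1).

Definition E_of (G : 'M[C]_m) (a z : C) : 'M[C]_(p, p + p) :=
  row_mx (Eminus_of G a z) (Eplus_of G a z).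

End HG.

End DeBranges.

(* Main.v *)
Require Import Defs.
From mathcomp Require Import all_boot all_order all_algebra.
From mathcomp Require Import complex.
From mathcomp Require Import all_classical all_reals all_analysis.
From mathcomp Require Import ring lra.

(** If the inner product of [H_G] is an integral over the unit circle, then
    multiplying both arguments by the variable does not change it. The block
    [g_ij] is the inner product of monomials of degrees [j] and [i], so it
    depends on [i - j] only ([deBranges_toeplitz]).

    Conversely, let [G] be block Toeplitz. Then multiplication by the variable
    is isometric on degrees less than [n], hence so is multiplication by
    [(1 - a^* z) / (z - a)] from the polynomials that vanish at [a] to those
    that vanish at [1 / a^*] ([mobius_isometry]). Comparing the reproducing
    kernels of these two subspaces gives the identity that expresses
    [1 - l * w^*] times the kernel at [l] and [w] as
    [Epl l *m (Epl w)^t* - Emi l *m (Emi w)^t*] ([kernel_identity]). Positivity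
    of the kernel now makes [Epl] invertible on the closed disc, and [Emi]
    invertible outside the open disc, including at infinity; the quotient [S]
    of [Emi] by [Epl] is contractive in the disc, and it is unitary at every
    point of the circle.

    On the circle [Epl] and [Emi] have the same Gram matrix, whose inverse is
    the weight of the integral. For a polynomial [f] of degree at most [n], the
    function [Epl^-1 f] is holomorphic on the closed disc, whereas [Emi^-1 f]
    is holomorphic outside it and vanishes at infinity. So, if a kernel
    function is integrated against [f], the part with [Epl] is evaluated by
    Cauchy's formula, and the part with [Emi] has mean zero. The integral thus
    reproduces the values of [f], and it has to be the form of [G]
    ([inner_eq]).

    The boundary value of [S^t* Epl^-1 f] is [Emi^-1 f]. For a polynomial it
    has negative frequencies only, which is orthogonality to [S H_2]
    ([poly_in_model_space]). If conversely [f] is any member of the de Branges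
    space, then orthogonality to [S z^k] removes all other frequencies from
    [Emi^-1 f]. As [Emi] has degree [n.+1], no frequency beyond [n] remains in
    [f], and an entire function of this kind is a polynomial
    ([entire_coef_poly]).

    Entire functions are differentiable at every point of the plane, elements
    of the Hardy space at every point of the disc, but nothing is known of
    their derivatives, so the function theory starts from Goursat's bisection
    argument, in the form that the integral of a closed differential form
    around a rectangle vanishes ([goursat]). In logarithmic polar coordinates
    this says that the mean of a holomorphic function over a circle does not
    depend on the radius ([mean_annulus]). Such means vary continuously with
    the radius, so a mean value property holds even with an exceptional point
    ([mean_value]), and applied to a difference quotient it becomes Cauchy's
    formula ([cauchy_formula]). *)

Set Implicit Arguments.
Unset Strict Implicit.
Unset Printing Implicit Defensive.

Import Order.TTheory GRing.Theory Num.Theory.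
Import numFieldNormedType.Exports.

Local Open Scope classical_set_scope.
Local Open Scope ring_scope.
Local Open Scope sesquilinear_scope.

(** * Positive definite matrices *)

Section PosDef.
Variable C : numClosedFieldType.

Lemma trmxCD k l (A B : 'M[C]_(k, l)) : (A + B)^t* = A^t* + B^t*.
Proof. by rewrite linearD map_mxD. Qed.

Lemma trmxCB k l (A B : 'M[C]_(k, l)) : (A - B)^t* = A^t* - B^t*.
Proof. by rewrite linearB map_mxB. Qed.

Lemma trmxCZ k l c (A : 'M[C]_(k, l)) : (c *: A)^t* = c^* *: A^t*.
Proof. by rewrite linearZ map_mxZ. Qed.

Lemma trmxC1 k : (1%:M : 'M[C]_k)^t* = 1%:M.
Proof. by rewrite tr_scalar_mx map_scalar_mx rmorph1. Qed.

Lemma trmxC_inv k (A : 'M[C]_k) : (invmx A)^t* = invmx (A^t*).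
Proof. by rewrite trmx_inv map_invmx. Qed.

Lemma invmx_unique k (A B : 'M[C]_k) : A *m B = 1%:M -> invmx A = B.
Proof.
move=> AB; have [uA _] := mulmx1_unit AB.
by rewrite -[invmx A]mulmx1 -AB mulKmx.
Qed.

Lemma invmxM k (A B : 'M[C]_k) : A \in unitmx -> B \in unitmx ->
  invmx (A *m B) = invmx B *m invmx A.
Proof.
move=> uA uB; apply: invmx_unique.
by rewrite -mulmxA mulKVmx // mulmxV.
Qed.

Lemma form_ge0 k (u : 'cV[C]_k) : 0 <= (u^t* *m u) 0 0.
Proof.
rewrite mxE sumr_ge0 // => i _.
by rewrite !mxE mulrC mul_conjC_ge0.
Qed.

Lemma form_eq0 k (u : 'cV[C]_k) : (u^t* *m u) 0 0 = 0 -> u = 0.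
Proof.
rewrite mxE => /eqP; rewrite psumr_eq0 => [/allP u0|i _]; last first.
  by rewrite !mxE mulrC mul_conjC_ge0.
apply/colP => i; have := u0 i (mem_index_enum _).
by rewrite /= !mxE mulrC mul_conjC_eq0 => /eqP.
Qed.

Lemma mulmx_ext k l (A B : 'M[C]_(k, l)) :
  (forall x : 'cV[C]_l, A *m x = B *m x) -> A = B.
Proof.
move=> AB; apply/matrixP => i j.
by have /colP/(_ i) := AB (delta_mx j 0); rewrite -!colE !mxE.
Qed.

Lemma scalemx_ext k l c d (A B : 'M[C]_(k, l)) :
  (forall x : 'cV[C]_l, c *: (A *m x) = d *: (B *m x)) -> c *: A = d *: B.
Proof. by move=> AB; apply: mulmx_ext => x; rewrite -!scalemxAl. Qed.

Lemma row_ker_unitmx k (A : 'M[C]_k) :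
  (forall u : 'cV[C]_k, A *m u = 0 -> u = 0) -> A \in unitmx.
Proof.
move=> inj; rewrite -unitmx_tr -row_free_unit -kermx_eq0; apply/rowV0P => v.
move/sub_kermxP => vA; apply: trmx_inj; rewrite trmx0; apply: inj.
by rewrite -[A]trmxK -trmx_mul vA trmx0.
Qed.

Lemma posdef_unit k (A : 'M[C]_k) : posdefmx A -> A \in unitmx.
Proof.
move=> [_ pos]; apply: row_ker_unitmx => u Au; apply/eqP/negP => /negP u0.
by have := pos u u0; rewrite -mulmxA Au mulmx0 mxE ltxx.
Qed.

Lemma posdef_congr k l (A : 'M[C]_k) (B : 'M[C]_(l, k)) :
  posdefmx A -> (forall u : 'cV[C]_l, B^t* *m u = 0 -> u = 0) ->
  posdefmx (B *m A *m B^t*).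
Proof.
move=> [hA pos] inj; split; first by rewrite !trmxC_mul trmxCK hA mulmxA.
move=> u u0; have -> : u^t* *m (B *m A *m B^t*) *m u
    = (B^t* *m u)^t* *m A *m (B^t* *m u).
  by rewrite trmxC_mul trmxCK !mulmxA.
by apply: pos; apply: contraNneq u0 => /inj ->.
Qed.

Lemma posdef_inv k (A : 'M[C]_k) : posdefmx A -> posdefmx (invmx A).
Proof.
move=> pA; have uA := posdef_unit pA; case: (pA) => hA _.
have -> : invmx A = invmx A *m A *m (invmx A)^t*.
  by rewrite trmxC_inv hA -mulmxA mulmxV ?mulmx1.
apply: posdef_congr => // u; rewrite trmxC_inv hA => /(congr1 (mulmx A)).
by rewrite mulKVmx // mulmx0.
Qed.

Lemma posdefD k (A B : 'M[C]_k) : posdefmx A ->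
  B^t* = B -> (forall u : 'cV[C]_k, 0 <= (u^t* *m B *m u) 0 0) ->
  posdefmx (A + B).
Proof.
move=> [hA pA] hB pB; split; first by rewrite trmxCD hA hB.
by move=> u u0; rewrite mulmxDr mulmxDl mxE ltr_wpDr ?pA.
Qed.

Lemma posdefZ k c (A : 'M[C]_k) : posdefmx A -> 0 < c -> posdefmx (c *: A).
Proof.
move=> [hA pA] c0; split; first by rewrite trmxCZ hA geC0_conj // ltW.
by move=> u u0; rewrite -scalemxAr -scalemxAl mxE mulr_gt0 ?pA.
Qed.

Lemma gram_ge0 k l (A : 'M[C]_(k, l)) (u : 'cV[C]_k) :
  0 <= (u^t* *m (A *m A^t*) *m u) 0 0.
Proof.
have -> : u^t* *m (A *m A^t*) *m u = (A^t* *m u)^t* *m (A^t* *m u).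
  by rewrite trmxC_mul trmxCK !mulmxA.
exact: form_ge0.
Qed.

Lemma trmxC_gram k l (A : 'M[C]_(k, l)) : (A *m A^t*)^t* = A *m A^t*.
Proof. by rewrite trmxC_mul trmxCK. Qed.

Lemma gram_unit k (A : 'M[C]_k) : A *m A^t* \in unitmx -> A \in unitmx.
Proof. by rewrite unitmx_mul => /andP[]. Qed.

(** The normalizing factor of [frakz] is only ever used through its Gram matrix,
    in which the square root disappears. *)
Lemma posdef_gram_inv_sqrt k (A : 'M[C]_k) : posdefmx A ->
  let N := invmx (sqrtmx A) in N \in unitmx /\ N *m N^t* = invmx A.
Proof.
move=> /sqrtmx_posdef[pS SS] N; have uS := posdef_unit pS.
rewrite /N unitmx_inv; split => //; rewrite trmxC_inv pS.1 -{3}SS.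
by rewrite invmxM.
Qed.

Lemma entryB k l (A B : 'M[C]_(k, l)) i j : (A - B) i j = A i j - B i j.
Proof. by rewrite !mxE. Qed.

Lemma gram_diff_apply k c (K A A' B B' W : 'M[C]_k) (x : 'rV[C]_k) (v : 'cV[C]_k) :
  c != 0 -> c *: K = A *m A' - B *m B' ->
  x *m K *m W *m v =
    c^-1 *: (x *m A *m (A' *m W *m v) - x *m B *m (B' *m W *m v)).
Proof.
move=> c0 KE; rewrite -[K]scale1r -(mulVf c0) -scalerA KE.
by rewrite -scalemxAr -!scalemxAl mulmxBr !mulmxBl !mulmxA.
Qed.

Lemma entryD k l (A B : 'M[C]_(k, l)) i j : (A + B) i j = A i j + B i j.
Proof. by rewrite !mxE. Qed.

Lemma entryZ k l c (A : 'M[C]_(k, l)) i j : (c *: A) i j = c * A i j.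
Proof. by rewrite !mxE. Qed.

Lemma gram_diff_ker k c (K A A' B B' : 'M[C]_k) (x : 'cV[C]_k) :
  A *m A' - B *m B' = c *: K -> A' *m x = 0 -> B' *m x = 0 ->
  c *: (K *m x) = 0.
Proof.
move=> AB Ax Bx; rewrite scalemxAl -AB mulmxBl -!mulmxA Ax Bx.
by rewrite !mulmx0 subrr.
Qed.

(** [S *m S^t* <= 1] implies [S^t* *m S <= 1]: with [w := S *m v], the square of
    [v - S^t* *m w] is nonnegative and at most the square of [v] minus that of
    [w]. *)
Lemma contractive_of_gram k (S : 'M[C]_k) :
  (forall u : 'cV[C]_k, (u^t* *m (S *m S^t*) *m u) 0 0 <= (u^t* *m u) 0 0) ->
  contractivemx S.
Proof.
move=> le v; set w := S *m v.
have := form_ge0 (v - S^t* *m w).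
have -> : (v - S^t* *m w)^t* *m (v - S^t* *m w) =
    v^t* *m v - w^t* *m w - (w^t* *m w - w^t* *m (S *m S^t*) *m w).
  have e : v^t* *m S^t* = w^t* by rewrite trmxC_mul.
  rewrite trmxCB trmxC_mul trmxCK mulmxBl !mulmxBr -!mulmxA -/w.
  by rewrite (mulmxA (v^t*)) e.
rewrite !entryB => H; have := le w => lew.
by rewrite -subr_ge0 (le_trans H) // gerBl subr_ge0.
Qed.

End PosDef.

(** * Vector polynomials and the Toeplitz condition *)

Section BlockVectors.
Variables (C : numClosedFieldType) (p n : nat).
Local Notation m := (\sum_(j < n.+1) p)%N.
(** The algebra uses nothing of the complex numbers, so it is done over any
    [numClosedFieldType]; over [R[i]] the definitions here and below are
    convertible to [Frow], [block_toeplitz], [frakz], [Eplus_of] and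
    [Eminus_of]. *)
Definition frow (z : C) : 'M[C]_(p, m) := \mxrow_(j < n.+1) (z ^+ j)%:M.

Definition toeplitz (G : 'M[C]_m) : Prop :=
  forall i j k l : 'I_n.+1, i%:Z - j%:Z = k%:Z - l%:Z ->
    submxblock G i j = submxblock G k l.

Local Notation F := frow.
Implicit Types (c d : nat -> 'cV[C]_p) (u v : 'cV[C]_m) (G : 'M[C]_m).

Definition bvec c : 'cV[C]_m := \mxcol_(j < n.+1) c j.

(** Multiplication by the variable, on coefficients. *)
Definition bshift c (j : nat) : 'cV[C]_p := if j is j'.+1 then c j' else 0.

Lemma bvecP u : exists c, u = bvec c.
Proof.
exists (fun j => submxcol u (inord j)).
by rewrite -[LHS]submxcolK; apply: eq_mxcol => j; rewrite inord_val.
Qed.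

Lemma bvecZ a c : bvec (fun j => a *: c j) = a *: bvec c.
Proof. by apply/matrixP => i j; rewrite !mxE. Qed.

Lemma frow_bvec z c : F z *m bvec c = \sum_(j < n.+1) z ^+ j *: c j.
Proof.
rewrite mul_mxrow_mxcol; apply: eq_bigr => j _.
by rewrite mul_scalar_mx.
Qed.

Lemma frow_bshift z c : c n = 0 -> F z *m bvec (bshift c) = z *: (F z *m bvec c).
Proof.
move=> cn; rewrite !frow_bvec big_ord_recl scaler0 add0r big_ord_recr /= cn.
rewrite scaler0 addr0 scaler_sumr; apply: eq_bigr => j _.
by rewrite scalerA -exprS.
Qed.

Lemma form_bvec G c d : (bvec c)^t* *m G *m bvec d =
  \sum_(i < n.+1) \sum_(j < n.+1) (c i)^t* *m submxblock G i j *m d j.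
Proof.
rewrite -[G in LHS]submxblockK tr_mxcol.
have -> : map_mx Num.conj (\mxrow_(j < n.+1) (c j)^T) = \mxrow_(j < n.+1) (c j)^t*.
  by apply/matrixP => i j; rewrite !mxE.
rewrite mul_mxrow_mxblock mul_mxrow_mxcol exchange_big.
by apply: eq_bigr => i _; rewrite mulmx_suml.
Qed.

(** This is the meaning of the Toeplitz condition: multiplication by the
    variable is isometric on the polynomials of degree less than [n]. *)
Lemma toeplitz_shift G c d : toeplitz G -> c n = 0 -> d n = 0 ->
  (bvec (bshift c))^t* *m G *m bvec (bshift d) = (bvec c)^t* *m G *m bvec d.
Proof.
move=> tG cn dn; rewrite !form_bvec.
rewrite big_ord_recl big1 ?add0r => [|j _]; last first.
  by rewrite /= trmx0 map_mx0 !mul0mx.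
rewrite [RHS]big_ord_recr /= [X in _ + X]big1 ?addr0 => [|j _]; last first.
  by rewrite cn trmx0 map_mx0 !mul0mx.
apply: eq_bigr => i _; rewrite big_ord_recl mulmx0 add0r.
rewrite [RHS]big_ord_recr /= dn mulmx0 addr0; apply: eq_bigr => j _.
congr (_ *m _ *m _); apply: tG => /=.
by rewrite !/bump /= !add1n !intS opprD addrACA subrr add0r.
Qed.

Lemma frow_factor a u : F a *m u = 0 ->
  exists2 c, c n = 0 & u = bvec (bshift c) - a *: bvec c.
Proof.
have [d ->] := bvecP u; rewrite frow_bvec => Fd.
(* the quotient of a polynomial by its linear factor, by Horner's scheme *)
pose c j := \sum_(j.+1 <= k < n.+1) a ^+ (k - j.+1) *: d k.
exists c; first by rewrite /c big_geq.
have cS j : (j < n.+1)%N ->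
    \sum_(j <= k < n.+1) a ^+ (k - j) *: d k = d j + a *: c j.
  move=> jn; rewrite big_ltn // subnn expr0 scale1r; congr (_ + _).
  rewrite scaler_sumr !big_nat; apply: eq_bigr => k /andP[jk _].
  by rewrite scalerA -exprS -subSn.
rewrite -bvecZ -[RHS]submxcolK -[LHS]submxcolK; apply: eq_mxcol => j.
rewrite submxcolB !mxcolK.
case: j => -[|j] jn /=.
  rewrite sub0r; apply/eqP; rewrite -addr_eq0 -cS // -[X in _ == X]Fd.
  rewrite big_mkord; apply/eqP; apply: eq_bigr => k _.
  by rewrite subn0.
rewrite {1}/c cS; last by [].
by rewrite addrK.
Qed.

End BlockVectors.

(** * Reproducing kernels of the polynomials that vanish at a point *)

Section KernelIdentity.
Variables (C : numClosedFieldType) (p n : nat).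
Local Notation m := (\sum_(j < n.+1) p)%N.
Local Notation F := (@frow C p n).
Variable G : 'M[C]_m.
Hypothesis Gpos : posdefmx G.
Local Notation Gam := (invmx G).

Definition hform (u v : 'cV[C]_m) : C := (u^t* *m G *m v) 0 0.

Lemma hformBl u v w : hform (u - v) w = hform u w - hform v w.
Proof. by rewrite /hform trmxCB !mulmxBl entryB. Qed.
Lemma hformBr u v w : hform w (u - v) = hform w u - hform w v.
Proof. by rewrite /hform !mulmxBr entryB. Qed.
Lemma hformZl a u w : hform (a *: u) w = a^* * hform u w.
Proof. by rewrite /hform trmxCZ -!scalemxAl mxE. Qed.
Lemma hformZr a u w : hform w (a *: u) = a * hform w u.
Proof. by rewrite /hform -!scalemxAr mxE. Qed.

Lemma hform_eq0 u : hform u u = 0 -> u = 0.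
Proof.
move=> u0; apply/eqP; apply: contraT => /(proj2 Gpos).
by rewrite -/(hform u u) u0 ltxx.
Qed.

Definition HGker (l w : C) : 'M[C]_p := F l *m Gam *m (F w)^t*.

Lemma frowC_inj b (x : 'cV[C]_p) : (F b)^t* *m x = 0 -> x = 0.
Proof.
move=> Fx; apply/colP => i; have := congr1 (fun A => (A^t* *m
  bvec n (fun j => if j is 0 then delta_mx i 0 else 0)) 0 0) Fx.
rewrite trmxC_mul trmxCK -mulmxA frow_bvec.
have -> : \sum_(j < n.+1) b ^+ j *:
    (if j : nat is 0 then delta_mx i 0 else 0) = delta_mx i 0 :> 'cV[C]_p.
  rewrite big_ord_recl big1 => [|j _]; last by rewrite scaler0.
  by rewrite addr0 expr0 scale1r.
rewrite trmx0 map_mx0 mul0mx mxE (bigD1 i) //= big1.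
  by rewrite !mxE !eqxx mulr1 addr0 => /eqP; rewrite conjC_eq0 => /eqP.
by move=> j /negPf ji; rewrite !mxE ji mulr0.
Qed.

Lemma HGker_pos b : posdefmx (HGker b b).
Proof. by apply: posdef_congr; [exact: posdef_inv|exact: frowC_inj]. Qed.

Lemma HGkerC l w : (HGker l w)^t* = HGker w l.
Proof.
by rewrite /HGker !trmxC_mul trmxCK (posdef_inv Gpos).1 mulmxA.
Qed.

(** Between [F l] and [(F w)^t*], this is the reproducing kernel of the subspace
    of polynomials that vanish at [b]: the full kernel minus its projection on
    the kernel functions at [b]. *)
Definition vanish_ker b : 'M[C]_m :=
  Gam - Gam *m (F b)^t* *m invmx (HGker b b) *m F b *m Gam.

Lemma vanish_kerC b : (vanish_ker b)^t* = vanish_ker b.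
Proof.
rewrite /vanish_ker trmxCB !trmxC_mul trmxCK (posdef_inv Gpos).1.
by rewrite trmxC_inv HGkerC !mulmxA.
Qed.

Lemma vanish_ker0 b : F b *m vanish_ker b = 0.
Proof.
rewrite /vanish_ker mulmxBr !mulmxA -/(HGker b b) mulmxV ?mul1mx ?subrr //.
exact/posdef_unit/HGker_pos.
Qed.

Lemma vanish_ker_repr b y u : F b *m u = 0 ->
  hform (vanish_ker b *m y) u = (y^t* *m u) 0 0.
Proof.
move=> Fu; rewrite /hform trmxC_mul vanish_kerC -!mulmxA; congr ((_ *m _) 0 0).
rewrite /vanish_ker mulmxBl mulKmx ?posdef_unit // -!mulmxA mulKmx ?posdef_unit //.
by rewrite Fu !mulmx0 subr0.
Qed.

Hypothesis Gtoe : toeplitz G.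

(** Multiplication by [(1 - a^* z) / (z - a)] is an isometry from the polynomials
    that vanish at [a] to those that vanish at the reflected point: after
    expansion both sides consist of the same terms, up to [toeplitz_shift]. *)
Lemma mobius_isometry (a : C) c d : c n = 0 -> d n = 0 ->
  hform (bvec n c - a^* *: bvec n (bshift c))
        (bvec n d - a^* *: bvec n (bshift d)) =
  hform (bvec n (bshift c) - a *: bvec n c)
        (bvec n (bshift d) - a *: bvec n d).
Proof.
move=> cn dn; rewrite !(hformBl, hformBr, hformZl, hformZr) conjCK.
have -> : hform (bvec n (bshift c)) (bvec n (bshift d)) =
          hform (bvec n c) (bvec n d) by rewrite /hform toeplitz_shift.
ring.
Qed.

(** The isometry above carries one reproducing kernel to the other. Concretely,
    let [d] be the difference of the image of the first kernel function and the
    matching multiple of the second. Both pair in the same way with any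
    polynomial vanishing at the reflected point, and [d] itself is one, so [d]
    is orthogonal to itself. *)
Lemma vanish_ker_reflection (a l w : C) : a != 0 ->
  ((1 - l * a^*) * (1 - a * w^*)) *: (F l *m vanish_ker a *m (F w)^t*) =
  ((l - a) * (w - a)^*) *: (F l *m vanish_ker (a^*)^-1 *m (F w)^t*).
Proof.
move=> a0; have ac0 : a^* != 0 by rewrite conjC_eq0.
suff vec (x : 'cV[C]_p) :
  ((1 - l * a^*) * (1 - a * w^*)) *: ((F l *m vanish_ker a *m (F w)^t*) *m x) =
  ((l - a) * (w - a)^*) *: (F l *m vanish_ker (a^*)^-1 *m (F w)^t* *m x).
  by apply: scalemx_ext.
set b := (a^*)^-1; set y := (F w)^t* *m x; rewrite -!mulmxA -/y.
have [q qn qE] : exists2 q : nat -> 'cV[C]_p, q n = 0 &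
    vanish_ker a *m y = bvec n (bshift q) - a *: bvec n q.
  by apply: frow_factor; rewrite mulmxA vanish_ker0 mul0mx.
set k := vanish_ker b *m y.
have Fbk : F b *m k = 0 by rewrite mulmxA vanish_ker0 mul0mx.
have yF u : (y^t* *m u) 0 0 = (x^t* *m (F w *m u)) 0 0.
  by rewrite trmxC_mul trmxCK mulmxA.
pose qh := bvec n q - a^* *: bvec n (bshift q).
have Fqh z : F z *m qh = (1 - z * a^*) *: (F z *m bvec n q).
  by rewrite mulmxBr -scalemxAr frow_bshift // scalerA scalerBl scale1r mulrC.
pose d := (1 - a * w^*) *: qh - (w - a)^* *: k.
suff d0 : d = 0.
  have -> : (1 - l * a^*) * (1 - a * w^*) *: (F l *m (vanish_ker a *m y))
      = (l - a) *: (F l *m ((1 - a * w^*) *: qh)).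
    rewrite qE mulmxBr -!scalemxAr frow_bshift // Fqh -scalerBl !scalerA.
    by congr (_ *: _); ring.
  by rewrite (subr0_eq d0) -scalemxAr scalerA.
have [h hn dE] : exists2 h : nat -> 'cV[C]_p, h n = 0 &
    d = bvec n (bshift h) - b *: bvec n h.
  apply: frow_factor; rewrite mulmxBr -!scalemxAr Fbk Fqh /b mulVf //.
  by rewrite subrr scale0r !scaler0 subrr.
pose hh := bvec n h - a^* *: bvec n (bshift h).
have dhh : d = - b *: hh.
  rewrite dE /hh scalerBr scalerA mulNr /b mulVf // scaleN1r opprK addrC scaleNr.
  by [].
apply: hform_eq0; rewrite {2}dhh hformZr.
rewrite /d hformBl !hformZl mobius_isometry // -qE !vanish_ker_repr; last 2 first.
- rewrite mulmxBr -scalemxAr frow_bshift // /b scalerA mulfV // scale1r subrr.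
  by [].
- by rewrite mulmxBr -scalemxAr frow_bshift // subrr.
rewrite !yF !mulmxBr -!scalemxAr frow_bshift //.
rewrite -!scalemxAr !(entryB, entryZ) rmorphB rmorph1 rmorphM /= !conjCK.
by ring.
Qed.


End KernelIdentity.

(** * The kernel identity *)

Section DeBrangesPair.
Variables (C : numClosedFieldType) (p n : nat).
Local Notation m := (\sum_(j < n.+1) p)%N.
Local Notation F := (@frow C p n).

(** A nonzero polynomial of degree at most [n] cannot vanish at the points
    1/2, ..., 1/(n+2). *)
Lemma frow_disc_inj (u : 'cV[C]_m) :
  (forall z, `|z| < 1 -> F z *m u = 0) -> u = 0.
Proof.
have [c ->] := bvecP u => Fu.
rewrite -[LHS]submxcolK -[RHS]submxcolK; apply: eq_mxcol => j.
rewrite mxcolK submxcol0; apply/colP => i; rewrite [RHS]mxE.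
pose P : {poly C} := \poly_(j < n.+1) c j i 0.
suff P0 : P = 0.
  by have := congr1 (fun q : {poly C} => q`_j) P0; rewrite coef_poly ltn_ord coef0.
apply/eqP; apply: contraT => P0.
pose rs := [seq (k.+2%:R : C)^-1 | k <- iota 0 n.+1].
have rsP : all (root P) rs.
  apply/allP => _ /mapP[k _ ->]; apply/rootP; rewrite horner_poly.
  have /Fu : `|(k.+2%:R : C)^-1| < 1.
    by rewrite normfV normr_nat invf_lt1 ?ltr0n // (ltr_nat _ 1).
  rewrite frow_bvec => /colP/(_ i); rewrite summxE [RHS]mxE => Fi; rewrite -[RHS]Fi.
  by apply: eq_bigr => l _; rewrite mxE mulrC.
have rsU : uniq rs.
  rewrite map_inj_uniq ?iota_uniq // => k l /invr_inj/eqP.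
  by rewrite eqr_nat => /eqP[].
have := max_poly_roots P0 rsP rsU.
by rewrite size_map size_iota ltnNge size_poly.
Qed.

(** The coefficients of [F] in reverse order: a polynomial in the inverse of the
    variable, cleared of denominators. *)
Definition frev (z : C) : 'M[C]_(p, m) := \mxrow_(j < n.+1) (z ^+ (n - j))%:M.

Lemma frowV (z : C) : z != 0 -> F z^-1 = z ^- n *: frev z.
Proof.
move=> z0; rewrite -mul_scalar_mx mul_mxrow; apply: eq_mxrow => j.
rewrite -scalar_mxM; congr (_%:M).
rewrite exprVn -[in z ^- n](subnK (_ : j <= n)%N); last by rewrite -ltnS.
by rewrite exprD invfM mulrAC mulVf ?mul1r // expf_neq0.
Qed.

Lemma frev0_bvec c : frev 0 *m bvec n c = c n.
Proof.
rewrite mul_mxrow_mxcol [LHS]big_ord_recr /= big1 ?add0r => [|j _].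
  by rewrite subnn expr0 mul1mx.
by rewrite mul_scalar_mx expr0n subn_eq0 leqNgt ltn_ord scale0r.
Qed.

Variable G : 'M[C]_m.
Hypotheses (Gpos : posdefmx G) (Gtoe : toeplitz G).
Variable a : C.
Hypotheses (a1 : `|a| < 1) (a0 : a != 0).
Local Notation Gam := (invmx G).
Local Notation K := (HGker G).
Local Notation b := (a^*)^-1.

Lemma one_sub_norm_gt0 (z : C) : `|z| < 1 -> 0 < 1 - `|z| ^+ 2.
Proof. by move=> z1; rewrite subr_gt0 exprn_ilt1. Qed.

Definition zfrak c : 'M[C]_(m, p) :=
  Gam *m (F c)^t* *m invmx (sqrtmx (F c *m Gam *m (F c)^t*)).

Definition Epl z : 'M[C]_p :=
  ((1 - z * a^*) / sqrtC (1 - `|a| ^+ 2)) *: (F z *m zfrak a).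

Definition Emi z : 'M[C]_p :=
  ((z - a) / sqrtC (1 - `|a| ^+ 2)) *: (F z *m zfrak b).

Lemma zfrak_unit (c : C) : invmx (sqrtmx (K c c)) \in unitmx.
Proof. by have [] := posdef_gram_inv_sqrt (HGker_pos Gpos c). Qed.

Lemma zfrak_gram l w c : F l *m zfrak c *m (F w *m zfrak c)^t* =
  K l w - F l *m vanish_ker G c *m (F w)^t*.
Proof.
rewrite /zfrak -/(HGker G c c); set N := invmx (sqrtmx _).
have [_ NN] := posdef_gram_inv_sqrt (HGker_pos Gpos c); rewrite -/N in NN.
rewrite !trmxC_mul trmxCK (posdef_inv Gpos).1 /vanish_ker mulmxBr mulmxBl.
by rewrite -NN /HGker opprB addrC subrK !mulmxA.
Qed.


(** By [vanish_ker_reflection] the projected kernels cancel, and, with primes for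
    conjugates, [(1 - l a')(1 - a w') - (l - a)(w' - a') = (1 - a a')(1 - l w')]. *)
Lemma kernel_identity l w :
  Epl l *m (Epl w)^t* - Emi l *m (Emi w)^t* = (1 - l * w^*) *: K l w.
Proof.
have s0 := one_sub_norm_gt0 a1; set s := 1 - _ in s0.
have s1 : sqrtC s * (sqrtC s)^* = 1 - a * a^*.
  by rewrite geC0_conj ?sqrtC_ge0 ?ltW // -expr2 sqrtCK /s normCK.
have s2 : sqrtC s != 0 by rewrite sqrtC_eq0 gt_eqF.
have s3 : (sqrtC s)^* != 0 by rewrite conjC_eq0.
have gram x y (A B : 'M[C]_p) :
    (x / sqrtC s *: A) *m (y / sqrtC s *: B)^t*
    = (x * y^* / (1 - a * a^*)) *: (A *m B^t*).
  rewrite trmxCZ -scalemxAl -scalemxAr scalerA -s1 rmorphM fmorphV.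
  by congr (_ *: _); rewrite invfM mulrACA.
rewrite /Epl /Emi -/s !gram !zfrak_gram.
have cE : (1 - w * a^*)^* = 1 - a * w^*.
  by rewrite rmorphB rmorph1 rmorphM /= conjCK mulrC.
have sE : 1 - a * a^* != 0 by rewrite -normCK gt_eqF.
have V := vanish_ker_reflection Gpos Gtoe l w a0.
have V' : ((1 - l * a^*) * (1 - a * w^*) / (1 - a * a^*)) *:
      (F l *m vanish_ker G a *m (F w)^t*) =
    ((l - a) * (w - a)^* / (1 - a * a^*)) *: (F l *m vanish_ker G b *m (F w)^t*).
  by set D := (1 - a * a^*)^-1; rewrite (mulrC _ D) (mulrC _ D) -scalerA V scalerA.
rewrite cE !scalerBr V' opprB addrA subrK -scalerBl; congr (_ *: _).
rewrite rmorphB /=; move: (a^*) (w^*) sE => a' w' sE.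
by field.
Qed.

Lemma gram_Epl z :
  Epl z *m (Epl z)^t* = Emi z *m (Emi z)^t* + (1 - `|z| ^+ 2) *: K z z.
Proof. by rewrite normCK -kernel_identity addrC subrK. Qed.

Lemma gram_Epl_circle z : `|z| = 1 ->
  Epl z *m (Epl z)^t* = Emi z *m (Emi z)^t*.
Proof. by move=> z1; rewrite gram_Epl z1 expr1n subrr scale0r addr0. Qed.

(** Inside the disc the Gram matrix of [Epl z] dominates a positive multiple of
    the kernel. On the circle, a vector killed by [(Epl z)^t*] is killed by
    [(Emi z)^t*] as well, hence by [HGker G l z] for all [l] in the disc, and
    so is zero. *)
Lemma Epl_unit z : `|z| <= 1 -> Epl z \in unitmx.
Proof.
rewrite le_eqVlt => /orP[/eqP z1|z1]; last first.
  apply: gram_unit; apply: posdef_unit; rewrite gram_Epl addrC.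
  apply: posdefD; [|exact: trmxC_gram|exact: gram_ge0].
  by apply: posdefZ; [exact: HGker_pos|exact: one_sub_norm_gt0].
suff : (Epl z)^t* \in unitmx by rewrite map_unitmx unitmx_tr.
apply: row_ker_unitmx => x Ex.
have Mx : (Emi z)^t* *m x = 0.
  apply: form_eq0; rewrite trmxC_mul trmxCK mulmxA -(mulmxA _ (Emi z)).
  by rewrite -gram_Epl_circle // -!mulmxA Ex !mulmx0 mxE.
apply: (@frowC_inj C p n z).
suff GFx : Gam *m ((F z)^t* *m x) = 0.
  by rewrite -[LHS](mulKVmx (posdef_unit Gpos)) GFx mulmx0.
apply: frow_disc_inj => l l1.
have /eqP := gram_diff_ker (kernel_identity l z) Ex Mx.
rewrite scaler_eq0 subr_eq0 /HGker -!mulmxA => /orP[/eqP lz|/eqP //].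
have : `|l * z^*| < 1 by rewrite normrM norm_conjC z1 mulr1.
by rewrite -lz normr1 ltxx.
Qed.

Lemma Emi_unit z : 1 <= `|z| -> Emi z \in unitmx.
Proof.
rewrite le_eqVlt => /orP[/eqP z1|z1]; apply: gram_unit.
  rewrite -gram_Epl_circle // unitmx_mul Epl_unit ?z1 //=.
  by rewrite map_unitmx unitmx_tr Epl_unit ?z1.
apply: posdef_unit.
have -> : Emi z *m (Emi z)^t* =
    (`|z| ^+ 2 - 1) *: K z z + Epl z *m (Epl z)^t*.
  by rewrite gram_Epl -[_ - 1]opprB scaleNr addrC addrK.
apply: posdefD; [|exact: trmxC_gram|exact: gram_ge0].
by apply: posdefZ; [exact: HGker_pos|rewrite subr_gt0 exprn_egt1].
Qed.

(** The reversed polynomial [z ^+ n.+1 *: Emi z^-1], see [EmiV]. *)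
Definition Erev z : 'M[C]_p :=
  ((1 - a * z) / sqrtC (1 - `|a| ^+ 2)) *: (frev z *m zfrak b).

Lemma EmiV (z : C) : z != 0 -> Emi z^-1 = z ^- n.+1 *: Erev z.
Proof.
move=> z0; rewrite /Emi frowV // -scalemxAl !scalerA; congr (_ *: _).
have zn0 : z ^+ n != 0 by rewrite expf_neq0.
have s2 : sqrtC (1 - `|a| ^+ 2) != 0.
  by rewrite sqrtC_eq0 gt_eqF // one_sub_norm_gt0.
rewrite [z ^+ n.+1]exprS; move: (z ^+ n) (sqrtC _) zn0 s2 => zn s zn0 s2.
by field; rewrite z0 zn0 s2.
Qed.

(** The leading coefficient of [Emi] is invertible. If the kernel function [f] at
    the reflected point had degree less than [n], then [z f] would be in the
    space and have the norm of [f]; since [(1 - a^* z) f] is orthogonal to [f],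
    its squared norm would be [- (1 - |a|^2)] times that of [f]. *)
Lemma frev0_zfrak_inj (x : 'cV[C]_p) :
  frev 0 *m (Gam *m ((F b)^t* *m x)) = 0 -> x = 0.
Proof.
set f := Gam *m _ => f0.
have ac0 : a^* != 0 by rewrite conjC_eq0.
suff f00 : f = 0.
  apply: (@frowC_inj C p n b).
  by rewrite -[LHS](mulKVmx (posdef_unit Gpos)) -/f f00 mulmx0.
have [c fE] := bvecP f.
have cn : c n = 0 by rewrite -frev0_bvec -fE.
pose g := bvec n (bshift c).
have repr u : hform G f u = (x^t* *m (F b *m u)) 0 0.
  rewrite /hform /f !trmxC_mul trmxCK (posdef_inv Gpos).1.
  by rewrite -!mulmxA mulKmx ?posdef_unit.
have fd0 : hform G f (f - a^* *: g) = 0.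
  rewrite repr mulmxBr -scalemxAr frow_bshift // -fE scalerA mulfV //.
  by rewrite scale1r subrr mulmx0 mxE.
have gg : hform G g g = hform G f f by rewrite /hform fE toeplitz_shift.
have hC u v : hform G u v = (hform G v u)^*.
  have -> : (hform G v u)^* = ((v^t* *m G *m u)^t*) 0 0 by rewrite 2!mxE.
  by rewrite !trmxC_mul trmxCK Gpos.1 mulmxA.
have h_ge0 u : 0 <= hform G u u.
  have [->|u0] := eqVneq u 0; last by rewrite ltW // Gpos.2.
  by rewrite /hform mulmx0 mxE.
have fg : hform G f f = a^* * hform G f g.
  by apply/eqP; rewrite -subr_eq0 -hformZr -hformBr fd0.
have gf : a * hform G g f = hform G f f.
  by rewrite [in RHS]hC fg rmorphM /= conjCK -hC.
have d_ge0 := h_ge0 (f - a^* *: g).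
have dE : hform G (f - a^* *: g) (f - a^* *: g) = - (1 - `|a| ^+ 2) * hform G f f.
  rewrite !(hformBl, hformBr, hformZl, hformZr) gg conjCK mulrBr gf -fg normCK.
  by ring.
apply: (hform_eq0 Gpos); apply/eqP; rewrite eq_le h_ge0 andbT.
move: d_ge0; rewrite dE mulNr oppr_ge0 pmulr_rle0 //.
exact: one_sub_norm_gt0.
Qed.

Lemma Erev_unit z : `|z| <= 1 -> Erev z \in unitmx.
Proof.
have [->|z0] := eqVneq z 0 => z1.
  rewrite /Erev mulr0 subr0 unitmxZ; last first.
    by rewrite unitfE mul1r invr_eq0 sqrtC_eq0 gt_eqF // one_sub_norm_gt0.
  rewrite /zfrak !mulmxA unitmx_mul zfrak_unit andbT.
  by apply: row_ker_unitmx => x; rewrite -!mulmxA => /frev0_zfrak_inj.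
have := @Emi_unit z^-1; rewrite EmiV // unitmxZ.
  by apply; rewrite normfV invf_ge1 ?normr_gt0.
by rewrite unitfE invr_eq0 expf_neq0.
Qed.

Lemma contractive_quotient z : `|z| < 1 ->
  contractivemx (invmx (Epl z) *m Emi z).
Proof.
move=> z1; apply: contractive_of_gram => u.
have uE := Epl_unit (ltW z1); set v := (invmx (Epl z))^t* *m u.
have uv : u = (Epl z)^t* *m v by rewrite mulmxA -trmxC_mul mulVmx // trmxC1 mul1mx.
have K0 := (posdefZ (HGker_pos Gpos z) (one_sub_norm_gt0 z1)).
rewrite -subr_ge0.
have -> : (u^t* *m u) 0 0 = (v^t* *m (Epl z *m (Epl z)^t*) *m v) 0 0.
  by rewrite {1 2}uv trmxC_mul trmxCK !mulmxA.
have -> : u^t* *m (invmx (Epl z) *m Emi z *m (invmx (Epl z) *m Emi z)^t*) *m u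
   = v^t* *m (Emi z *m (Emi z)^t*) *m v.
  by rewrite /v !trmxC_mul trmxCK !mulmxA.
rewrite gram_Epl mulmxDr mulmxDl entryD addrAC subrr add0r.
have [->|v0] := eqVneq v 0; first by rewrite mulmx0 mxE.
by rewrite ltW // K0.2.
Qed.


End DeBrangesPair.

(** * Boundary values on the unit circle *)

Section BoundaryIdentities.
Variables (C : numClosedFieldType) (p n : nat).
Local Notation m := (\sum_(j < n.+1) p)%N.
Local Notation F := (@frow C p n).
Variable G : 'M[C]_m.
Hypotheses (Gpos : posdefmx G) (Gtoe : toeplitz G).
Variable a : C.
Hypotheses (a1 : `|a| < 1) (a0 : a != 0).
Local Notation Gam := (invmx G).
Local Notation Ep := (Epl G a).
Local Notation Em := (Emi G a).
Local Notation Er := (Erev G a).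
Local Notation S z := (invmx (Ep z) *m Em z).

Lemma Epl_circle_unit z : `|z| = 1 -> Ep z \in unitmx.
Proof. by move=> z1; apply: Epl_unit; rewrite ?z1. Qed.

Lemma Emi_circle_unit z : `|z| = 1 -> Em z \in unitmx.
Proof. by move=> z1; apply: Emi_unit; rewrite ?z1. Qed.

Lemma trmxC_unit k (A : 'M[C]_k) : (A^t* \in unitmx) = (A \in unitmx).
Proof. by rewrite map_unitmx unitmx_tr. Qed.

Lemma weight_Epl z : `|z| <= 1 -> invmx (Ep z *m (Ep z)^t*) =
  (invmx (Ep z))^t* *m invmx (Ep z).
Proof.
move=> z1; have u := Epl_unit Gpos Gtoe a1 a0 z1.
by rewrite invmxM ?trmxC_unit // trmxC_inv.
Qed.

Lemma weight_Emi z : `|z| = 1 -> invmx (Ep z *m (Ep z)^t*) =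
  (invmx (Em z))^t* *m invmx (Em z).
Proof.
move=> z1; have u := Emi_circle_unit z1.
by rewrite gram_Epl_circle // invmxM ?trmxC_unit // trmxC_inv.
Qed.

(** On the circle [Epl] and [Emi] have the same Gram matrix, so the adjoint
    of the quotient turns [Epl^-1] into [Emi^-1]. *)
Lemma quotient_adjoint z k (v : 'M[C]_(p, k)) : `|z| = 1 ->
  (S z)^t* *m (invmx (Ep z) *m v) = invmx (Em z) *m v.
Proof.
move=> z1; rewrite trmxC_mul !mulmxA -(mulmxA _ _ (invmx (Ep z))).
rewrite -weight_Epl ?z1 // weight_Emi // mulmxA -trmxC_mul mulVmx ?Emi_circle_unit //.
by rewrite trmxC1 mul1mx.
Qed.

Lemma quotient_unitary z : `|z| = 1 -> S z \is unitarymx.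
Proof.
move=> z1; apply/unitarymxP; rewrite trmxC_mul -mulmxA (mulmxA (Em z)).
rewrite -gram_Epl_circle // -mulmxA -trmxC_mul.
by rewrite mulVmx ?Epl_circle_unit // trmxC1 mulmx1 mulVmx ?Epl_circle_unit.
Qed.

Lemma circle_conjV (z : C) : `|z| = 1 -> z^* = z^-1 /\ z != 0.
Proof.
move=> z1; have z0 : z != 0 by rewrite -normr_gt0 z1 ltr01.
by split=> //; rewrite invC_norm z1 expr1n invr1 mul1r.
Qed.

(** On the circle [invmx Em *m F] is conjugate-analytic and vanishes at
    infinity: its reflection carries a factor [z]. *)
Lemma invEmi_frow (z : C) (u : 'cV[C]_m) : `|z| = 1 ->
  invmx (Em z) *m (F z *m u) = z^* *: (invmx (Er z^*) *m (frev p n z^* *m u)).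
Proof.
move=> z1; have [zV z0] := circle_conjV z1; have zc0 : z^* != 0 by rewrite zV invr_eq0.
have uE : Er z^* \in unitmx by apply: Erev_unit => //; rewrite norm_conjC z1.
have {1 2}-> : z = (z^*)^-1 by rewrite zV invrK.
rewrite EmiV // frowV // invmxZ; last first.
  by rewrite unitmxZ // unitfE invr_eq0 expf_neq0.
rewrite -!scalemxAl -!scalemxAr scalerA; congr (_ *: _).
by rewrite invrK exprS -mulrA mulfV ?mulr1 // expf_neq0.
Qed.

(** The two terms of the kernel identity each absorb one form of the weight. *)
Lemma kernel_weight z w (x : 'cV[C]_p) (u : 'cV[C]_m) : `|z| = 1 ->
  1 - w * z^* != 0 ->
  (F z *m (Gam *m (F w)^t* *m x))^t* *m invmx (Ep z *m (Ep z)^t*) *m (F z *m u) =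
  (1 - w * z^*)^-1 *: (x^t* *m Ep w *m (invmx (Ep z) *m (F z *m u)) -
    x^t* *m Em w *m (invmx (Em z) *m (F z *m u))).
Proof.
move=> z1 w1.
have -> : F z *m (Gam *m (F w)^t* *m x) = HGker G z w *m x by rewrite !mulmxA.
have KE : (1 - w * z^*) *: (HGker G z w)^t* =
    Ep w *m (Ep z)^t* - Em w *m (Em z)^t*.
  by rewrite HGkerC // kernel_identity.
rewrite trmxC_mul (gram_diff_apply _ _ _ w1 KE).
congr (_ *: (_ - _)); congr (_ *m (_ *m _)).
  rewrite weight_Epl ?z1 // mulmxA -trmxC_mul mulVmx ?Epl_circle_unit //.
  by rewrite trmxC1 mul1mx.
rewrite weight_Emi // mulmxA -trmxC_mul mulVmx ?Emi_circle_unit //.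
by rewrite trmxC1 mul1mx.
Qed.

Lemma weight_form z (u v : 'cV[C]_m) : `|z| = 1 ->
  (F z *m v)^t* *m invmx (Ep z *m (Ep z)^t*) *m (F z *m u) =
  v^t* *m ((invmx (Ep z) *m F z)^t* *m (invmx (Ep z) *m (F z *m u))).
Proof.
by move=> z1; rewrite weight_Epl ?z1 // !trmxC_mul !mulmxA.
Qed.

Lemma entry_mulZ k l q c (A : 'M[C]_(k, l)) (B : 'M[C]_(l, q)) i j :
  (A *m (c *: B)) i j = c * (A *m B) i j.
Proof. by rewrite -scalemxAr entryZ. Qed.

Lemma kernel_integrand z w (x : 'cV[C]_p) (u : 'cV[C]_m) : `|z| = 1 ->
  1 - w * z^* != 0 ->
  ((F z *m (Gam *m (F w)^t* *m x))^t* *m invmx (Ep z *m (Ep z)^t*)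
    *m (F z *m u)) 0 0 =
  (x^t* *m Ep w *m (invmx (Ep z) *m (F z *m u))) 0 0 * (1 - w * z^*)^-1 +
  (-1) * ((1 - w * z^*)^-1 *
    (z^* * (x^t* *m Em w *m (invmx (Er z^*) *m (frev p n z^* *m u))) 0 0)).
Proof.
move=> z1 wz; rewrite kernel_weight // invEmi_frow // entryZ entryB.
rewrite mulN1r mulrBr [in RHS]mulrC; congr (_ - _ * _).
exact: entry_mulZ.
Qed.

End BoundaryIdentities.

(** * Integrals over intervals *)

Section IntervalIntegral.
Variable R : realType.
Implicit Types (f g : R -> R) (a b c M : R).
Local Notation mu := (@lebesgue_measure R).

Definition ctn_on a b f := forall x, a <= x <= b -> {for x, continuous f}.

Definition rint a b f : R := \int[mu]_(x in `[a, b]) f x.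

Lemma ctn_on_integrable a b f : ctn_on a b f ->
  mu.-integrable `[a, b] (EFin \o f).
Proof.
move=> cf; apply: continuous_compact_integrable; first exact: segment_compact.
by apply: continuous_in_subspaceT => x; rewrite inE /= in_itv /=; exact: cf.
Qed.

Lemma ctn_onW a b a' b' f : a <= a' -> b' <= b -> ctn_on a b f -> ctn_on a' b' f.
Proof.
move=> aa bb cf x /andP[ax xb]; apply: cf.
by rewrite (le_trans aa) //= (le_trans xb).
Qed.

Lemma ctn_onD a b f g : ctn_on a b f -> ctn_on a b g ->
  ctn_on a b (fun x => f x + g x).
Proof. by move=> cf cg x xab; apply: (@continuousD _ R^o); [exact: cf|exact: cg]. Qed.

Lemma ctn_onN a b f : ctn_on a b f -> ctn_on a b (fun x => - f x).
Proof. by move=> cf x xab; apply: (@continuousN _ R^o); exact: cf. Qed.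

Lemma ctn_onB a b f g : ctn_on a b f -> ctn_on a b g ->
  ctn_on a b (fun x => f x - g x).
Proof. by move=> cf cg; exact: ctn_onD cf (ctn_onN cg). Qed.

Lemma ctn_onM a b f g : ctn_on a b f -> ctn_on a b g ->
  ctn_on a b (fun x => f x * g x).
Proof. by move=> cf cg x xab; apply: continuousM; [exact: cf|exact: cg]. Qed.

Lemma ctn_on_cst a b c : ctn_on a b (fun=> c).
Proof. by move=> x _; exact: cst_continuous. Qed.

Lemma eq_rint a b f g : (forall x, a <= x <= b -> f x = g x) ->
  rint a b f = rint a b g.
Proof.
by move=> fg; apply: eq_Rintegral => x; rewrite inE /= in_itv /=; exact: fg.
Qed.

Lemma rintD a b f g : ctn_on a b f -> ctn_on a b g ->
  rint a b (fun x => f x + g x) = rint a b f + rint a b g.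
Proof. by move=> cf cg; apply: RintegralD => //; exact: ctn_on_integrable. Qed.

Lemma rintB a b f g : ctn_on a b f -> ctn_on a b g ->
  rint a b (fun x => f x - g x) = rint a b f - rint a b g.
Proof. by move=> cf cg; apply: RintegralB => //; exact: ctn_on_integrable. Qed.

Lemma rintZ a b c f : ctn_on a b f ->
  rint a b (fun x => c * f x) = c * rint a b f.
Proof. by move=> cf; apply: RintegralZl => //; exact: ctn_on_integrable. Qed.

Lemma rint_cst a b c : a <= b -> rint a b (fun=> c) = c * (b - a).
Proof.
move=> ab; rewrite /rint Rintegral_cst //= lebesgue_measure_itv /= lte_fin.
by case: ltgtP ab => // -> _; rewrite subrr.
Qed.

Lemma le_rint a b f g : ctn_on a b f -> ctn_on a b g ->
  (forall x, a <= x <= b -> f x <= g x) -> rint a b f <= rint a b g.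
Proof.
move=> cf cg fg; apply: le_Rintegral; [by []|exact: ctn_on_integrable..|].
by move=> x; rewrite /= in_itv /=; exact: fg.
Qed.

Lemma rint_bound a b f M : a <= b -> ctn_on a b f ->
  (forall x, a <= x <= b -> `|f x| <= M) -> `|rint a b f| <= M * (b - a).
Proof.
move=> ab cf fM; rewrite ler_norml -mulNr -!rint_cst //; apply/andP; split.
  by apply: le_rint => //;
    [exact: ctn_on_cst|move=> x /fM; rewrite ler_norml => /andP[]].
by apply: le_rint => //; [exact: ctn_on_cst|move=> x /fM; rewrite ler_norml => /andP[]].
Qed.

Lemma rint_split a b c f : a <= c -> c <= b -> ctn_on a b f ->
  rint a b f = rint a c f + rint c b f.
Proof.
move=> ac cb cf; apply/eqP; rewrite addrC -subr_eq; apply/eqP.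
rewrite /rint Rintegral_itvB ?bnd_simp //; last exact: ctn_on_integrable.
apply: Rintegral_itv_obnd_cbnd; apply: integrableS (ctn_on_integrable cf) => //.
by move=> x /=; rewrite !in_itv /= => /andP[/ltW cx ->]; rewrite (le_trans ac).
Qed.

End IntervalIntegral.

(** * Goursat's lemma for closed forms *)

Section Goursat.
Variable R : realType.
Implicit Types (x y a b h k e : R).
Variables P Q : R -> R -> R.

(** The form [P dx + Q dy] is closed when the derivatives of [P] in [y] and of
    [Q] in [x] agree; both are called [p2]. *)
Definition closed_form_at x y := exists p1 p2 q2 : R, forall e, 0 < e ->
  exists2 d : R, 0 < d & forall x' y', `|x' - x| < d -> `|y' - y| < d ->
    `|P x' y' - P x y - (p1 * (x' - x) + p2 * (y' - y))|
       <= e * (`|x' - x| + `|y' - y|) /\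
    `|Q x' y' - Q x y - (p2 * (x' - x) + q2 * (y' - y))|
       <= e * (`|x' - x| + `|y' - y|).

(** The integral of [P dx + Q dy] around the rectangle with corner [(x, y)] and
    sides [a], [b], with opposite sides under the same integral sign. *)
Definition circulation x y a b : R :=
  rint x (x + a) (fun t => P t y - P t (y + b)) +
  rint y (y + b) (fun t => Q (x + a) t - Q x t).

Lemma near_dist_lt x d : 0 < d -> \forall t \near x, `|t - x| < d.
Proof.
by move=> d0; apply/nbhs_ballP; exists d => //= t; rewrite /ball /= distrC.
Qed.

Lemma lipschitz_at_continuous (f : R -> R) x c d : 0 < d ->
  (forall t, `|t - x| < d -> `|f t - f x| <= c * `|t - x|) ->
  {for x, continuous f}.
Proof.
move=> d0 fc; apply/(@cvgrPdist_le _ R^o) => e e0; near=> t.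
have tx : `|t - x| < d by near: t; apply: near_dist_lt.
rewrite distrC (le_trans (fc _ tx)) //.
have c1 : 0 < `|c| + 1 by rewrite ltr_wpDl.
apply: (@le_trans _ _ ((`|c| + 1) * `|t - x|)).
  by rewrite ler_wpM2r // (le_trans (ler_norm c)) // lerDl.
rewrite mulrC -ler_pdivlMr //; apply/ltW; near: t; apply: near_dist_lt.
by rewrite divr_gt0.
Unshelve. all: by end_near. Qed.

Lemma closed_form_continuousP x y : closed_form_at x y ->
  {for x, continuous (P ^~ y)}.
Proof.
move=> [p1 [p2 [q2 /(_ 1 ltr01)[d d0 H]]]].
apply: (@lipschitz_at_continuous _ _ (1 + `|p1|) d) => // t tx.
have [] := H t y tx; first by rewrite subrr normr0.
rewrite subrr mulr0 normr0 !addr0 mul1r => H1 _.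
rewrite -[P t y - _](subrK (p1 * (t - x))) (le_trans (ler_normD _ _)) //.
by rewrite mulrDl mul1r; apply: lerD => //; rewrite normrM.
Qed.

Lemma closed_form_continuousQ x y : closed_form_at x y ->
  {for y, continuous (Q x)}.
Proof.
move=> [p1 [p2 [q2 /(_ 1 ltr01)[d d0 H]]]].
apply: (@lipschitz_at_continuous _ _ (1 + `|q2|) d) => // t ty.
have [] := H x t _ ty; first by rewrite subrr normr0.
rewrite subrr !mulr0 normr0 !add0r mul1r => _ H1.
rewrite -[Q x t - _](subrK (q2 * (t - y))) (le_trans (ler_normD _ _)) //.
by rewrite mulrDl mul1r; apply: lerD => //; rewrite normrM.
Qed.

Definition closed_form_on x y a b := forall s t, x <= s <= x + a ->
  y <= t <= y + b -> closed_form_at s t.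

Lemma closed_form_ctnP x y a b t : closed_form_on x y a b ->
  y <= t <= y + b -> ctn_on x (x + a) (P ^~ t).
Proof. by move=> H ty s sx; apply: closed_form_continuousP; exact: H. Qed.

Lemma closed_form_ctnQ x y a b s : closed_form_on x y a b ->
  x <= s <= x + a -> ctn_on y (y + b) (Q s).
Proof. by move=> H sx t ty; apply: closed_form_continuousQ; exact: H. Qed.

Lemma circulation_quarters x y h k : 0 <= h -> 0 <= k ->
  closed_form_on x y (h + h) (k + k) ->
  circulation x y (h + h) (k + k) =
    circulation x y h k + circulation (x + h) y h k +
    (circulation x (y + k) h k + circulation (x + h) (y + k) h k).
Proof.
move=> h0 k0 H; rewrite /circulation.
have cP t : y <= t <= y + (k + k) -> ctn_on x (x + (h + h)) (P ^~ t).
  exact: closed_form_ctnP.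
have cQ s : x <= s <= x + (h + h) -> ctn_on y (y + (k + k)) (Q s).
  exact: closed_form_ctnQ.
have sP t : y <= t <= y + (k + k) ->
    rint x (x + (h + h)) (P ^~ t) =
    rint x (x + h) (P ^~ t) + rint (x + h) (x + h + h) (P ^~ t).
  by move=> ty; rewrite -addrA; apply: rint_split; [lra|lra|exact: cP].
have sQ s : x <= s <= x + (h + h) ->
    rint y (y + (k + k)) (Q s) =
    rint y (y + k) (Q s) + rint (y + k) (y + k + k) (Q s).
  by move=> sx; rewrite -addrA; apply: rint_split; [lra|lra|exact: cQ].
have dP x1 x2 t1 t2 : x <= x1 -> x2 <= x + (h + h) -> y <= t1 <= y + (k + k) ->
   y <= t2 <= y + (k + k) -> rint x1 x2 (fun t => P t t1 - P t t2) =
   rint x1 x2 (P ^~ t1) - rint x1 x2 (P ^~ t2).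
  by move=> ? ? t1P t2P; apply: rintB; apply: ctn_onW (cP _ _).
have dQ y1 y2 t1 t2 : y <= y1 -> y2 <= y + (k + k) -> x <= t1 <= x + (h + h) ->
   x <= t2 <= x + (h + h) -> rint y1 y2 (fun t => Q t1 t - Q t2 t) =
   rint y1 y2 (Q t1) - rint y1 y2 (Q t2).
  by move=> ? ? t1P t2P; apply: rintB; apply: ctn_onW (cQ _ _).
rewrite !dP; first rewrite !dQ; first rewrite !sP; first rewrite !sQ;
  try by clear -h0 k0; lra.
rewrite -!addrA; ring.
Qed.

Lemma circulation_small x y a b e s t p2 : 0 <= a -> 0 <= b -> 0 <= e ->
  closed_form_on x y a b ->
  x <= s <= x + a -> y <= t <= y + b ->
  (exists p1 q2 : R, forall x' y', x <= x' <= x + a -> y <= y' <= y + b ->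
    `|P x' y' - P s t - (p1 * (x' - s) + p2 * (y' - t))|
       <= e * (`|x' - s| + `|y' - t|) /\
    `|Q x' y' - Q s t - (p2 * (x' - s) + q2 * (y' - t))|
       <= e * (`|x' - s| + `|y' - t|)) ->
  `|circulation x y a b| <= 2 * e * (a + b) ^+ 2.
Proof.
move=> a0 b0 e0 H sx ty [p1 [q2 loc]].
have dist x' y' : x <= x' <= x + a -> y <= y' <= y + b ->
    e * (`|x' - s| + `|y' - t|) <= e * (a + b).
  by move=> ? ?; rewrite ler_wpM2l // lerD // ler_norml; lra.
have xx : x <= x <= x + a by lra.
have xa : x <= x + a <= x + a by lra.
have yy : y <= y <= y + b by lra.
have yb : y <= y + b <= y + b by lra.
have cP t' : y <= t' <= y + b -> ctn_on x (x + a) (P ^~ t').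
  exact: closed_form_ctnP.
have cQ s' : x <= s' <= x + a -> ctn_on y (y + b) (Q s').
  exact: closed_form_ctnQ.
have cPP : ctn_on x (x + a) (fun z => P z y - P z (y + b)).
  by apply: ctn_onB; apply: cP.
have cQQ : ctn_on y (y + b) (fun z => Q (x + a) z - Q x z).
  by apply: ctn_onB; apply: cQ.
(* the linear parts of opposite sides are constants that cancel *)
have -> : circulation x y a b =
    rint x (x + a) (fun z => P z y - P z (y + b) - (- p2 * b)) +
    rint y (y + b) (fun z => Q (x + a) z - Q x z - p2 * a).
  rewrite (rintB cPP (@ctn_on_cst R _ _ _)) (rintB cQQ (@ctn_on_cst R _ _ _)).
  rewrite !rint_cst ?lerDl // /circulation.
  by ring.
have B1 : `|rint x (x + a) (fun z => P z y - P z (y + b) - (- p2 * b))|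
    <= 2 * e * (a + b) * (x + a - x).
  apply: rint_bound; [lra|by apply: ctn_onB => //; exact: ctn_on_cst|].
  move=> z zx; have [] := loc z y zx yy; have [] := loc z (y + b) zx yb.
  have := dist z y zx yy; have := dist z (y + b) zx yb.
  set u := e * (a + b); set u1 := e * _; set u2 := e * _.
  rewrite !ler_norml => ? ? /andP[? ?] _ /andP[? ?] _.
  by rewrite -[2 * e * _]mulrA -/u; apply/andP; split; lra.
have B2 : `|rint y (y + b) (fun z => Q (x + a) z - Q x z - p2 * a)|
    <= 2 * e * (a + b) * (y + b - y).
  apply: rint_bound; [lra|by apply: ctn_onB => //; exact: ctn_on_cst|].
  move=> z zy; have [] := loc x z xx zy; have [] := loc (x + a) z xa zy.
  have := dist x z xx zy; have := dist (x + a) z xa zy.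
  set u := e * (a + b); set u1 := e * _; set u2 := e * _.
  rewrite !ler_norml => ? ? _ /andP[? ?] _ /andP[? ?].
  by rewrite -[2 * e * _]mulrA -/u; apply/andP; split; lra.
apply: (le_trans (ler_normD _ _)); apply: (le_trans (lerD B1 B2)).
by rewrite le_eqVlt; apply/orP; left; apply/eqP; ring.
Qed.

End Goursat.

Section GoursatTheorem.
Variable R : realType.
Variables P Q : R -> R -> R.
Variables x0 y0 a b : R.
Hypotheses (a0 : 0 < a) (b0 : 0 < b).
Hypothesis PQ : closed_form_on P Q x0 y0 a b.
Local Notation circ := (circulation P Q).

Let side (c : R) (k : nat) := c / 2 ^+ k.
Let inside k (s : R * R) := [/\ x0 <= s.1, s.1 + side a k <= x0 + a,
  y0 <= s.2 & s.2 + side b k <= y0 + b].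

Let sideS c k : side c k.+1 + side c k.+1 = side c k.
Proof.
rewrite /side exprS; have := @expf_neq0 R 2 k; rewrite pnatr_eq0 => /(_ isT).
by move: (2 ^+ k) => t t0; field.
Qed.

Let side_gt0 c k : 0 < c -> 0 < side c k.
Proof. by move=> c0; rewrite divr_gt0 // exprn_gt0. Qed.

Let inside_closed k s : inside k s -> closed_form_on P Q s.1 s.2 (side a k) (side b k).
Proof. by case=> ? ? ? ? x y ? ?; apply: PQ; lra. Qed.

Let subrect k (s s' : R * R) := [/\ s.1 <= s'.1,
  s'.1 + side a k.+1 <= s.1 + side a k, s.2 <= s'.2 &
  s'.2 + side b k.+1 <= s.2 + side b k].

Let bisection k s : inside k s -> exists s', [/\ inside k.+1 s', subrect k s s' &
  `|circ s.1 s.2 (side a k) (side b k)| <=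
    4 * `|circ s'.1 s'.2 (side a k.+1) (side b k.+1)| ].
Proof.
move=> ins; have cl := inside_closed ins; move: ins => [x_ge x_le y_ge y_le].
rewrite /inside /subrect.
have h0 := side_gt0 k.+1 a0; have l0 := side_gt0 k.+1 b0.
move: cl x_ge x_le y_ge y_le h0 l0; rewrite -!(sideS _ k).
move: (side a k.+1) (side b k.+1) => h l cl x_ge x_le y_ge y_le h0 l0.
move: s cl x_ge x_le y_ge y_le => [x y] /= cl x_ge x_le y_ge y_le.
have corner u v : 0 <= u <= h -> 0 <= v <= l ->
    [/\ x0 <= x + u, x + u + h <= x0 + a, y0 <= y + v & y + v + l <= y0 + b] /\
    [/\ x <= x + u, x + u + h <= x + (h + h), y <= y + v &
      y + v + l <= y + (l + l)].
  by clear PQ cl; move=> /andP[? ?] /andP[? ?]; split; split; lra.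
have [h1 l1] := (ltW h0, ltW l0); have [oh ol] := (lexx h, lexx l).
rewrite circulation_quarters //.
set q1 := circ x y h l; set q2 := circ (x + h) y h l.
set q3 := circ x (y + l) h l; set q4 := circ (x + h) (y + l) h l.
have : `|q1 + q2 + (q3 + q4)| <= `|q1| + `|q2| + (`|q3| + `|q4|).
  by apply: le_trans (ler_normD _ _) _; apply: lerD; exact: ler_normD.
set V := `|_ + _| => tri.
have [H|H1] := leP V (4 * `|q1|).
  by have [] := corner 0 0; rewrite ?h1 ?l1 ?lexx // !addr0; exists (x, y).
have [H|H2] := leP V (4 * `|q2|).
  by have [] := corner h 0; rewrite ?h1 ?l1 ?lexx // addr0; exists (x + h, y).
have [H|H3] := leP V (4 * `|q3|).
  by have [] := corner 0 l; rewrite ?h1 ?l1 ?lexx // addr0; exists (x, y + l).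
have [] := corner h l; rewrite ?h1 ?l1 ?lexx //; exists (x + h, y + l).
split => //=; rewrite -/q4; move: tri H1 H2 H3; clear.
by move: V `|q1| `|q2| `|q3| `|q4| => V v1 v2 v3 v4 *; lra.
Qed.

(** Repeated bisection keeps a fixed fraction of the circulation per unit of
    area, while differentiability at the limit point makes it negligible. *)
Theorem goursat : circ x0 y0 a b = 0.
Proof.
apply/eqP; apply: contraT => circ0.
have /choice[f fP] : forall ks : nat * (R * R), exists s', inside ks.1 ks.2 ->
    [/\ inside ks.1.+1 s', subrect ks.1 ks.2 s' &
      `|circ ks.2.1 ks.2.2 (side a ks.1) (side b ks.1)| <=
      4 * `|circ s'.1 s'.2 (side a ks.1.+1) (side b ks.1.+1)| ].
  move=> [k s] /=; have [ins|nins] := pselect (inside k s).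
    by have [s' H] := bisection ins; exists s'.
  by exists (0, 0) => /nins.
pose s := fix s k := if k is k'.+1 then f (k', s k') else (x0, y0).
have s_in k : inside k (s k).
  elim: k => [|k IH]; last by have [] := fP (k, s k) IH.
  by rewrite /inside /side expr0 !divr1.
have s_sub k : subrect k (s k) (s k.+1) by have [] := fP (k, s k) (s_in k).
have s_big k : `|circ x0 y0 a b| <=
    4 ^+ k * `|circ (s k).1 (s k).2 (side a k) (side b k)|.
  elim: k => [|k IH]; first by rewrite /side expr0 !divr1 mul1r.
  apply: (le_trans IH); rewrite exprSr -mulrA ler_wpM2l ?exprn_ge0 //.
  by have [] := fP (k, s k) (s_in k).
have nest k j : (k <= j)%N -> [/\ (s k).1 <= (s j).1,
    (s j).1 + side a j <= (s k).1 + side a k, (s k).2 <= (s j).2 &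
    (s j).2 + side b j <= (s k).2 + side b k].
  move=> /subnK <-; elim: (j - k)%N => [|i [? ? ? ?]]; first by split.
  by have [? ? ? ?] := s_sub (i + k)%N; rewrite addSn; split; lra.
have sub_limit (c : R) (pr : R * R -> R) : 0 < c ->
    (forall k j, (k <= j)%N -> pr (s k) <= pr (s j) /\
      pr (s j) + side c j <= pr (s k) + side c k) ->
    exists z, forall k, pr (s k) <= z <= pr (s k) + side c k.
  move=> c0 mono; pose A := range (fun k => pr (s k)).
  have ubA k : ubound A (pr (s k) + side c k).
    move=> _ [j _ <-]; have := side_gt0 j c0; have := side_gt0 k c0.
    by case: (leqP k j) => [|/ltnW] /mono[]; lra.
  have supA : has_sup A.
    by split; [exists (pr (s 0%N)), 0%N|exists (pr (s 0%N) + side c 0)].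
  exists (sup A) => k; apply/andP; split.
    by apply: sup_upper_bound => //; exists k.
  by apply: ge_sup; [case: supA|exact: ubA].
have [x xs] : exists x, forall k, (s k).1 <= x <= (s k).1 + side a k.
  by apply: sub_limit => // k j /nest[].
have [y ys] : exists y, forall k, (s k).2 <= y <= (s k).2 + side b k.
  by apply: sub_limit => // k j /nest[].
have side0 c : side c 0 = c by rewrite /side expr0 divr1.
have [p1 [p2 [q2 loc]]] : closed_form_at P Q x y.
  by apply: PQ; [have := xs 0%N|have := ys 0%N]; rewrite /= side0.
pose e := `|circ x0 y0 a b| / (4 * (a + b) ^+ 2).
have ab0 : 0 < (a + b) ^+ 2 by rewrite exprn_gt0 // addr_gt0.
have e0 : 0 < e by rewrite divr_gt0 ?normr_gt0 // mulr_gt0.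
have [d d0 locd] := loc e e0.
have [k kP] : exists k, side (a + b) k < d.
  have := @cvg_geometric R (a + b) (2^-1) _.
  rewrite gtr0_norm ?invf_lt1 ?ltr1n // => /(_ isT)/cvgrPdist_lt/(_ d d0).
  case=> k _ /(_ k (leqnn k)) /=; rewrite sub0r normrN exprVn gtr0_norm.
    by exists k.
  by rewrite side_gt0 // addr_gt0.
have sideD : side (a + b) k = side a k + side b k by rewrite /side mulrDl.
have sa := side_gt0 k a0; have sb := side_gt0 k b0.
suff : 4 ^+ k * `|circ (s k).1 (s k).2 (side a k) (side b k)| <
    `|circ x0 y0 a b| by rewrite ltNge s_big.
have small := @circulation_small R P Q (s k).1 (s k).2 (side a k) (side b k) e
   x y p2 (ltW sa) (ltW sb) (ltW e0) (inside_closed (s_in k)) (xs k) (ys k).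
have {}small : `|circ (s k).1 (s k).2 (side a k) (side b k)|
    <= 2 * e * (side a k + side b k) ^+ 2.
  apply: small; exists p1, q2 => x' y' x'P y'P; apply: locd; rewrite ltr_norml.
    by have := xs k; lra.
  by have := ys k; lra.
apply: le_lt_trans (ler_wpM2l _ small) _; first by rewrite exprn_ge0.
have -> : 4 ^+ k * (2 * e * (side a k + side b k) ^+ 2) = `|circ x0 y0 a b| / 2.
  have e4 : (2 ^+ k) ^+ 2 = 4 ^+ k :> R by rewrite -exprM mulnC exprM -natrX.
  rewrite -sideD /side /e expr_div_n e4.
  have t0 : (4 ^+ k : R) != 0 by rewrite expf_neq0 // pnatr_eq0.
  move: (4 ^+ k) t0 ((a + b) ^+ 2) (gt_eqF ab0) => t t0 r r0.
  by field; rewrite t0 r0.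
by rewrite ltr_pdivrMr // mulr_natr mulr2n ltrDl normr_gt0.
Qed.

End GoursatTheorem.

(** * Complex differentiability and the exponential map *)

Section ComplexDerivative.

Lemma derivable_affine (K : numFieldType) (f : K^o -> K^o) (x : K^o) (e : K) :
  derivable f x 1 -> 0 < e ->
  exists2 d : K, 0 < d & forall w, `|w - x| < d ->
    `|f w - f x - 'D_1 f x * (w - x)| <= e * `|w - x|.
Proof.
move=> df e0; move/cvgrPdist_le : df => /(_ e e0).
rewrite /dnbhs /within /= => /nbhs_ballP[d /= d0 H]; exists d => // w wx.
have [->|wx0] := eqVneq w x; first by rewrite !subrr !mulr0 subr0 !normr0 mulr0.
have wx1 : w - x != 0 by rewrite subr_eq0.
have := H (w - x); rewrite /ball /= sub0r normrN => /(_ wx wx1).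
rewrite scaler1 subrK distrC => Hw.
have -> : f w - f x - 'D_1 f x * (w - x) =
    ((w - x)^-1 *: (f w - f x) - 'D_1 f x) * (w - x).
  by rewrite mulrBl /GRing.scale /= mulrAC mulVf // mul1r.
by rewrite normrM ler_wpM2r.
Qed.

Lemma derivable_affineP (K : numFieldType) (f : K^o -> K^o) (x : K^o) :
  derivable f x 1 <-> exists D : K, forall e : K, 0 < e ->
    exists2 d : K, 0 < d & forall w, `|w - x| < d ->
      `|f w - f x - D * (w - x)| <= e * `|w - x|.
Proof.
split=> [df|[D H]].
  by exists ('D_1 f x) => e; exact: derivable_affine.
apply/cvg_ex; exists D; apply/cvgrPdist_le => e e0.
have [d d0 Hd] := H e e0.
rewrite /dnbhs /within /=; apply/nbhs_ballP; exists d => // h.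
rewrite /ball /= sub0r normrN => hd h0.
have := Hd (h + x); rewrite addrK => /(_ hd) Hh.
rewrite distrC -(ler_pM2r (x := `|h|)) ?normr_gt0 // -[X in X <= _]normrM.
by rewrite mulrBl /GRing.scale /= mulrAC mulVf // mul1r mulr1.
Qed.

Section Closure.
Variable K : numFieldType.
Implicit Types (f g : K^o -> K^o) (x : K^o).

(** Complex differentiability, with the functions written pointwise, as they
    occur in the entries of matrices. *)
Lemma holo_comp f g x : derivable f (g x) 1 -> derivable g x 1 ->
  derivable (f \o g) x 1.
Proof.
move=> df dg.
have dg' := iffLR (derivable1_diffP g x) dg.
have df' := iffLR (derivable1_diffP f (g x)) df.
apply: (iffRL (derivable1_diffP _ _)).
have H := @differentiable_comp K K^o K^o K^o g f x.
by apply: H.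
Qed.

Lemma holo_continuous f x : derivable f x 1 -> {for x, continuous f}.
Proof. by move=> /derivable1_diffP df; exact: differentiable_continuous. Qed.

Lemma holo_cst (c : K^o) x : derivable (fun=> c : K^o) x 1.
Proof. exact: derivable_cst. Qed.

Lemma holoD f g x : derivable f x 1 -> derivable g x 1 ->
  derivable (fun w => f w + g w : K^o) x 1.
Proof. exact: derivableD. Qed.

Lemma holoB f g x : derivable f x 1 -> derivable g x 1 ->
  derivable (fun w => f w - g w : K^o) x 1.
Proof. exact: derivableB. Qed.

Lemma holoM f g x : derivable f x 1 -> derivable g x 1 ->
  derivable (fun w => f w * g w : K^o) x 1.
Proof. exact: derivableM. Qed.

Lemma holoV f x : f x != 0 -> derivable f x 1 ->
  derivable (fun w => (f w)^-1 : K^o) x 1.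
Proof. exact: derivableV. Qed.

Lemma holoX n x : derivable (fun w : K^o => w ^+ n : K^o) x 1.
Proof.
elim: n => [|n IH]; first exact: holo_cst.
have -> : (fun w : K^o => w ^+ n.+1 : K^o) = fun w => w * w ^+ n.
  by apply/funext => w; rewrite exprS.
by apply: holoM IH; exact: derivable_id.
Qed.

Lemma holo_sum (I : Type) (s : seq I) (P : pred I) (F : I -> K^o -> K^o) x :
  (forall i, P i -> derivable (F i) x 1) ->
  derivable (fun w => \sum_(i <- s | P i) F i w : K^o) x 1.
Proof.
move=> dF; elim: s => [|i s IH].
  rewrite (_ : (fun _ => _) = fun=> 0); first exact: holo_cst.
  by apply/funext => w; rewrite big_nil.
have -> : (fun w : K^o => \sum_(j <- i :: s | P j) F j w : K^o) =
    fun w => (if P i then F i w else 0) + \sum_(j <- s | P j) F j w.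
  by apply/funext => w; rewrite big_cons; case: (P i); rewrite ?add0r.
by apply: holoD IH; case Pi: (P i); [exact: dF|exact: holo_cst].
Qed.

Lemma holo_prod (I : Type) (s : seq I) (P : pred I) (F : I -> K^o -> K^o) x :
  (forall i, P i -> derivable (F i) x 1) ->
  derivable (fun w => \prod_(i <- s | P i) F i w : K^o) x 1.
Proof.
move=> dF; elim: s => [|i s IH].
  rewrite (_ : (fun _ => _) = fun=> 1); first exact: holo_cst.
  by apply/funext => w; rewrite big_nil.
have -> : (fun w : K^o => \prod_(j <- i :: s | P j) F j w : K^o) =
    fun w => (if P i then F i w else 1) * \prod_(j <- s | P j) F j w.
  by apply/funext => w; rewrite big_cons; case: (P i); rewrite ?mul1r.
by apply: holoM IH; case Pi: (P i); [exact: dF|exact: holo_cst].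
Qed.

End Closure.

Section MatrixClosure.
Variable K : numFieldType.
Implicit Type x : K^o.

Definition mxholo k l (A : K -> 'M[K]_(k, l)) x :=
  forall i j, derivable (fun w : K^o => A w i j : K^o) x 1.

Lemma mxholo_cst k l (A : 'M[K]_(k, l)) x : mxholo (fun=> A) x.
Proof. by move=> i j; exact: holo_cst. Qed.

Lemma mxholoM k l q (A : K -> 'M[K]_(k, l)) (B : K -> 'M[K]_(l, q)) x :
  mxholo A x -> mxholo B x -> mxholo (fun w => A w *m B w) x.
Proof.
move=> dA dB i j; under eq_fun do rewrite mxE.
by apply: holo_sum => o _; exact: holoM.
Qed.

Lemma mxholoZ k l (f : K^o -> K^o) (A : K -> 'M[K]_(k, l)) x :
  derivable f x 1 -> mxholo A x -> mxholo (fun w => f w *: A w) x.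
Proof. by move=> df dA i j; under eq_fun do rewrite mxE; exact: holoM. Qed.

Lemma holo_det k (A : K -> 'M[K]_k) x : mxholo A x ->
  derivable (fun w : K^o => \det (A w) : K^o) x 1.
Proof.
move=> dA; apply: holo_sum => s _; apply: holoM; first exact: holo_cst.
by apply: holo_prod => i _.
Qed.

Lemma near_unitmx k (A : K -> 'M[K]_k) x : A x \in unitmx -> mxholo A x ->
  \forall w \near (x : K^o), A w \in unitmx.
Proof.
rewrite unitmxE unitfE => uA /holo_det/holo_continuous cA.
near=> w; rewrite unitmxE unitfE; near: w.
exact: (cvgr_neq0 _ cA uA).
Unshelve. all: by end_near. Qed.

(** Cramer's rule holds in a neighbourhood, since the determinant is continuous. *)
Lemma mxholo_inv k (A : K -> 'M[K]_k) x : A x \in unitmx ->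
  mxholo A x -> mxholo (fun w => invmx (A w)) x.
Proof.
move=> uA dA i j.
have Ainv w : A w \in unitmx ->
    invmx (A w) i j = (\det (A w))^-1 * cofactor (A w) j i.
  by move=> uw; rewrite /invmx uw !mxE.
apply: (@near_eq_derivable _ _ _
    (fun w : K^o => (\det (A w))^-1 * cofactor (A w) j i : K^o)).
  by near=> w; rewrite Ainv //; near: w; exact: near_unitmx.
apply: holoM.
  by apply: holoV; [rewrite -unitfE -unitmxE|exact: holo_det].
apply: holoM; first exact: holo_cst.
by apply: holo_det => s t; under eq_fun do rewrite !mxE; exact: dA.
Unshelve. all: by end_near. Qed.

End MatrixClosure.

End ComplexDerivative.

Section ComplexModulus.
Variable R : realType.
Local Notation C := R[i].
Implicit Types (z w : C) (r s t x y e : R).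

(** The modulus as a real number: norms in [C] are complex numbers. *)
Definition cabs z : R := complex.Re `|z|.

Lemma cabsE z : `|z| = (cabs z)%:C%C.
Proof. by rewrite /cabs normc_def. Qed.

Lemma cabs_sqrt z : cabs z = Num.sqrt (complex.Re z ^+ 2 + complex.Im z ^+ 2).
Proof. by rewrite /cabs normc_def. Qed.

Lemma cabs_ge0 z : 0 <= cabs z.
Proof. by rewrite cabs_sqrt sqrtr_ge0. Qed.

Lemma cabsD z w : cabs (z + w) <= cabs z + cabs w.
Proof. by have := ler_normD z w; rewrite !cabsE -rmorphD lecR. Qed.

Lemma cabsN z : cabs (- z) = cabs z.
Proof. by rewrite /cabs normrN. Qed.

Lemma cabsM z w : cabs (z * w) = cabs z * cabs w.
Proof. by apply: (@complexI R); rewrite rmorphM -!cabsE normrM. Qed.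

Lemma cabs_real r : cabs r%:C%C = `|r|.
Proof. by rewrite cabs_sqrt /= expr0n addr0 sqrtr_sqr. Qed.

Lemma Re_le_cabs z : `|complex.Re z| <= cabs z.
Proof. by have := normc_ge_Re z; rewrite cabsE lecR. Qed.

Lemma Im_le_cabs z : `|complex.Im z| <= cabs z.
Proof.
by rewrite cabs_sqrt -sqrtr_sqr ler_wsqrtr // lerDr sqr_ge0.
Qed.

Lemma cabs_le_ReIm z : cabs z <= `|complex.Re z| + `|complex.Im z|.
Proof.
case: z => a b; rewrite [X in cabs X]complexE /=.
apply: (le_trans (cabsD _ _)); rewrite cabsM !cabs_real.
by rewrite [cabs 'i%C]cabs_sqrt /= expr0n expr1n add0r sqrtr1 mul1r.
Qed.

Lemma ltc_cabs z r : (`|z| < r%:C%C) = (cabs z < r).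
Proof. by rewrite cabsE ltcR. Qed.

Lemma lec_cabs z r : (`|z| <= r%:C%C) = (cabs z <= r).
Proof. by rewrite cabsE lecR. Qed.

Lemma gt0_realC (e : C) : 0 < e -> exists2 r : R, e = r%:C%C & 0 < r.
Proof.
move=> e0; exists (complex.Re e); last by move: e0; rewrite ltcE => /andP[].
by rewrite RRe_real // gtr0_real.
Qed.

Lemma derivable_cabsP (f : C -> C) z : derivable (f : C^o -> C^o) z 1 <->
  exists D : C, forall e, 0 < e -> exists2 d : R, 0 < d &
    forall w, cabs (w - z) < d ->
      cabs (f w - f z - D * (w - z)) <= e * cabs (w - z).
Proof.
rewrite derivable_affineP; split=> -[D H]; exists D => e e0.
  have [|d /gt0_realC[r -> r0] Hd] := H e%:C%C; first by rewrite ltcR.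
  exists r => // w; rewrite -ltc_cabs => /Hd.
  by rewrite !cabsE -rmorphM lecR.
have [r -> r0] := gt0_realC e0; have [d d0 Hd] := H r r0.
exists d%:C%C; first by rewrite ltcR.
by move=> w; rewrite ltc_cabs => /Hd; rewrite !cabsE -rmorphM lecR.
Qed.

Lemma cabs_expi t : cabs (expi t) = 1.
Proof. by rewrite cabs_sqrt /= cos2Dsin2 sqrtr1. Qed.

Lemma expiD s t : expi (s + t) = expi s * expi t.
Proof.
apply/eqP; rewrite eq_complex /= cosD sinD; apply/andP; split=> //.
by rewrite addrC.
Qed.

Lemma expi0 : expi 0 = 1 :> C.
Proof. by apply/eqP; rewrite eq_complex /= cos0 sin0 !eqxx. Qed.

Lemma expi2pi : expi (2 * pi) = 1 :> C.
Proof.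
apply/eqP; rewrite eq_complex /=.
by rewrite mulrC mulr_natr cos2pi sin2pi !eqxx.
Qed.

Lemma cabs_circle_pt r t : 0 <= r -> cabs (circle_pt r t) = r.
Proof. by move=> r0; rewrite cabsM cabs_real cabs_expi mulr1 ger0_norm. Qed.

Definition cexp z : C := circle_pt (expR (complex.Re z)) (complex.Im z).

Lemma cexpD z w : cexp (z + w) = cexp z * cexp w.
Proof.
case: z w => [a b] [c d]; rewrite /cexp /circle_pt /= expRD expiD rmorphM.
by rewrite mulrACA.
Qed.

Lemma is_derive_affine0 (f : R -> R) (D : R) e :
  is_derive (0 : R) (1 : R) f D -> 0 < e ->
  \forall d \near 0^'+, forall u, `|u| < d -> `|f u - f 0 - D * u| <= e * `|u|.
Proof.
move=> [df <-] e0; have [d d0 H] := derivable_affine df e0.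
near=> d'; move=> u ud; have := H u; rewrite subr0; apply.
by apply: (lt_le_trans ud); near: d'; exact: nbhs_right_le.
Unshelve. all: by end_near. Qed.

Lemma polar_remainder (u v al be ga c N : R) : 0 <= c <= 1 ->
  `|u| <= c -> `|u| <= N -> `|v| <= N -> `|al| <= c * `|u| ->
  `|be| <= c * `|v| -> `|ga| <= c * `|v| ->
  `|(1 + u + al) * (1 + be) - 1 - u| + `|(1 + u + al) * (v + ga) - v|
    <= 9 * c * N.
Proof.
move=> /andP[c0 c1] uc uN vN alu bev gav.
have N0 : 0 <= N by exact: le_trans uN.
have alN : `|al| <= c * N by apply: le_trans alu _; rewrite ler_wpM2l.
have beN : `|be| <= c * N by apply: le_trans bev _; rewrite ler_wpM2l.
have gaN : `|ga| <= c * N by apply: le_trans gav _; rewrite ler_wpM2l.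
have alc : `|al| <= c.
  by apply: le_trans alu _; rewrite -[leRHS]mulr1 ler_wpM2l // (le_trans uc).
have E3 : `|1 + u + al| <= 3.
  apply: le_trans (ler_normD _ _) _; apply: le_trans (lerD (ler_normD _ _) alc) _.
  by rewrite normr1; move: c1 uc; clear; move: `|u| => U *; lra.
have E2 : `|u + al| <= 2 * c.
  by apply: le_trans (ler_normD _ _) _; move: uc alc; clear;
    move: `|u| `|al| => U A *; lra.
have -> : (1 + u + al) * (1 + be) - 1 - u = al + (1 + u + al) * be by ring.
have -> : (1 + u + al) * (v + ga) - v = (1 + u + al) * ga + (u + al) * v by ring.
have -> : 9 * c * N = (c * N + 3 * (c * N)) + (3 * (c * N) + 2 * c * N) by ring.
apply: lerD; apply: le_trans (ler_normD _ _) _; apply: lerD => //;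
  by rewrite normrM ler_pM.
Qed.

(** The derivatives at 0 of the real exponential, cosine and sine, assembled by
    [polar_remainder]. *)
Lemma cexp_affine0 e : 0 < e -> exists2 d : R, 0 < d &
  forall w, cabs w < d -> cabs (cexp w - 1 - w) <= e * cabs w.
Proof.
move=> e0.
have E1 := is_derive_affine0 (is_derive_expR 0).
have E2 := is_derive_affine0 (is_derive_cos 0).
have E3 := is_derive_affine0 (is_derive_sin 0).
pose c := Num.min 1 (e / 9).
have c0 : 0 < c by rewrite lt_min ltr01 divr_gt0.
have c1 : c <= 1 by rewrite ge_min lexx.
have ce : 9 * c <= e by rewrite mulrC -ler_pdivlMr // ge_min lexx orbT.
have [d [dc d0 D1 D2 D3]] : exists d, [/\ d <= c, 0 < d,
    forall u, `|u| < d -> `|expR u - expR 0 - expR 0 * u| <= c * `|u|,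
    forall u, `|u| < d -> `|cos u - cos 0 - - sin 0 * u| <= c * `|u| &
    forall u, `|u| < d -> `|sin u - sin 0 - cos 0 * u| <= c * `|u| ].
  apply: (@filter_ex _ (0 : R)^'+); near=> d; split.
  - by near: d; exact: nbhs_right_le.
  - by [].
  - by near: d; exact: E1.
  - by near: d; exact: E2.
  - by near: d; exact: E3.
exists d => // w wd.
have ud := le_lt_trans (Re_le_cabs w) wd; have vd := le_lt_trans (Im_le_cabs w) wd.
have := D1 _ ud; have := D2 _ vd; have := D3 _ vd.
have := Re_le_cabs w; have := Im_le_cabs w.
rewrite expR0 cos0 sin0 !subr0 oppr0 mul0r !mul1r !subr0.
move=> vN uN g3 g2 g1; apply: le_trans (cabs_le_ReIm _) _.
move: (cabs w) wd vN uN ud vd g1 g2 g3 => N wd.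
case: w => u v /= vN uN ud vd g1 g2 g3.
have := @polar_remainder u v (expR u - 1 - u) (cos v - 1) (sin v - v) c N.
have -> : 1 + u + (expR u - 1 - u) = expR u by ring.
rewrite [1 + _]addrC subrK [v + _]addrC subrK.
rewrite !mul0r !subr0 !addr0 => H.
apply: (@le_trans _ _ (9 * c * N)); last by rewrite ler_wpM2r // (le_trans _ uN).
apply: H => //; first by rewrite (ltW c0).
exact: le_trans (ltW ud) dc.
Unshelve. all: by end_near. Qed.

Lemma derivable_cexp z : derivable (cexp : C^o -> C^o) z 1.
Proof.
apply/derivable_cabsP; exists (cexp z) => e e0.
have k0 : 0 < cabs (cexp z) + 1 by rewrite ltr_wpDl ?cabs_ge0.
have [d d0 H] := @cexp_affine0 (e / (cabs (cexp z) + 1)) (divr_gt0 e0 k0).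
exists d => // w wz.
have -> : cexp w - cexp z - cexp z * (w - z) = cexp z * (cexp (w - z) - 1 - (w - z)).
  by rewrite !mulrBr mulr1 -cexpD [z + _]addrC subrK.
rewrite cabsM; apply: (@le_trans _ _ ((cabs (cexp z) + 1) *
   (e / (cabs (cexp z) + 1) * cabs (w - z)))).
  by apply: ler_pM; rewrite ?cabs_ge0 ?lerDl //; exact: H.
by rewrite mulrA mulrCA divff ?gt_eqF // mulr1.
Qed.

End ComplexModulus.

(** * Means over circles *)

Section CircleMeans.
Variable R : realType.
Local Notation C := R[i].
Implicit Types (z w : C) (r s t x y e : R) (f g : C -> C).
Local Notation twopi := (2 * pi : R).

Definition cmean r f : C := circle_mean (fun t => f (circle_pt r t)).

Lemma twopi_gt0 : 0 < twopi.
Proof. by rewrite mulr_gt0 // pi_gt0. Qed.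

Lemma Re_cmean r f : complex.Re (cmean r f) =
  twopi^-1 * rint 0 twopi (fun t => complex.Re (f (circle_pt r t))).
Proof. by []. Qed.

Lemma Im_cmean r f : complex.Im (cmean r f) =
  twopi^-1 * rint 0 twopi (fun t => complex.Im (f (circle_pt r t))).
Proof. by []. Qed.

Lemma derivable_comp_cexp f z : derivable (f : C^o -> C^o) (cexp z) 1 ->
  derivable (f \o @cexp R : C^o -> C^o) z 1.
Proof.
move=> df.
exact (@holo_comp C (f : C^o -> C^o) (@cexp R : C^o -> C^o) z df (@derivable_cexp R z)).
Qed.

(** The Cauchy-Riemann equations say that [Im f dx + Re f dy] is closed. *)
Lemma cauchy_riemann f x y : derivable (f : C^o -> C^o) (x +i* y)%C 1 ->
  closed_form_at (fun s t => complex.Im (f (s +i* t)%C))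
                 (fun s t => complex.Re (f (s +i* t)%C)) x y.
Proof.
move=> /derivable_cabsP[[u v] H].
exists v, u, (- v) => e e0; have [d d0 Hd] := H e e0.
exists (d / 2); first by rewrite divr_gt0.
move=> x' y' dx dy.
have hE : (x' +i* y')%C - (x +i* y)%C = ((x' - x) +i* (y' - y))%C by [].
have le : cabs ((x' - x) +i* (y' - y))%C <= `|x' - x| + `|y' - y|.
  exact: cabs_le_ReIm.
have small : cabs ((x' - x) +i* (y' - y))%C < d.
  by apply: le_lt_trans le _; rewrite [d]splitr ltrD.
have := Hd (x' +i* y')%C; rewrite hE => /(_ small) est.
have {}est := le_trans est (ler_wpM2l (ltW e0) le).
split.
  apply: le_trans est; apply: le_trans (Im_le_cabs _).
  move: (f _) (f _) => [a1 a2] [b1 b2] /=.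
  by rewrite [v * _ + _]addrC.
apply: le_trans est; apply: le_trans (Re_le_cabs _).
by move: (f _) (f _) => [a1 a2] [b1 b2] /=; rewrite mulNr.
Qed.

Lemma circle_pt_periodic r : circle_pt r twopi = circle_pt r 0.
Proof. by rewrite /circle_pt expi2pi expi0. Qed.

(** Pull back along the exponential: the annulus becomes a rectangle of height
    [2 * pi], whose horizontal sides cancel by periodicity and whose vertical
    sides carry the two means. *)
Lemma Re_mean_annulus f r1 r2 : 0 < r1 -> r1 < r2 ->
  (forall z, r1 <= cabs z <= r2 -> derivable (f : C^o -> C^o) z 1) ->
  rint 0 twopi (fun t => complex.Re (f (circle_pt r1 t))) =
  rint 0 twopi (fun t => complex.Re (f (circle_pt r2 t))).
Proof.
move=> r10 r12 df; pose F := f \o @cexp R.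
pose P s t := complex.Im (F (s +i* t)%C); pose Q s t := complex.Re (F (s +i* t)%C).
have r20 : 0 < r2 by exact: lt_trans r12.
have a0 : 0 < ln r2 - ln r1 by rewrite subr_gt0 ltr_ln ?posrE.
have PQ : closed_form_on P Q (ln r1) 0 (ln r2 - ln r1) twopi.
  move=> s t sP _; apply: cauchy_riemann; apply: derivable_comp_cexp.
  apply: df; rewrite /cexp /= cabs_circle_pt ?expR_ge0 //.
  move: sP; rewrite addrC subrK => /andP[s1 s2].
  move: s1 s2; rewrite -(ler_expR (ln r1)) -(ler_expR s) !lnK ?posrE // => -> ->.
  by [].
have := goursat a0 twopi_gt0 PQ.
rewrite /circulation add0r (@eq_rint _ (ln r1) _ _ (fun=> 0)); last first.
  by move=> s _; rewrite /P /F /cexp /= circle_pt_periodic subrr.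
rewrite rint_cst ?lerDl ?(ltW a0) // mul0r add0r.
have cQ s : ln r1 <= s <= ln r1 + (ln r2 - ln r1) -> ctn_on 0 twopi (Q s).
  by move=> sP; rewrite -[twopi]add0r; apply: closed_form_ctnQ PQ _.
rewrite rintB; last 2 first.
- by apply: cQ; rewrite lexx lerDl ltW.
- by apply: cQ; rewrite lexx lerDl ltW.
rewrite [ln r1 + _]addrC subrK => /eqP; rewrite subr_eq0 => /eqP.
by rewrite /Q /F /cexp /= !lnK ?posrE // => ->.
Qed.

Lemma mean_annulus f r1 r2 : 0 < r1 -> r1 <= r2 ->
  (forall z, r1 <= cabs z <= r2 -> derivable (f : C^o -> C^o) z 1) ->
  cmean r1 f = cmean r2 f.
Proof.
move=> r10; rewrite le_eqVlt => /predU1P[->//|r12] df.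
apply/eqP; rewrite eq_complex !Re_cmean !Im_cmean.
rewrite (Re_mean_annulus r10 r12 df) eqxx /=.
have Imf z : complex.Im (f z) = complex.Re (- 'i%C * f z).
  by case: (f z) => u v /=; rewrite oppr0 mul0r sub0r mulN1r opprK.
have e r : rint 0 twopi (fun t => complex.Im (f (circle_pt r t))) =
    rint 0 twopi (fun t => complex.Re (- 'i%C * f (circle_pt r t))).
  by apply: eq_rint => t _; exact: Imf.
rewrite !e; apply/eqP; congr (_ * _).
apply: (@Re_mean_annulus (fun z => - 'i%C * f z) r1 r2 r10 r12) => z zP.
apply: (@holoM C (fun=> - 'i%C) f); first exact: holo_cst.
exact: df.
Qed.

End CircleMeans.

Section CircleMeansTheory.
Variable R : realType.
Local Notation C := R[i].
Implicit Types (z w : C) (r s t x y e : R) (f g : C -> C).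
Local Notation twopi := (2 * pi : R).

Definition ccts f z := {for z, continuous (f : C^o -> C^o)}.

Lemma cvg_cabsP (T : Type) (F : set_system T) (FF : Filter F) (g : T -> C) z :
  (g x : C^o) @[x --> F] --> (z : C^o) <->
  forall e, 0 < e -> \forall x \near F, cabs (g x - z) < e.
Proof.
split=> [/cvgrPdist_lt H e e0|H].
  have /H : 0 < e%:C%C :> C by rewrite ltcR.
  by apply: filterS => x; rewrite distrC ltc_cabs.
apply/cvgrPdist_lt => e /gt0_realC[r -> /H].
by apply: filterS => x; rewrite distrC ltc_cabs.
Qed.

Lemma cctsP f z : ccts f z <-> forall e, 0 < e -> exists2 d : R, 0 < d &
  forall w, cabs (w - z) < d -> cabs (f w - f z) < e.
Proof.
split=> [/(cvg_cabsP (F := nbhs (z : C^o))) H e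
  /H/nbhs_ballP[d /= /gt0_realC[r -> r0] Hr]|H].
  by exists r => // w; rewrite -ltc_cabs distrC => /Hr.
apply/(cvg_cabsP (F := nbhs (z : C^o))) => e /H[d d0 Hd];
  apply/nbhs_ballP; exists d%:C%C => /=.
  by rewrite ltcR.
by move=> w; rewrite /ball /= distrC ltc_cabs => /Hd.
Qed.

Lemma holo_ccts f z : derivable (f : C^o -> C^o) z 1 -> ccts f z.
Proof. exact: (@holo_continuous C f z). Qed.

Lemma ccts_cst (c : C) z : ccts (fun=> c) z.
Proof. exact: (@cst_continuous C^o C^o). Qed.

Lemma ccts_id z : ccts id z.
Proof. by move=> ?; exact. Qed.

Lemma cctsD f g z : ccts f z -> ccts g z -> ccts (fun w => f w + g w) z.
Proof. exact: (@continuousD C C^o C^o f g z). Qed.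

Lemma cctsM f g z : ccts f z -> ccts g z -> ccts (fun w => f w * g w) z.
Proof. exact: (@continuousM C C^o f g z). Qed.

Lemma ccts_conj z : ccts (fun w => w^*) z.
Proof.
apply/cctsP => e e0; exists e => // w wz.
by rewrite -rmorphB /= /cabs normcJ.
Qed.

Lemma ccts_comp f g z : ccts f (g z) -> ccts g z -> ccts (f \o g) z.
Proof. by move=> cf cg; exact (@continuous_comp C^o C^o C^o g f z cg cf). Qed.

Lemma real_continuousP (h : R -> R) t e : {for t, continuous h} -> 0 < e ->
  exists2 d : R, 0 < d & forall t', `|t' - t| < d -> `|h t' - h t| < e.
Proof.
move=> /(@cvgrPdist_lt _ R^o) H e0; have /nbhs_ballP[d /= d0 Hd] := H e e0.
by exists d => // t' tt; rewrite distrC; apply: Hd; rewrite /ball /= distrC.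
Qed.

Lemma circle_pt_near r t e : 0 < e -> exists2 d : R, 0 < d &
  forall r' t', `|r' - r| < d -> `|t' - t| < d ->
  cabs (circle_pt r' t' - circle_pt r t) < e.
Proof.
move=> e0; pose k := e / 3 / (`|r| + 1).
have r1 : 0 < `|r| + 1 by rewrite ltr_wpDl.
have k0 : 0 < k by rewrite !divr_gt0.
have e3 : 0 < e / 3 by rewrite divr_gt0.
have rk : `|r| * k < e / 3.
  by rewrite /k mulrCA -ltr_pdivlMl // mulVf ?gt_eqF // ltr_pdivrMr // mul1r ltrDl.
have [d1 d10 H1] := real_continuousP (@continuous_cos R t) k0.
have [d2 d20 H2] := real_continuousP (@continuous_sin R t) k0.
exists (Num.min (e / 3) (Num.min d1 d2)); first by rewrite !lt_min e3 d10.
move=> r' t'; rewrite !lt_min => /andP[rr _] /andP[_ /andP[/H1 c1 /H2 s1]].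
have -> : circle_pt r' t' - circle_pt r t =
    (r' - r)%:C%C * expi t' + r%:C%C * (expi t' - expi t).
  by rewrite /circle_pt rmorphB mulrBl mulrBr addrA subrK.
apply: le_lt_trans (cabsD _ _) _; rewrite !cabsM !cabs_real cabs_expi mulr1.
have : `|r| * cabs (expi t' - expi t) <= `|r| * k + `|r| * k.
  rewrite -mulrDr ler_wpM2l //; apply: le_trans (cabs_le_ReIm _) _.
  by apply: lerD; apply: ltW.
by move: rk rr; clear; move: (`|r| * cabs _) (`|r| * k) `|r' - r| => A B D *; lra.
Qed.

(** Compactness of the circle makes continuity uniform along it. *)
Lemma circle_tube f r e : (forall t, ccts f (circle_pt r t)) -> 0 < e ->
  exists2 d : R, 0 < d & forall r' t, `|r' - r| < d -> 0 <= t <= twopi ->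
    cabs (f (circle_pt r' t) - f (circle_pt r t)) < e.
Proof.
move=> cf e0.
have e2 : 0 < e / 2 by rewrite divr_gt0.
have /compact_near_coveringP cov := @segment_compact R 0 twopi.
have := cov R (nbhs r) (fun r' t => cabs (f (circle_pt r' t) - f (circle_pt r t)) < e).
case=> [t _|d /= d0 Hd].
- have /cctsP/(_ _ e2)[d d0 Hd] := cf t.
  have [c c0 Hc] := circle_pt_near r t d0.
  exists (ball t c, ball r c); first by split; exact: nbhsx_ballx.
  move=> [t' r'] [/=]; rewrite /ball /= ![`|_ - t'|]distrC ![`|_ - r'|]distrC.
  move=> tt rr; have fr := Hd _ (Hc _ _ rr tt).
  have := Hc r t'; rewrite subrr normr0 => /(_ c0 tt)/Hd ft.
  rewrite -[X in cabs X](subrKA (f (circle_pt r t))).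
  apply: le_lt_trans (cabsD _ _) _.
  by rewrite -[cabs (_ - f (circle_pt r t'))]cabsN opprB [e]splitr ltrD.
exists d => // r' t rr tP; apply: (Hd r') => /=; last by rewrite in_itv.
by rewrite distrC.
Qed.

Lemma circle_cts f r t : ccts f (circle_pt r t) ->
  {for t, continuous (fun t => complex.Re (f (circle_pt r t)))} /\
  {for t, continuous (fun t => complex.Im (f (circle_pt r t)))}.
Proof.
move=> /cctsP cf.
have H e : 0 < e -> \forall t' \near t,
    cabs (f (circle_pt r t') - f (circle_pt r t)) < e.
  move=> /cf[d d0 Hd]; have [c c0 Hc] := circle_pt_near r t d0.
  have := near_dist_lt t c0; apply: filterS => t' tt.
  by apply: Hd; apply: Hc => //; rewrite subrr normr0.
split; apply/(@cvgrPdist_lt _ R^o) => e /H; apply: filterS => t';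
  rewrite distrC -raddfB; apply: le_lt_trans.
  exact: Re_le_cabs.
exact: Im_le_cabs.
Qed.

End CircleMeansTheory.

Section MeanValue.
Variable R : realType.
Local Notation C := R[i].
Implicit Types (z w : C) (r s t x y e : R) (f g : C -> C).
Local Notation twopi := (2 * pi : R).

Definition ccirc r f := forall t, ccts f (circle_pt r t).

Lemma ccirc_ctn r f : ccirc r f ->
  ctn_on 0 twopi (fun t => complex.Re (f (circle_pt r t))) /\
  ctn_on 0 twopi (fun t => complex.Im (f (circle_pt r t))).
Proof. by move=> cf; split=> t _; have [] := circle_cts (cf t). Qed.

Lemma ccirc_cst r (c : C) : ccirc r (fun=> c).
Proof. by move=> t; exact: ccts_cst. Qed.

Lemma ccircD r f g : ccirc r f -> ccirc r g -> ccirc r (fun z => f z + g z).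
Proof. by move=> cf cg t; exact: cctsD (cf t) (cg t). Qed.

Lemma ccircM r f g : ccirc r f -> ccirc r g -> ccirc r (fun z => f z * g z).
Proof. by move=> cf cg t; exact: cctsM (cf t) (cg t). Qed.

Lemma eq_cmean r f g : (forall t, f (circle_pt r t) = g (circle_pt r t)) ->
  cmean r f = cmean r g.
Proof. by move=> fg; rewrite /cmean; congr circle_mean; apply/funext. Qed.

Lemma ReD z w : complex.Re (z + w) = complex.Re z + complex.Re w.
Proof. by case: z w => [? ?] [? ?]. Qed.

Lemma ImD z w : complex.Im (z + w) = complex.Im z + complex.Im w.
Proof. by case: z w => [? ?] [? ?]. Qed.

Lemma cmeanD r f g : ccirc r f -> ccirc r g ->
  cmean r (fun z => f z + g z) = cmean r f + cmean r g.
Proof.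
move=> /ccirc_ctn[cf cf'] /ccirc_ctn[cg cg'].
apply/eqP; rewrite eq_complex ReD ImD !Re_cmean !Im_cmean -!mulrDr -!rintD //.
by apply/andP; split; apply/eqP; congr (_ * _); apply: eq_rint => t _;
   rewrite ?ReD ?ImD.
Qed.

Lemma cmeanZ r (c : C) f : ccirc r f ->
  cmean r (fun z => c * f z) = c * cmean r f.
Proof.
move=> /ccirc_ctn[cf cf'].
apply/eqP; rewrite eq_complex Re_cmean Im_cmean.
rewrite (@eq_rint _ 0 twopi _ (fun t => complex.Re c * complex.Re (f (circle_pt r t))
  - complex.Im c * complex.Im (f (circle_pt r t)))); last first.
  by move=> t _; case: c (f _) => [? ?] [? ?].
rewrite (@eq_rint _ 0 twopi (fun t => complex.Im (c * _))
  (fun t => complex.Re c * complex.Im (f (circle_pt r t))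
  + complex.Im c * complex.Re (f (circle_pt r t)))); last first.
  by move=> t _; case: c (f _) => [? ?] [? ?].
have cZ (k : R) h : ctn_on 0 twopi h -> ctn_on 0 twopi (fun t => k * h t).
  by move=> ch; apply: ctn_onM => //; exact: ctn_on_cst.
rewrite rintB; [|exact: cZ..]; rewrite rintD; [|exact: cZ..].
rewrite !rintZ // [twopi^-1 * (_ - _)]mulrBr [twopi^-1 * (_ + _)]mulrDr.
rewrite !(mulrCA twopi^-1) -!Re_cmean -!Im_cmean.
by case: c (cmean r f) => [? ?] [? ?] /=; rewrite !eqxx.
Qed.

Lemma cmean_cst r (c : C) : cmean r (fun=> c) = c.
Proof.
have k0 : twopi != 0 by rewrite gt_eqF // twopi_gt0.
apply/eqP; rewrite eq_complex Re_cmean Im_cmean !rint_cst ?(ltW (twopi_gt0 R)) //.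
by rewrite !subr0 ![twopi^-1 * _]mulrC !mulfK // !eqxx.
Qed.

Lemma cmean_sum r (I : Type) (s : seq I) (P : pred I) (F : I -> C -> C) :
  (forall i, P i -> ccirc r (F i)) ->
  cmean r (fun z => \sum_(i <- s | P i) F i z) = \sum_(i <- s | P i) cmean r (F i) /\
  ccirc r (fun z => \sum_(i <- s | P i) F i z).
Proof.
move=> cF; elim: s => [|i s [IH IHc]].
  rewrite big_nil (_ : (fun _ => _) = fun=> 0).
    by split; [exact: cmean_cst|exact: ccirc_cst].
  by apply/funext => z; rewrite big_nil.
have cF' : ccirc r (fun z => if P i then F i z else 0).
  by case Pi: (P i); [exact: cF|exact: ccirc_cst].
have -> : (fun z => \sum_(j <- i :: s | P j) F j z) =
    fun z => (if P i then F i z else 0) + \sum_(j <- s | P j) F j z.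
  by apply/funext => z; rewrite big_cons; case: (P i); rewrite ?add0r.
split; last exact: ccircD.
rewrite cmeanD // IH big_cons; case: (P i) => //.
by rewrite cmean_cst add0r.
Qed.

Lemma cmean_conj r f : ccirc r f -> cmean r (fun z => (f z)^*) = (cmean r f)^*.
Proof.
move=> /ccirc_ctn[cf cf']; apply/eqP; rewrite eq_complex.
have Rc z : complex.Re (z^*) = complex.Re z by case: z.
have Ic z : complex.Im (z^*) = (-1) * complex.Im z.
  by case: z => a b; rewrite /= mulN1r.
rewrite Rc Ic !Re_cmean !Im_cmean.
rewrite (@eq_rint _ 0 twopi _ (fun t => complex.Re (f (circle_pt r t)))) ?eqxx //=.
rewrite (@eq_rint _ 0 twopi _ (fun t => (-1) * complex.Im (f (circle_pt r t)))) //.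
by rewrite rintZ // mulrCA.
Qed.

Lemma cmean_bound r f M : ccirc r f ->
  (forall t, 0 <= t <= twopi -> cabs (f (circle_pt r t)) <= M) ->
  cabs (cmean r f) <= 2 * M.
Proof.
move=> /ccirc_ctn[cf cf'] fM; have k0 := twopi_gt0 R.
apply: le_trans (cabs_le_ReIm _) _; rewrite Re_cmean Im_cmean.
have bnd h : ctn_on 0 twopi h -> (forall t, 0 <= t <= twopi -> `|h t| <= M) ->
    `|twopi^-1 * rint 0 twopi h| <= M.
  move=> ch hM; have := rint_bound (ltW k0) ch hM; rewrite subr0 => H.
  by rewrite normrM gtr0_norm ?invr_gt0 // ler_pdivrMl // [twopi * M]mulrC.
have -> : 2 * M = M + M by rewrite mulr_natl mulr2n.
by apply: lerD; apply: bnd => // t tP;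
  apply: le_trans (fM t tP); [exact: Re_le_cabs|exact: Im_le_cabs].
Qed.

Definition ccts_disc f := forall z, cabs z <= 1 -> ccts f z.

Lemma ccts_disc_circ r f : 0 <= r <= 1 -> ccts_disc f -> ccirc r f.
Proof. by move=> /andP[r0 r1] cf t; apply: cf; rewrite cabs_circle_pt. Qed.

Lemma cmean_cts f r e : ccts_disc f -> 0 <= r <= 1 -> 0 < e ->
  exists2 d : R, 0 < d & forall s, 0 <= s <= 1 -> `|s - r| < d ->
    cabs (cmean s f - cmean r f) <= e.
Proof.
move=> cf rP e0; have e2 : 0 < e / 2 by rewrite divr_gt0.
have [d d0 Hd] := circle_tube (ccts_disc_circ rP cf) e2.
exists d => // s sP sr.
(* both means are means over the unit circle of the dilated functions *)
pose fs z := f (s%:C%C * z); pose fr z := f (r%:C%C * z).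
have dil t0 : 0 <= t0 <= 1 -> ccirc 1 (fun z => f (t0%:C%C * z)) /\
    cmean t0 f = cmean 1 (fun z => f (t0%:C%C * z)).
  move=> tP; have E t : t0%:C%C * circle_pt 1 t = circle_pt t0 t.
    by rewrite /circle_pt mul1r.
  split=> [t|]; last by congr circle_mean; apply/funext => t; rewrite E.
  apply: (@ccts_comp _ f (fun z => t0%:C%C * z)).
    by rewrite E; exact: ccts_disc_circ cf t.
  by apply: cctsM; [exact: ccts_cst|exact: ccts_id].
have [cs ->] := dil s sP; have [cr ->] := dil r rP.
have cN : ccirc 1 (fun z => (-1) * f (r%:C%C * z)).
  exact: ccircM (@ccirc_cst 1 (-1)) cr.
have -> : cmean 1 (fun z => f (s%:C%C * z)) - cmean 1 (fun z => f (r%:C%C * z)) =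
   cmean 1 (fun z => f (s%:C%C * z) + (-1) * f (r%:C%C * z)).
  by rewrite (cmeanD cs cN) (cmeanZ _ cr) mulN1r.
have -> : e = 2 * (e / 2) by rewrite mulrC divfK // pnatr_eq0.
apply: cmean_bound; first exact: ccircD cs cN.
move=> t tP; rewrite mulN1r.
by rewrite /circle_pt mul1r; apply: ltW; exact: Hd.
Qed.

(** The means are constant on the open annulus, and they depend continuously on
    the radius up to its boundary. *)
Lemma cmean_closed_annulus f (a b : R) : ccts_disc f -> 0 <= a < b -> b <= 1 ->
  (forall z, a < cabs z < b -> derivable (f : C^o -> C^o) z 1) ->
  cmean a f = cmean b f.
Proof.
move=> cf /andP[a0 ab] b1 df; apply/eqP; rewrite -subr_eq0.
apply/eqP; apply: normr0_eq0; rewrite cabsE; congr (_%:C%C).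
apply/eqP; rewrite eq_le cabs_ge0 andbT; apply/ler_addgt0Pl => e e0; rewrite addr0.
have e2 : 0 < e / 2 by rewrite divr_gt0.
have [d1 d10 H1] : exists2 d : R, 0 < d & forall s, 0 <= s <= 1 -> `|s - a| < d ->
    cabs (cmean s f - cmean a f) <= e / 2.
  by apply: cmean_cts => //; rewrite a0 (le_trans (ltW ab)).
have [d2 d20 H2] : exists2 d : R, 0 < d & forall s, 0 <= s <= 1 -> `|s - b| < d ->
    cabs (cmean s f - cmean b f) <= e / 2.
  by apply: cmean_cts => //; rewrite b1 (le_trans a0 (ltW ab)).
pose k := Num.min ((b - a) / 2) (Num.min (d1 / 2) (d2 / 2)).
have k0 : 0 < k by rewrite !lt_min !divr_gt0 // subr_gt0.
have kab : k <= (b - a) / 2 by rewrite ge_min lexx.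
have kd1 : k <= d1 / 2 by rewrite !ge_min lexx orbT.
have kd2 : k <= d2 / 2 by rewrite !ge_min lexx !orbT.
have M : cmean (a + k) f = cmean (b - k) f.
  apply: mean_annulus; [by clear H1 H2 df cf; lra..|].
  by move=> z /andP[z1 z2]; apply: df; clear H1 H2 cf; lra.
have -> : cmean a f - cmean b f =
    - (cmean (a + k) f - cmean a f) + (cmean (b - k) f - cmean b f).
  by rewrite M opprB addrA subrK.
apply: le_trans (cabsD _ _) _; rewrite cabsN [e]splitr; apply: lerD.
  apply: H1; first by clear H2 df cf; lra.
  by rewrite addrAC subrr add0r gtr0_norm //; clear H2 df cf; lra.
apply: H2; first by clear H1 df cf; lra.
by rewrite addrAC subrr add0r normrN gtr0_norm //; clear H1 df cf; lra.
Qed.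

(** The mean value property survives an exceptional point: the means are
    constant on both sides of its circle, and continuous across it. *)
Lemma mean_value f w : ccts_disc f -> cabs w < 1 ->
  (forall z, cabs z < 1 -> z != w -> derivable (f : C^o -> C^o) z 1) ->
  cmean 1 f = f 0.
Proof.
move=> cf w1 df; have -> : f 0 = cmean 0 f.
  rewrite -[LHS](cmean_cst 0) /cmean; congr circle_mean; apply/funext => t.
  by rewrite /circle_pt mul0r.
rewrite -(@cmean_closed_annulus f (cabs w) 1) ?cabs_ge0 //; last first.
  move=> z /andP[wz z1]; apply: df => //; apply: contraTneq wz => ->.
  by rewrite ltxx.
have [w0|w0] := ltP 0 (cabs w); last first.
  by rewrite (_ : cabs w = 0) //; apply/eqP; rewrite eq_le w0 cabs_ge0.
rewrite -(@cmean_closed_annulus f 0 (cabs w)) ?lexx ?ltW // => z /andP[_ zw].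
apply: df; first exact: lt_trans zw w1.
by apply: contraTneq zw => ->; rewrite ltxx.
Qed.

End MeanValue.

(** * Cauchy's formula *)

Section CauchyFormula.
Variable R : realType.
Local Notation C := R[i].
Implicit Types (z w : C) (r s t x y e : R) (f g : C -> C).
Local Notation twopi := (2 * pi : R).

Definition holo_disc f :=
  forall z, cabs z <= 1 -> derivable (f : C^o -> C^o) z 1.

Lemma holo_disc_circ f : holo_disc f -> ccirc 1 f.
Proof. by move=> df t; apply: holo_ccts; apply: df; rewrite cabs_circle_pt. Qed.

Lemma holo_disc_mean f : holo_disc f -> cmean 1 f = f 0.
Proof.
move=> df; apply: (@mean_value _ f 0).
- by move=> z z1; apply: holo_ccts; exact: df.
- by rewrite /cabs normr0.
- by move=> z z1 _; apply: df; exact: ltW.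
Qed.

Lemma holo_conj f z : derivable (f : C^o -> C^o) (z^*) 1 ->
  derivable ((fun w => (f w^*)^*) : C^o -> C^o) z 1.
Proof.
move=> /derivable_cabsP[D H]; apply/derivable_cabsP; exists D^* => e /H[d d0 Hd].
have cabsJ w : cabs (w^*) = cabs w by rewrite /cabs normcJ.
have cB w1 w2 : (w1 - w2)^* = w1^* - w2^* by exact: rmorphB.
have cM w1 w2 : (w1 * w2)^* = w1^* * w2^* by exact: rmorphM.
exists d => // w wz; have := Hd (w^*); rewrite -cB !cabsJ => /(_ wz).
have -> : f w^* - f z^* - D * (w - z)^* =
    ((f w^*)^* - (f z^*)^* - D^* * (w - z))^*.
  by rewrite !cB cM !cB !conjCK.
by rewrite cabsJ.
Qed.

Lemma circle_conj t : (circle_pt 1 t)^* = (circle_pt 1 t)^-1.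
Proof.
have H : circle_pt 1 t * (circle_pt 1 t)^* = 1.
  by rewrite -normCK cabsE cabs_circle_pt ?ler01 // expr1n.
have z0 : circle_pt 1 t != 0.
  by apply: contra_eq_neq H => ->; rewrite mul0r eq_sym oner_neq0.
by apply: (mulfI z0); rewrite H mulfV.
Qed.

Lemma cabs_eq0 z : cabs z = 0 -> z = 0.
Proof. by move=> z0; apply/normr0_eq0; rewrite cabsE z0. Qed.

Lemma circle_pt_neq0 t : circle_pt 1 t != 0.
Proof.
apply/eqP => z0; have := cabs_circle_pt t (@ler01 R).
by rewrite z0 /cabs normr0 => /eqP; rewrite eq_sym oner_eq0.
Qed.

(** On the unit circle, reflection amounts to conjugating the mean. *)
Lemma holo_disc_mean_conj f : holo_disc f -> cmean 1 (fun z => f (z^*)) = f 0.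
Proof.
move=> df; have dg : holo_disc (fun z => (f z^*)^*).
  by move=> z z1; apply: holo_conj; apply: df; rewrite /cabs normcJ.
rewrite (@eq_cmean _ 1 _ (fun z => ((f z^*)^*)^*)) => [|t]; last by rewrite conjCK.
rewrite (cmean_conj (holo_disc_circ dg)) (holo_disc_mean dg) conjCK.
by rewrite rmorph0.
Qed.

Lemma one_sub_neq0 z : cabs z < 1 -> 1 - z != 0.
Proof.
apply: contraTneq => /subr0_eq <-.
by rewrite /cabs normr1 ltxx.
Qed.

Lemma holo_id z : derivable (id : C^o -> C^o) z 1.
Proof. exact: derivable_id. Qed.

Lemma holo_disc_geometric w : cabs w < 1 -> holo_disc (fun z => (1 - w * z)^-1).
Proof.
move=> w1 z z1; apply: (@holoV C (fun z => 1 - w * z)).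
  apply: one_sub_neq0; rewrite cabsM; apply: le_lt_trans w1.
  by rewrite -[leRHS]mulr1 ler_wpM2l ?cabs_ge0.
apply: (@holoB C (fun=> 1) (fun z => w * z)); first exact: holo_cst.
by apply: (@holoM C (fun=> w) id); [exact: holo_cst|exact: holo_id].
Qed.

Lemma cauchy_kernel_conj w z : (1 - w * z^*)^-1 = ((1 - w^* * z)^-1)^*.
Proof. by rewrite fmorphV rmorphB rmorph1 rmorphM /= conjCK. Qed.

Lemma cauchy_kernel_circ w : cabs w < 1 -> ccirc 1 (fun z => (1 - w * z^*)^-1).
Proof.
move=> w1; have := @holo_disc_circ _ (@holo_disc_geometric (w^*) _).
rewrite /cabs normcJ => /(_ w1) H t.
have -> : (fun z => (1 - w * z^*)^-1) = (fun z => ((1 - w^* * z)^-1)^*).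
  by apply/funext => z; rewrite cauchy_kernel_conj.
apply: (@ccts_comp _ (fun z => z^*) (fun z => (1 - w^* * z)^-1)).
  exact: ccts_conj.
exact: H.
Qed.

Lemma cauchy_kernel_mean w : cabs w < 1 -> cmean 1 (fun z => (1 - w * z^*)^-1) = 1.
Proof.
move=> w1; have dg : holo_disc (fun z => (1 - w^* * z)^-1).
  by apply: holo_disc_geometric; rewrite /cabs normcJ.
rewrite (@eq_cmean R 1 _ (fun z => ((1 - w^* * z)^-1)^*)) => [|t]; last first.
  exact: cauchy_kernel_conj.
rewrite (cmean_conj (holo_disc_circ dg)) (holo_disc_mean dg).
by rewrite mulr0 subr0 invr1 rmorph1.
Qed.

(** The difference quotient of [f] at [w] is continuous, and holomorphic away
    from [w]; the mean value property applied to [z] times this quotient is the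
    formula, because [z^*] is the inverse of [z] on the circle. *)
Theorem cauchy_formula f w : holo_disc f -> cabs w < 1 ->
  cmean 1 (fun z => f z * (1 - w * z^*)^-1) = f w.
Proof.
move=> df w1; have /derivable_cabsP[D HD] := df w (ltW w1).
(* the difference quotient, extended by continuity at its only bad point *)
pose q z := if z == w then D else (f z - f w) / (z - w).
have dq z : cabs z <= 1 -> z != w -> derivable (q : C^o -> C^o) z 1.
  move=> z1 zw; apply: (@near_eq_derivable C C^o C^o
    (fun u => (f u - f w) / (u - w))).
    near=> u; have -> // : q u = (f u - f w) / (u - w).
    rewrite /q ifN // -subr_eq0; near: u.
    have c : ccts (fun u => u - w) z by apply: cctsD; [exact: ccts_id|exact: ccts_cst].
    by apply: (cvgr_neq0 _ c); rewrite subr_eq0.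
  apply: (@holoM C (fun u => f u - f w) (fun u => (u - w)^-1)).
    by apply: (@holoB C f (fun=> f w)); [exact: df|exact: holo_cst].
  apply: (@holoV C (fun u => u - w)); first by rewrite subr_eq0.
  by apply: (@holoB C id (fun=> w)); [exact: holo_id|exact: holo_cst].
have cq z : cabs z <= 1 -> ccts q z.
  move=> z1; have [->|zw] := eqVneq z w; last by apply: holo_ccts; exact: dq.
  apply/cctsP => e e0; have e2 : 0 < e / 2 by rewrite divr_gt0.
  have [d d0 Hd] := HD _ e2; exists d => // u ud.
  rewrite {2}/q eqxx /q; case: eqVneq => [_|uw].
    by rewrite subrr /cabs normr0.
  have uw0 : u - w != 0 by rewrite subr_eq0.
  have uw1 : 0 < cabs (u - w).
    by rewrite lt_def cabs_ge0 andbT; apply: contraNneq uw0 => /cabs_eq0 ->.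
  rewrite -(ltr_pM2r uw1) -cabsM mulrBl divfK //.
  apply: le_lt_trans (Hd u ud) _; rewrite ltr_pM2r //.
  by rewrite ltr_pdivrMr // mulr_natr mulr2n ltrDl.
have zq : cmean 1 (fun z => z * q z) = 0.
  have cF : ccts_disc (fun z => z * q z).
    by move=> z z1; apply: cctsM; [exact: ccts_id|exact: cq].
  have dF z : cabs z < 1 -> z != w ->
      derivable ((fun z => z * q z) : C^o -> C^o) z 1.
    move=> z1 zw; apply: (@holoM C id q); first exact: holo_id.
    by apply: dq => //; exact: ltW.
  exact: etrans (mean_value cF w1 dF) (mul0r _).
have circ t : f (circle_pt 1 t) * (1 - w * (circle_pt 1 t)^*)^-1 =
    circle_pt 1 t * q (circle_pt 1 t) + f w * (1 - w * (circle_pt 1 t)^*)^-1.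
  have z1 := cabs_circle_pt t (@ler01 R); have zz := circle_pt_neq0 t.
  rewrite circle_conj; move: (circle_pt 1 t) z1 zz => z z1 z0.
  have zw : z != w by apply: contraTneq w1 => <-; rewrite z1 ltxx.
  rewrite /q ifN //; have zw0 : z - w != 0 by rewrite subr_eq0.
  have -> : (1 - w * z^-1)^-1 = z / (z - w).
    by rewrite -[1 in LHS](divff z0) -mulrBl invfM invrK mulrC.
  rewrite [z * (_ / _)]mulrA [z * (_ - _)]mulrC -mulrA -mulrDl subrK.
  by [].
rewrite (@eq_cmean R 1 _ (fun z => z * q z + f w * (1 - w * z^*)^-1) circ)
  cmeanD; last 2 first.
- by move=> t; apply: cctsM; [exact: ccts_id|apply: cq; rewrite cabs_circle_pt].
- by apply: ccircM; [exact: ccirc_cst|exact: cauchy_kernel_circ].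
by rewrite zq add0r cmeanZ ?cauchy_kernel_mean ?mulr1 //; exact: cauchy_kernel_circ.
Unshelve. all: by end_near. Qed.

End CauchyFormula.

(** * Entire functions with bounded spectrum *)

Section EntirePolynomials.
Variable R : realType.
Local Notation C := R[i].
Implicit Types (z w : C) (r s t x y e : R) (f g : C -> C).
Local Notation twopi := (2 * pi : R).

Lemma circle_bounded r f : ccirc r f ->
  exists2 M : R, 0 <= M & forall t, 0 <= t <= twopi -> cabs (f (circle_pt r t)) <= M.
Proof.
move=> /ccirc_ctn[c1 c2].
have bnd h : ctn_on 0 twopi h -> exists M, forall t, 0 <= t <= twopi -> `|h t| <= M.
  move=> ch; have [|t _ tmax] := @EVT_max R (fun t => `|h t|) 0 twopi
    (ltW (twopi_gt0 R)).
    apply: continuous_in_subspaceT => t; rewrite inE /= in_itv /= => /ch cht.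
    exact: (@continuous_comp R^o R^o R^o h (fun x => `|x|) t cht
      (@norm_continuous R R^o _)).
  by exists `|h t| => s sP; apply: tmax; rewrite in_itv.
have [[M1 H1] [M2 H2]] := (bnd _ c1, bnd _ c2).
have H t : 0 <= t <= twopi -> cabs (f (circle_pt r t)) <= M1 + M2.
  by move=> tP; apply: le_trans (cabs_le_ReIm _) _; apply: lerD; [exact: H1|exact: H2].
exists (M1 + M2) => //; apply: le_trans (H 0 _); first exact: cabs_ge0.
by rewrite lexx ltW // twopi_gt0.
Qed.

(** Used to discard the remainder of a geometric series. *)
Lemma cabs_small_eq0 z (w : C) (M : R) N : 0 <= M -> cabs w < 1 ->
  (forall k, (N <= k)%N -> cabs z <= cabs w ^+ k * M) -> z = 0.
Proof.
move=> M0 w1 H; apply: cabs_eq0; apply/eqP; rewrite eq_le cabs_ge0 andbT.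
apply/ler_addgt0Pl => e e0; rewrite addr0.
have := @cvg_geometric R M (cabs w) _.
rewrite ger0_norm ?cabs_ge0 // => /(_ w1)/cvgrPdist_lt/(_ e e0)[k _ Hk].
apply: le_trans (H (maxn N k) (leq_maxl _ _)) _.
have /= := Hk (maxn N k) (leq_maxr _ _); rewrite sub0r normrN => /ltW.
by rewrite mulrC; apply: le_trans; exact: ler_norm.
Qed.

Lemma cabs_expr w k : cabs (w ^+ k) = cabs w ^+ k.
Proof.
elim: k => [|k IH]; first by rewrite !expr0 /cabs normr1.
by rewrite !exprS cabsM IH.
Qed.

(** Expand the Cauchy kernel as a finite geometric sum. Its terms produce the
    Fourier coefficients, and the remainder is of the order of [w ^+ N]. *)
Lemma holo_disc_coef_poly f n w : holo_disc f -> cabs w < 1 ->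
  (forall k, (n < k)%N -> cmean 1 (fun z => (z^*) ^+ k * f z) = 0) ->
  f w = \sum_(k < n.+1) w ^+ k * cmean 1 (fun z => (z^*) ^+ k * f z).
Proof.
move=> df w1 fk; have cf := holo_disc_circ df.
pose K z := (1 - w * z^*)^-1; have cK : ccirc 1 K by exact: cauchy_kernel_circ.
have cX k : ccirc 1 (fun z => (z^*) ^+ k).
  move=> t; apply: (@ccts_comp _ (fun z => z ^+ k) (fun z => z^*)).
    by apply: holo_ccts; exact: (@holoX C k).
  exact: ccts_conj.
have cXf k : ccirc 1 (fun z => (z^*) ^+ k * f z).
  exact (@ccircM R 1 (fun z => (z^*) ^+ k) f (cX k) cf).
have [M M0 HM] := circle_bounded (ccircM cf cK).
apply/eqP; rewrite -subr_eq0; apply/eqP.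
apply: (@cabs_small_eq0 _ w (2 * M) n.+1) => //; first by rewrite mulr_ge0.
move=> N nN.
have expand t : f (circle_pt 1 t) * K (circle_pt 1 t) =
    \sum_(k < N) w ^+ k * ((circle_pt 1 t)^* ^+ k * f (circle_pt 1 t)) +
    w ^+ N * ((circle_pt 1 t)^* ^+ N * (f (circle_pt 1 t) * K (circle_pt 1 t))).
  set z := circle_pt 1 t.
  have x1 : 1 - w * z^* != 0.
    apply: one_sub_neq0; rewrite cabsM [cabs z^*]/cabs normcJ -/(cabs z).
    by rewrite cabs_circle_pt // mulr1.
  have geo : K z = \sum_(k < N) (w * z^*) ^+ k + (w * z^*) ^+ N * K z.
    apply: (mulfI x1); rewrite mulrDr mulrCA /K divff // mulr1.
    by rewrite -[1 - _]opprB mulNr -subrX1 opprB subrK.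
  rewrite {1}geo mulrDr mulr_sumr; congr (_ + _); last by rewrite exprMn; ring.
  by apply: eq_bigr => k _; rewrite exprMn mulrC mulrA.
have cw k : ccirc 1 (fun z => w ^+ k * ((z^*) ^+ k * f z)).
  by apply: ccircM; [exact: ccirc_cst|exact: cXf].
have cXN : ccirc 1 (fun z => (z^*) ^+ N * (f z * K z)).
  by apply: ccircM; [exact: cX|exact: ccircM].
have [Sm Sc] := @cmean_sum R 1 'I_N (index_enum _) xpredT
  (fun k z => w ^+ k * ((z^*) ^+ k * f z)) (fun k _ => cw k).
have := cauchy_formula df w1.
rewrite (@eq_cmean R 1 _ (fun z => \sum_(k < N) w ^+ k * ((z^*) ^+ k * f z) +
  w ^+ N * ((z^*) ^+ N * (f z * K z))) expand).
rewrite (cmeanD Sc (ccircM (@ccirc_cst R 1 (w ^+ N)) cXN)) Sm (cmeanZ _ cXN) => <-.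
pose c k := cmean 1 (fun z => (z^*) ^+ k * f z).
have -> : \sum_(k < N) cmean 1 (fun z => w ^+ k * ((z^*) ^+ k * f z)) =
    \sum_(k < n.+1) w ^+ k * c k.
  transitivity (\sum_(k < N | (k < n.+1)%N) w ^+ k * c k); last first.
    by rewrite -(big_ord_widen N (fun k => w ^+ k * c k) nN).
  rewrite [RHS]big_mkcond; apply: eq_bigr => k _; rewrite (cmeanZ _ (cXf k)).
  by case: ltnP => // nk; rewrite fk // mulr0.
rewrite addrAC subrr add0r cabsM cabs_expr ler_wpM2l ?exprn_ge0 ?cabs_ge0 //.
apply: cmean_bound => // t tP; rewrite cabsM cabs_expr.
have -> : cabs (circle_pt 1 t)^* = 1 by rewrite /cabs normcJ -/(cabs _) cabs_circle_pt.
by rewrite expr1n mul1r; exact: HM.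
Qed.

(** Rescaling moves any point into the unit disc, where [holo_disc_coef_poly]
    applies; by [mean_annulus] the Fourier coefficients scale accordingly. *)
Theorem entire_coef_poly f n :
  (forall z, derivable (f : C^o -> C^o) z 1) ->
  (forall k, (n < k)%N -> cmean 1 (fun z => (z^*) ^+ k * f z) = 0) ->
  forall w, f w = \sum_(k < n.+1) w ^+ k * cmean 1 (fun z => (z^*) ^+ k * f z).
Proof.
move=> df fk w; pose r := cabs w + 1; pose c : C := r%:C%C.
have r1 : 1 <= r by rewrite lerDr cabs_ge0.
have r0 : 0 < r by exact: lt_le_trans r1.
have c0 : c != 0 by apply/eqP => /complexI/eqP; rewrite gt_eqF.
pose g z := f (c * z).
have dg : holo_disc g.
  move=> z _; apply: (@holo_comp C f (fun z => c * z)); first exact: df.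
  by apply: (@holoM C (fun=> c) id); [exact: holo_cst|exact: holo_id].
have coef k : cmean 1 (fun z => (z^*) ^+ k * g z) =
    c ^+ k * cmean 1 (fun z => (z^*) ^+ k * f z).
  pose h z := (z ^+ k)^-1 * f z.
  have dh z : z != 0 -> derivable (h : C^o -> C^o) z 1.
    move=> z0; apply: (@holoM C (fun z => (z ^+ k)^-1) f); last exact: df.
    apply: (@holoV C (fun z => z ^+ k)); first by rewrite expf_neq0.
    exact: (@holoX C k).
  have h1 t : (circle_pt 1 t)^* ^+ k * f (circle_pt 1 t) = h (circle_pt 1 t).
    by rewrite /h circle_conj exprVn.
  have hr : cmean 1 h = cmean r h.
    apply: mean_annulus => // z /andP[z1 _]; apply: dh.
    by apply: contraTneq z1 => ->; rewrite /cabs normr0 -ltNge.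
  rewrite [in RHS](@eq_cmean R 1 _ h h1) hr.
  have hc : ccirc 1 (fun z => h (c * z)).
    move=> t; apply: holo_ccts; apply: (@holo_comp C h (fun z => c * z)).
      by apply: dh; rewrite mulf_neq0 // circle_pt_neq0.
    by apply: (@holoM C (fun=> c) id); [exact: holo_cst|exact: holo_id].
  have -> : cmean r h = cmean 1 (fun z => h (c * z)).
    by congr circle_mean; apply/funext => t; rewrite /circle_pt mul1r.
  rewrite -(cmeanZ _ hc); apply: eq_cmean => t; rewrite /h /g circle_conj.
  move: (circle_pt 1 t) => z; rewrite exprMn invfM exprVn !mulrA.
  by rewrite divff ?mul1r // expf_neq0.
have wr : cabs (w / c) < 1.
  have : cabs (w / c) * r = cabs w.
    by rewrite -[r in LHS](ger0_norm (ltW r0)) -cabs_real -cabsM divfK.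
  by move=> e; rewrite -(ltr_pM2r r0) e mul1r ltrDl.
have gk k : (n < k)%N -> cmean 1 (fun z => (z^*) ^+ k * g z) = 0.
  by move=> nk; rewrite coef fk // mulr0.
have := holo_disc_coef_poly dg wr gk; rewrite {1}/g mulrC divfK // => ->.
apply: eq_bigr => k _; rewrite coef mulrA -exprMn divfK //.
Qed.

End EntirePolynomials.

(** * Holomorphy and spectra of the de Branges pair *)

Section MatrixContinuity.
Variable R : realType.
Local Notation C := R[i].
Implicit Types (z w : C) (r s t x y e : R) (f g : C -> C).

Definition mxccts k l (A : C -> 'M[C]_(k, l)) z :=
  forall i j, ccts (fun w => A w i j) z.

Lemma mxholo_ccts k l (A : C -> 'M[C]_(k, l)) z :
  mxholo A z -> mxccts A z.
Proof. by move=> dA i j; exact: holo_ccts (dA i j). Qed.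

Lemma ccts_sum (I : Type) (s : seq I) (F : I -> C -> C) z :
  (forall i, ccts (F i) z) -> ccts (fun w => \sum_(i <- s) F i w) z.
Proof.
move=> cF; elim: s => [|i s IH].
  by under eq_fun do rewrite big_nil; exact: ccts_cst.
under eq_fun do rewrite big_cons.
exact (@cctsD R (F i) (fun w => \sum_(j <- s) F j w) z (cF i) IH).
Qed.

Lemma mxcctsM k l q (A : C -> 'M[C]_(k, l)) (B : C -> 'M[C]_(l, q)) z :
  mxccts A z -> mxccts B z -> mxccts (fun w => A w *m B w) z.
Proof.
move=> cA cB i j; under eq_fun do rewrite mxE.
by apply: ccts_sum => o; exact: cctsM (cA i o) (cB o j).
Qed.

Lemma mxccts_adj k l (A : C -> 'M[C]_(k, l)) z :
  mxccts A z -> mxccts (fun w => (A w)^t*) z.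
Proof.
move=> cA i j; under eq_fun do rewrite !mxE.
exact (@ccts_comp R (fun z => z^*) (fun w => A w j i) z (@ccts_conj R _) (cA j i)).
Qed.

End MatrixContinuity.

Section ModelHolomorphy.
Variables (C : numClosedFieldType) (p n : nat).
Local Notation m := (\sum_(j < n.+1) p)%N.
Local Notation F := (@frow C p n).

Lemma frow_entry (z : C) i j :
  F z i j = if i == tagnat.sig2 j then z ^+ tagnat.sig1 j else 0.
Proof. by rewrite !mxE; case: (i == _). Qed.

Lemma mxholo_frow z : mxholo F z.
Proof.
move=> i j.
have -> : (fun w : C^o => F w i j : C^o) =
    fun w => if i == tagnat.sig2 j then w ^+ tagnat.sig1 j else 0.
  by apply/funext => w; rewrite frow_entry.
by case: (i == _); [exact: holoX|exact: holo_cst].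
Qed.

Lemma mxholo_frev z : mxholo (@frev C p n) z.
Proof.
move=> i j.
have -> : (fun w : C^o => frev p n w i j : C^o) =
    fun w => if i == tagnat.sig2 j then w ^+ (n - tagnat.sig1 j) else 0.
  by apply/funext => w; rewrite !mxE; case: (i == _).
by case: (i == _); [exact: holoX|exact: holo_cst].
Qed.

Lemma mxholo_poly (u : 'cV[C]_m) z : mxholo (fun w => F w *m u) z.
Proof. by apply: mxholoM; [exact: mxholo_frow|exact: mxholo_cst]. Qed.

Variable G : 'M[C]_m.
Hypotheses (Gpos : posdefmx G) (Gtoe : toeplitz G).
Variable a : C.
Hypotheses (a1 : `|a| < 1) (a0 : a != 0).
Local Notation Ep := (Epl G a).
Local Notation Em := (Emi G a).
Local Notation Er := (Erev G a).

Let holo_affine (b c d : C) z : derivable (fun w : C^o => (b - c * w) * d : C^o) z 1.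
Proof.
apply: holoM; last exact: holo_cst.
apply: holoB; first exact: holo_cst.
by apply: holoM; [exact: holo_cst|exact: derivable_id].
Qed.

Lemma mxholo_Epl z : mxholo Ep z.
Proof.
apply: mxholoZ.
  rewrite (_ : (fun _ => _) = fun w : C^o =>
    (1 - a^* * w) * (sqrtC (1 - `|a| ^+ 2))^-1); first exact: holo_affine.
  by apply/funext => w; rewrite mulrC [w * _]mulrC mulrC.
by apply: mxholoM; [exact: mxholo_frow|exact: mxholo_cst].
Qed.

Lemma mxholo_Emi z : mxholo Em z.
Proof.
apply: mxholoZ.
  rewrite (_ : (fun _ => _) = fun w : C^o =>
    (- a - (- 1) * w) * (sqrtC (1 - `|a| ^+ 2))^-1); first exact: holo_affine.
  by apply/funext => w; rewrite mulN1r opprK [- a + w]addrC.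
by apply: mxholoM; [exact: mxholo_frow|exact: mxholo_cst].
Qed.

Lemma mxholo_Erev z : mxholo Er z.
Proof.
apply: mxholoZ; first exact: holo_affine.
by apply: mxholoM; [exact: mxholo_frev|exact: mxholo_cst].
Qed.

Lemma mxholo_invEpl z : `|z| <= 1 -> mxholo (fun w => invmx (Ep w)) z.
Proof. by move=> z1; apply: mxholo_inv; [exact: Epl_unit|exact: mxholo_Epl]. Qed.

Lemma mxholo_quotient z : `|z| <= 1 -> mxholo (fun w => invmx (Ep w) *m Em w) z.
Proof.
by move=> z1; apply: mxholoM; [exact: mxholo_invEpl|exact: mxholo_Emi].
Qed.

Lemma mxholo_invEpl_poly (u : 'cV[C]_m) z : `|z| <= 1 ->
  mxholo (fun w => invmx (Ep w) *m (F w *m u)) z.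
Proof.
by move=> z1; apply: mxholoM; [exact: mxholo_invEpl|exact: mxholo_poly].
Qed.

Lemma mxholo_invErev_poly (u : 'cV[C]_m) z : `|z| <= 1 ->
  mxholo (fun w => invmx (Er w) *m (frev p n w *m u)) z.
Proof.
move=> z1; apply: mxholoM.
  by apply: mxholo_inv; [exact: Erev_unit|exact: mxholo_Erev].
by apply: mxholoM; [exact: mxholo_frev|exact: mxholo_cst].
Qed.

End ModelHolomorphy.

Section Spectrum.
Variable R : realType.
Local Notation C := R[i].
Implicit Types (z w : C) (f g : C -> C).

(** The mean of [(z^* ) ^+ k * f z] is the Fourier coefficient of index [k]. *)
Definition spectrum_lt N f := ccirc 1 f /\
  forall k, (N <= k)%N -> cmean 1 (fun z => (z^*) ^+ k * f z) = 0.

Lemma ccirc_conjX k : ccirc 1 (fun z : C => (z^*) ^+ k).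
Proof.
move=> t; apply: (@ccts_comp _ (fun z => z ^+ k) (fun z => z^*)).
  by apply: holo_ccts; exact: (@holoX C k).
exact: ccts_conj.
Qed.

Lemma spectrum_ltW N M f : (N <= M)%N -> spectrum_lt N f -> spectrum_lt M f.
Proof. by move=> NM [cf fk]; split=> // k /(leq_trans NM)/fk. Qed.

Lemma spectrum_lt0 N : spectrum_lt N (fun=> 0).
Proof.
split=> [|k _]; first exact: ccirc_cst.
by under eq_fun do rewrite mulr0; exact: cmean_cst.
Qed.

Lemma spectrum_ltD N f g : spectrum_lt N f -> spectrum_lt N g ->
  spectrum_lt N (fun z => f z + g z).
Proof.
move=> [cf fk] [cg gk]; split=> [|k kN]; first exact: ccircD cf cg.
under eq_fun do rewrite mulrDr.
have cX := @ccirc_conjX k.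
rewrite (cmeanD (ccircM cX cf) (ccircM cX cg)) fk // gk // addr0.
by [].
Qed.

Lemma spectrum_ltZ N (c : C) f : spectrum_lt N f -> spectrum_lt N (fun z => c * f z).
Proof.
move=> [cf fk]; split=> [|k kN]; first exact: ccircM (@ccirc_cst R 1 c) cf.
under eq_fun do rewrite mulrCA.
by rewrite (cmeanZ c (ccircM (@ccirc_conjX k) cf)) fk // mulr0.
Qed.

Lemma spectrum_lt_sum N (I : Type) (s : seq I) (f : I -> C -> C) :
  (forall i, spectrum_lt N (f i)) -> spectrum_lt N (fun z => \sum_(i <- s) f i z).
Proof.
move=> sf; elim: s => [|i s IH].
  by under eq_fun do rewrite big_nil; exact: spectrum_lt0.
by under eq_fun do rewrite big_cons; exact: (spectrum_ltD (sf i) IH).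
Qed.

Lemma eq_spectrum_lt N f g : ccirc 1 g ->
  (forall t, f (circle_pt 1 t) = g (circle_pt 1 t)) ->
  spectrum_lt N f -> spectrum_lt N g.
Proof.
move=> cg fg [_ fk]; split=> // k kN; rewrite -[RHS](fk k kN).
by apply: eq_cmean => t; rewrite fg.
Qed.

Lemma spectrum_lt_mulX N l f : spectrum_lt N f ->
  spectrum_lt (l + N) (fun z => z ^+ l * f z).
Proof.
move=> [cf fk]; split=> [|k lNk].
  by move=> t; apply: cctsM (cf t); apply: holo_ccts; exact: (@holoX C l).
have kl : (l <= k)%N by apply: leq_trans lNk; exact: leq_addr.
rewrite -[RHS](fk (k - l)%N); last by rewrite leq_subRL.
apply: eq_cmean => t; rewrite circle_conj; have := circle_pt_neq0 t.
move: (circle_pt 1 t) => z z0; rewrite mulrA; congr (_ * _).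
by rewrite -{1}(subnK kl) exprD -mulrA -exprMn mulVf // expr1n mulr1.
Qed.

End Spectrum.

(** * The inner product *)

Section ModelInner.
Variables (R : realType) (p n : nat).
Local Notation C := R[i].
Local Notation m := (\sum_(j < n.+1) p)%N.
Local Notation F := (@frow C p n).
Variable G : 'M[C]_m.
Hypotheses (Gpos : posdefmx G) (Gtoe : toeplitz G).
Variable a : C.
Hypotheses (a1 : `|a| < 1) (a0 : a != 0).
Local Notation Gam := (invmx G).
Local Notation Ep := (Epl G a).
Local Notation Em := (Emi G a).
Local Notation Er := (Erev G a).
Implicit Types z w : C.

Lemma le1_cabs z : cabs z <= 1 -> `|z| <= 1.
Proof. by rewrite -lec_cabs. Qed.

Lemma norm_circle_pt (t : R) : `|circle_pt 1 t : C| = 1.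
Proof. by rewrite cabsE cabs_circle_pt. Qed.

Definition mxmean r k l (A : C -> 'M[C]_(k, l)) : 'M[C]_(k, l) :=
  \matrix_(i, j) cmean r (fun z => A z i j).

Lemma mxmean_mull r k l q (B : 'M[C]_(k, l)) (A : C -> 'M[C]_(l, q)) i j :
  (forall i j, ccirc r (fun z => A z i j)) ->
  cmean r (fun z => (B *m A z) i j) = (B *m mxmean r A) i j.
Proof.
move=> cA.
have cB o : ccirc r (fun z => B i o * A z o j).
  exact: ccircM (@ccirc_cst R r (B i o)) (cA o j).
have [H _] := @cmean_sum R r 'I_l (index_enum _) xpredT
  (fun o z => B i o * A z o j) (fun o _ => cB o).
rewrite mxE; under eq_fun do rewrite mxE.
by rewrite H; apply: eq_bigr => o _; rewrite mxE (cmeanZ _ (cA o j)).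
Qed.

Lemma holo_disc_entry k (x : 'rV[C]_k) (A : C -> 'cV[C]_k) :
  (forall z, `|z| <= 1 -> mxholo A z) -> holo_disc (fun z => (x *m A z) 0 0).
Proof.
move=> dA z /le1_cabs z1.
have H : mxholo (fun w => x *m A w) z.
  exact: mxholoM (@mxholo_cst C 1 k x z) (dA z z1).
exact: H.
Qed.

(** The integral reproduces values: by [kernel_integrand] the integrand has a part
    from [Epl], whose mean Cauchy's formula computes, and a part from [Emi],
    which is a holomorphic function of [z^*] that vanishes at 0. *)
Lemma inner_kernel w (x : 'cV[C]_p) (u : 'cV[C]_m) : cabs w < 1 ->
  cmean 1 (fun z => ((F z *m (Gam *m (F w)^t* *m x))^t*
    *m invmx (Ep z *m (Ep z)^t*) *m (F z *m u)) 0 0)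
  = (x^t* *m (F w *m u)) 0 0.
Proof.
move=> w1.
pose al z := (x^t* *m Ep w *m (invmx (Ep z) *m (F z *m u))) 0 0.
pose be z := (x^t* *m Em w *m (invmx (Er z) *m (frev p n z *m u))) 0 0.
pose et z := (1 - w * z)^-1 * (z * be z).
have dal : holo_disc al.
  by apply: holo_disc_entry => z z1; exact: mxholo_invEpl_poly.
have dbe : holo_disc be.
  by apply: holo_disc_entry => z z1; exact: mxholo_invErev_poly.
have det_ : holo_disc et.
  move=> z z1; apply: (@holoM C (fun z => (1 - w * z)^-1) (fun z => z * be z)).
    exact: holo_disc_geometric.
  by apply: (@holoM C id be); [exact: holo_id|exact: dbe].
have pt t : ((F (circle_pt 1 t) *m (Gam *m (F w)^t* *m x))^t*
    *m invmx (Ep (circle_pt 1 t) *m (Ep (circle_pt 1 t))^t*)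
    *m (F (circle_pt 1 t) *m u)) 0 0 =
    al (circle_pt 1 t) * (1 - w * (circle_pt 1 t)^*)^-1 +
    (-1) * et ((circle_pt 1 t)^*).
  have z1 := norm_circle_pt t; move: (circle_pt 1 t) z1 => z z1.
  have wz : 1 - w * z^* != 0.
    apply: one_sub_neq0; rewrite cabsM [cabs z^*]/cabs normcJ z1 /= mulr1.
    exact: w1.
  exact (kernel_integrand Gpos Gtoe a1 a0 x u z1 wz).
rewrite (@eq_cmean R 1 _ (fun z => al z * (1 - w * z^*)^-1 + (-1) * et (z^*)) pt).
have cet : ccirc 1 (fun z => et z^*).
  move=> t; apply: (@ccts_comp _ et (fun z => z^*)); last exact: ccts_conj.
  by apply: holo_ccts; apply: det_; rewrite /cabs normcJ norm_circle_pt.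
have cal : ccirc 1 (fun z => al z * (1 - w * z^*)^-1).
  exact: ccircM (holo_disc_circ dal) (cauchy_kernel_circ w1).
rewrite (cmeanD cal (ccircM (@ccirc_cst R 1 (-1)) cet)) (cmeanZ _ cet).
rewrite (holo_disc_mean_conj det_) (cauchy_formula dal w1).
rewrite /et !mul0r !mulr0 addr0 /al mulmxA -(mulmxA _ (Ep w)) mulmxV ?mulmx1 //.
by apply: Epl_unit => //; apply: le1_cabs; exact: ltW.
Qed.

(** The integral is the form of some matrix, which sends [u] to [tau]. By
    [inner_kernel] it has the same kernel functions as [G] at all points of the
    disc, so [tau = G *m u]. *)
Theorem inner_eq (u v : 'cV[C]_m) :
  cmean 1 (fun z => ((F z *m v)^t* *m invmx (Ep z *m (Ep z)^t*) *m (F z *m u)) 0 0)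
  = (v^t* *m G *m u) 0 0.
Proof.
pose Phi z := (invmx (Ep z) *m F z)^t* *m (invmx (Ep z) *m (F z *m u)).
have cPhi i j : ccirc 1 (fun z => Phi z i j).
  move=> t; have z1 : `|circle_pt 1 t : C| <= 1 by rewrite norm_circle_pt.
  apply: (mxcctsM (A := fun z => (invmx (Ep z) *m F z)^t*)).
    apply: mxccts_adj; apply: mxholo_ccts.
    by apply: mxholoM; [exact: mxholo_invEpl|exact: mxholo_frow].
  by apply: mxholo_ccts; exact: mxholo_invEpl_poly.
pose tau := mxmean 1 Phi.
have innerE (v' : 'cV[C]_m) : cmean 1 (fun z => ((F z *m v')^t*
    *m invmx (Ep z *m (Ep z)^t*) *m (F z *m u)) 0 0) = (v'^t* *m tau) 0 0.
  rewrite -(mxmean_mull (v'^t*) 0 0 cPhi); apply: eq_cmean => t.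
  by rewrite weight_form // norm_circle_pt.
suff tauE : tau = G *m u by rewrite innerE tauE mulmxA.
have uG := posdef_unit Gpos.
suff H : Gam *m tau = u by rewrite -H mulKVmx.
apply/eqP; rewrite -subr_eq0; apply/eqP.
apply: (@frow_disc_inj C p n) => w w1.
have w1' : cabs w < 1 by rewrite -ltc_cabs.
apply/colP => i; rewrite [RHS]mxE.
have := inner_kernel (delta_mx i 0) u w1'; rewrite innerE.
rewrite !trmxC_mul trmxCK (posdef_inv Gpos).1.
rewrite -!mulmxA => H; rewrite mulmxBr entryB.
have D (y : 'cV[C]_p) : ((delta_mx i 0 : 'cV[C]_p)^t* *m y) 0 0 = y i 0.
  have -> : (delta_mx i 0 : 'cV[C]_p)^t* = delta_mx 0 i.
    apply/matrixP => k l; rewrite !mxE; case: (l == i); case: (k == 0);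
      by rewrite ?(rmorph0, rmorph1).
  by rewrite -rowE mxE.
by move: H; rewrite !D => ->; rewrite subrr.
Qed.

End ModelInner.

(** * The Hardy space *)

Section HardyTheory.
Variable R : realType.
Local Notation C := R[i].
Implicit Types (z w : C) (r s t e : R) (f g : C -> C).
Local Notation twopi := (2 * pi : R).

Lemma cmean_dilate r f : cmean r f = cmean 1 (fun z => f (r%:C%C * z)).
Proof. by congr circle_mean; apply/funext => t; rewrite /circle_pt mul1r. Qed.

Lemma ccirc_dilate r f : ccirc r f -> ccirc 1 (fun z => f (r%:C%C * z)).
Proof.
move=> cf t; apply: (@ccts_comp _ f (fun z => r%:C%C * z)).
  by rewrite /circle_pt mul1r; exact: cf.
by apply: cctsM; [exact: ccts_cst|exact: ccts_id].
Qed.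

Lemma hardy_integralE r f : ccirc r f ->
  ((twopi^-1)%:E * \int[@lebesgue_measure R]_(t in `[0%R, twopi])
     (complex.Re (f (circle_pt r t)))%:E = (complex.Re (cmean r f))%:E)%E.
Proof.
move=> /ccirc_ctn[cf _]; rewrite Re_cmean EFinM; congr (_ * _)%E.
rewrite /rint /Rintegral fineK //; apply: integrable_fin_num => //.
exact: ctn_on_integrable.
Qed.

(** The means depend continuously on the radius, which ranges over a compact
    interval. *)
Lemma cmean_disc_bounded f : ccts_disc f ->
  exists M : R, forall r, 0 <= r <= 1 -> cabs (cmean r f) <= M.
Proof.
move=> cf.
have /compact_near_coveringP/near_covering_withinP cov := @segment_compact R 0 1.
have := cov R (pinfty_nbhs R) (fun M r => cabs (cmean r f) <= M).
case=> [r|M [_ HM]].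
  rewrite /= in_itv /= => rP; have [d d0 Hd] := cmean_cts cf rP ltr01.
  exists (ball r d, [set M | cabs (cmean r f) + 1 < M]).
    split=> /=; first exact: nbhsx_ballx.
    by exists (cabs (cmean r f) + 1); split=> //; exact: num_real.
  move=> [s M] /= [rs HM] sP.
  rewrite -[cmean s f](subrK (cmean r f)); apply: le_trans (cabsD _ _) _.
  rewrite addrC; apply: le_trans (ltW HM); rewrite lerD2l.
  by apply: Hd => //; rewrite distrC.
exists (M + 1) => r rP; apply: (HM (M + 1)) => /=; last by rewrite in_itv.
by rewrite ltrDl.
Qed.

Lemma cmean_dominated r f k : ccirc r f -> ccirc r k ->
  (forall t, 0 <= t <= twopi ->
    cabs (f (circle_pt r t)) <= complex.Re (k (circle_pt r t))) ->
  cabs (cmean r f) <= 2 * complex.Re (cmean r k).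
Proof.
move=> /ccirc_ctn[cf cf'] /ccirc_ctn[ck _] fk; have k0 := twopi_gt0 R.
apply: le_trans (cabs_le_ReIm _) _; rewrite Re_cmean Im_cmean.
have bnd h : ctn_on 0 twopi h ->
    (forall t, 0 <= t <= twopi -> `|h t| <= cabs (f (circle_pt r t))) ->
    `|twopi^-1 * rint 0 twopi h| <= complex.Re (cmean r k).
  move=> ch hf; rewrite normrM gtr0_norm ?invr_gt0 // Re_cmean.
  rewrite ler_pM2l ?invr_gt0 // ler_norml; apply/andP; split.
    rewrite lerNl -mulN1r -rintZ //; apply: le_rint => //.
      by apply: ctn_onM => //; exact: ctn_on_cst.
    move=> t tP; rewrite mulN1r; apply: le_trans (fk t tP).
    by apply: le_trans (hf t tP); rewrite -normrN; exact: ler_norm.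
  apply: le_rint => // t tP; apply: le_trans (fk t tP).
  by apply: le_trans (hf t tP); exact: ler_norm.
have -> : 2 * complex.Re (cmean r k) = complex.Re (cmean r k) + complex.Re (cmean r k).
  by rewrite mulr_natl mulr2n.
by apply: lerD; apply: bnd => // t tP; [exact: Re_le_cabs|exact: Im_le_cabs].
Qed.

Lemma holo_disc_hardy2 k (A : C -> 'cV[C]_k) :
  (forall z, `|z| <= 1 -> mxholo A z) -> hardy2 A.
Proof.
move=> dA; split=> [z /ltW z1 i j|]; first exact: dA.
pose f z := ((A z)^t* *m A z) 0 0.
have cf : ccts_disc f.
  move=> z /le1_cabs z1; have cA : mxccts A z by apply: mxholo_ccts; exact: dA.
  have H : mxccts (fun w => (A w)^t* *m A w) z by apply: mxcctsM => //; exact: mxccts_adj.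
  exact: H.
have [M HM] := cmean_disc_bounded cf; exists M => r /andP[r0 r1].
have rP : 0 <= r <= 1 by rewrite r0 ltW.
rewrite (hardy_integralE (ccts_disc_circ rP cf)) lee_fin.
apply: le_trans (HM r rP); apply: le_trans (Re_le_cabs _); exact: ler_norm.
Qed.

Lemma hardy2_mean k (g : C -> 'cV[C]_k) : hardy2 g ->
  (forall z, cabs z < 1 -> mxholo g z) /\
  exists M : R, forall r, 0 <= r < 1 ->
    complex.Re (cmean r (fun z => ((g z)^t* *m g z) 0 0)) <= M.
Proof.
move=> [dg [M HM]].
have hg z : cabs z < 1 -> mxholo g z by rewrite -ltc_cabs => z1 i j; exact: dg.
split=> //; exists M => r rP; have := HM r rP.
rewrite (hardy_integralE (f := fun z => ((g z)^t* *m g z) 0 0)) ?lee_fin //.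
move=> t; have cg : mxccts g (circle_pt r t).
  by apply: mxholo_ccts; apply: hg; case/andP: rP => r0; rewrite cabs_circle_pt.
have H : mxccts (fun w => (g w)^t* *m g w) (circle_pt r t).
  by apply: mxcctsM => //; exact: mxccts_adj.
exact: H.
Qed.

End HardyTheory.

Section ModelSpace.
Variables (R : realType) (p n : nat).
Local Notation C := R[i].
Local Notation m := (\sum_(j < n.+1) p)%N.
Local Notation F := (@frow C p n).
Variable G : 'M[C]_m.
Hypotheses (Gpos : posdefmx G) (Gtoe : toeplitz G).
Variable a : C.
Hypotheses (a1 : `|a| < 1) (a0 : a != 0).
Local Notation Ep := (Epl G a).
Local Notation Em := (Emi G a).
Local Notation Er := (Erev G a).
Implicit Types z w : C.

Lemma adj_mul_entry k (x y : 'cV[C]_k) :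
  (x^t* *m y) 0 0 = \sum_i (x i 0)^* * y i 0.
Proof. by rewrite mxE; apply: eq_bigr => i _; rewrite !mxE. Qed.

Lemma Re_gram k (x : 'cV[C]_k) :
  complex.Re ((x^t* *m x) 0 0) = \sum_i cabs (x i 0) ^+ 2.
Proof.
rewrite adj_mul_entry.
have -> : \sum_i (x i 0)^* * x i 0 = (\sum_i cabs (x i 0) ^+ 2)%:C%C.
  rewrite rmorph_sum; apply: eq_bigr => i _.
  by rewrite mulrC -normCK cabsE rmorphXn.
by [].
Qed.

Lemma cabs_sum (I : Type) (s : seq I) (f : I -> C) :
  cabs (\sum_(i <- s) f i) <= \sum_(i <- s) cabs (f i).
Proof.
elim: s => [|i s IH]; first by rewrite !big_nil /cabs normr0.
by rewrite !big_cons; apply: le_trans (cabsD _ _) _; rewrite lerD2l.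
Qed.

Lemma ccirc_entry_adj k (x y : C -> 'cV[C]_k) (r : R) :
  (forall t, mxccts x (circle_pt r t)) -> (forall t, mxccts y (circle_pt r t)) ->
  ccirc r (fun z => ((x z)^t* *m y z) 0 0).
Proof.
move=> cx cy t.
have H : mxccts (fun w => (x w)^t* *m y w) (circle_pt r t).
  by apply: mxcctsM => //; exact: mxccts_adj.
exact: H.
Qed.

Lemma mxholo_dilate k l (A : C -> 'M[C]_(k, l)) (c : C) z :
  mxholo A (c * z) -> mxholo (fun w => A (c * w)) z.
Proof.
move=> dA i j; apply: (@holo_comp C (fun w => A w i j) (fun w => c * w)).
  exact: dA.
by apply: (@holoM C (fun=> c) id); [exact: holo_cst|exact: holo_id].
Qed.

(** The boundary values of [psi] are anti-analytic and vanish at infinity, so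
    against the dilation of [g] to radius [r] they have mean zero, by the mean
    value property. Replacing [psi] at radius [r] by its boundary values costs
    little, as [psi] is uniformly continuous and the means of [g] are bounded. *)
Lemma anti_analytic_orthogonal k (psi ka g : C -> 'cV[C]_k) :
  (forall z, cabs z <= 1 -> mxccts psi z) ->
  (forall z, cabs z <= 1 -> mxholo ka z) ->
  (forall t, psi (circle_pt 1 t) =
    (circle_pt 1 t)^* *: ka (circle_pt 1 t)^*) ->
  hardy2 g ->
  (cmean r (fun z => ((g z)^t* *m psi z) 0 0) : C^o) @[r --> 1^'-] --> (0 : C^o).
Proof.
move=> cpsi dka psiE /hardy2_mean[dg [M HM]]; apply/cvg_cabsP => e e0.
pose L := k%:R + `|M| + 1.
have L0 : 0 < L by rewrite ltr_wpDl // addr_ge0.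
pose dl := e / (4 * L).
have dl0 : 0 < dl by rewrite divr_gt0 // mulr_gt0.
have cpsi1 t : mxccts psi (circle_pt 1 t) by apply: cpsi; rewrite cabs_circle_pt.
have close : \forall r \near (1 : R)^'-, forall i t, 0 <= t <= 2 * pi ->
    cabs (psi (circle_pt r t) i 0 - psi (circle_pt 1 t) i 0) < dl.
  apply: filter_forall => i.
  have [d d0 Hd] := @circle_tube R (fun z => psi z i 0) 1 dl
    (fun t => cpsi1 t i 0) dl0.
  near=> r; move=> t tP; apply: Hd => //.
  near: r; apply: cvg_within; exact: near_dist_lt.
near=> r; rewrite subr0.
have r0 : 0 < r by near: r; exact: nbhs_left_gt.
have r1 : r < 1 by near: r; exact: nbhs_left_lt.
have Hr : forall i t, 0 <= t <= 2 * pi ->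
    cabs (psi (circle_pt r t) i 0 - psi (circle_pt 1 t) i 0) < dl.
  by near: r.
have rP : 0 <= r <= 1 by rewrite !ltW.
have cabsr t : cabs (circle_pt r t) < 1 by rewrite cabs_circle_pt // ltW.
have cgr t : mxccts g (circle_pt r t) by apply: mxholo_ccts; exact: dg.
have cpsir t : mxccts psi (circle_pt r t) by apply: cpsi; exact: ltW.
pose gr z := g (r%:C%C * z).
have dgr z : cabs z <= 1 -> mxholo gr z.
  move=> z1; apply: (mxholo_dilate (c := r%:C%C)); apply: dg.
  rewrite cabsM cabs_real ger0_norm ?ltW //; apply: le_lt_trans r1.
  by rewrite -[leRHS]mulr1 ler_wpM2l // ltW.
have rE t : r%:C%C * circle_pt 1 t = circle_pt r t by rewrite /circle_pt mul1r.
have cgr1 t : mxccts gr (circle_pt 1 t).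
  by apply: mxholo_ccts; apply: dgr; rewrite cabs_circle_pt.
have cpsi_r1 t : mxccts (fun z => psi (r%:C%C * z) - psi z) (circle_pt 1 t).
  move=> i j.
  have c1 : ccts (fun z => psi (r%:C%C * z) i j) (circle_pt 1 t).
    have cr : ccirc r (fun z => psi z i j) by move=> s; exact: cpsir.
    exact: (ccirc_dilate cr).
  have c2 : ccts (fun z => (-1) * psi z i j) (circle_pt 1 t).
    by apply: cctsM; [exact: ccts_cst|exact: cpsi1].
  have := cctsD c1 c2; congr (ccts _ _); apply/funext => z.
  by rewrite !mxE mulN1r.
(* the mean of the boundary values vanishes exactly *)
have main0 : cmean 1 (fun z => ((gr z)^t* *m psi z) 0 0) = 0.
  pose et z := z * \sum_i (gr (z^*) i 0)^* * ka z i 0.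
  have det_ : holo_disc et.
    move=> z z1; apply: (@holoM C id (fun z => \sum_i (gr (z^*) i 0)^* * ka z i 0)).
      exact: holo_id.
    apply: holo_sum => i _.
    apply: (@holoM C (fun z => (gr (z^*) i 0)^*) (fun z => ka z i 0)).
      apply: (holo_conj (f := fun z => gr z i 0)); apply: dgr.
      by rewrite /cabs normcJ.
    exact: dka.
  have := holo_disc_mean_conj det_; rewrite /et mul0r => <-.
  apply: eq_cmean => t; rewrite adj_mul_entry psiE mulr_sumr.
  by apply: eq_bigr => i _; rewrite mxE conjCK mulrCA.
have split_ : cmean r (fun z => ((g z)^t* *m psi z) 0 0) =
    cmean 1 (fun z => ((gr z)^t* *m (psi (r%:C%C * z) - psi z)) 0 0).
  rewrite cmean_dilate -[RHS]addr0 -main0 -cmeanD; last 2 first.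
  - exact: ccirc_entry_adj.
  - exact: ccirc_entry_adj.
  by apply: eq_cmean => t; rewrite mulmxBr entryB subrK.
rewrite split_.
pose gg z := ((gr z)^t* *m gr z) 0 0.
have cgg : ccirc 1 gg by exact: ccirc_entry_adj.
pose k_ z : C := dl%:C%C * (k%:R%:C%C + gg z).
have ck : ccirc 1 k_.
  apply: ccircM; first exact: ccirc_cst.
  by apply: ccircD cgg; exact: ccirc_cst.
have Mgg : complex.Re (cmean 1 gg) <= `|M|.
  apply: le_trans (ler_norm M); have := HM r; rewrite ltW // r1 => /(_ isT).
  by rewrite (cmean_dilate r (fun z => ((g z)^t* *m g z) 0 0)).
have Rek : complex.Re (cmean 1 k_) = dl * (k%:R + complex.Re (cmean 1 gg)).
  rewrite (cmeanZ _ (ccircD (@ccirc_cst R 1 _) cgg)).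
  rewrite (cmeanD (@ccirc_cst R 1 _) cgg) cmean_cst.
  by case: (cmean 1 gg) => x y /=; rewrite mul0r subr0.
have dom : cabs (cmean 1 (fun z => ((gr z)^t* *m (psi (r%:C%C * z) - psi z)) 0 0))
    <= 2 * complex.Re (cmean 1 k_).
  apply: (cmean_dominated (ccirc_entry_adj cgr1 cpsi_r1) ck) => t tP.
  set z := circle_pt 1 t.
  have -> : complex.Re (k_ z) = dl * (k%:R + \sum_i cabs (gr z i 0) ^+ 2).
    by rewrite /k_ -Re_gram -/(gg z); case: (gg z) => x y /=; rewrite mul0r subr0.
  rewrite adj_mul_entry; apply: le_trans (cabs_sum _ _) _.
  have -> : k%:R = \sum_(i < k) 1 :> R by rewrite sumr_const card_ord.
  rewrite -big_split mulr_sumr /=; apply: ler_sum => i _.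
  rewrite cabsM [cabs (_^*)]/cabs normcJ -/(cabs _) mulrC.
  apply: ler_pM; rewrite ?cabs_ge0 //.
    by rewrite entryB rE; apply: ltW; exact: Hr.
  have := sqr_ge0 (cabs (gr z i 0) - 1); have := cabs_ge0 (gr z i 0).
  by move: (cabs _) => x x0; rewrite sqrrB expr1n mulr1 => ?; lra.
apply: le_lt_trans dom _; rewrite Rek.
have le1 : 2 * (dl * (k%:R + complex.Re (cmean 1 gg))) <= 2 * (dl * L).
  apply: ler_wpM2l => //; apply: ler_wpM2l; first exact: ltW.
  rewrite /L -addrA lerD2l.
  by apply: le_trans Mgg _; rewrite lerDl.
apply: le_lt_trans le1 _; rewrite /dl.
have -> : 2 * (e / (4 * L) * L) = e / 2.
  by field; rewrite gt_eqF.
by rewrite ltr_pdivrMr // mulr_natr mulr2n ltrDl.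
Unshelve. all: by end_near. Qed.

End ModelSpace.

(** * The de Branges space *)

Section ModelEqualsHG.
Variables (R : realType) (p n : nat).
Local Notation C := R[i].
Local Notation m := (\sum_(j < n.+1) p)%N.
Local Notation F := (@frow C p n).
Variable G : 'M[C]_m.
Hypotheses (Gpos : posdefmx G) (Gtoe : toeplitz G).
Variable a : C.
Hypotheses (a1 : `|a| < 1) (a0 : a != 0).
Local Notation Ep := (Epl G a).
Local Notation Em := (Emi G a).
Local Notation Er := (Erev G a).
Implicit Types z w : C.

Definition quot z : 'M[C]_p := invmx (Ep z) *m Em z.

Lemma quot_adj_ccts (f : C -> 'cV[C]_p) z : cabs z <= 1 -> mxholo f z ->
  mxccts (fun w => (quot w)^t* *m (invmx (Ep w) *m f w)) z.
Proof.
move=> /le1_cabs z1 df; apply: (mxcctsM (A := fun w => (quot w)^t*)).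
  by apply: mxccts_adj; apply: mxholo_ccts; exact: mxholo_quotient.
by apply: mxholo_ccts; apply: mxholoM => //; exact: mxholo_invEpl.
Qed.

Lemma orthogonal_psi (h g : C -> 'cV[C]_p) :
  hardy2_orthogonal h (fun z => quot z *m g z) =
  ((cmean r (fun z => ((g z)^t* *m ((quot z)^t* *m h z)) 0 0) : C^o)
     @[r --> 1^'-] --> (0 : C^o)).
Proof.
rewrite /hardy2_orthogonal /cmean.
by under eq_fun do under eq_fun do rewrite trmxC_mul -mulmxA.
Qed.

(** By [invEmi_frow], [psi] is anti-analytic on the circle and vanishes at
    infinity there. *)
Theorem poly_in_model_space (u : 'cV[C]_m) :
  model_space quot (fun z => invmx (Ep z) *m (F z *m u)).
Proof.
split=> [|g hg].
  by apply: holo_disc_hardy2 => z z1; exact: mxholo_invEpl_poly.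
rewrite orthogonal_psi.
pose psi z := (quot z)^t* *m (invmx (Ep z) *m (F z *m u)).
pose ka z := invmx (Er z) *m (frev p n z *m u).
apply: (@anti_analytic_orthogonal R p psi ka g) => //.
- by move=> z z1; apply: quot_adj_ccts => //; exact: mxholo_poly.
- by move=> z /le1_cabs z1; exact: mxholo_invErev_poly.
- move=> t; have z1 := norm_circle_pt t.
  exact: etrans (quotient_adjoint Gpos Gtoe a1 a0 _ z1)
                (invEmi_frow Gpos Gtoe a1 a0 u z1).
Qed.

Lemma hardy2_monomial k (i : 'I_p) :
  hardy2 (fun z : C => z ^+ k *: (delta_mx i 0 : 'cV[C]_p)).
Proof.
apply: holo_disc_hardy2 => z _; apply: mxholoZ; last exact: mxholo_cst.
exact: (@holoX C k).
Qed.

(** Orthogonality is tested on monomials: the mean over the circle of radius [r]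
    tends both to 0 and to the mean over the unit circle, which is a Fourier
    coefficient. *)
Lemma model_space_spectrum (f : C -> 'cV[C]_p) :
  (forall z, cabs z <= 1 -> mxholo f z) ->
  model_space quot (fun z => invmx (Ep z) *m f z) ->
  forall i, spectrum_lt 0 (fun z => ((quot z)^t* *m (invmx (Ep z) *m f z)) i 0).
Proof.
move=> df [_ orth] i; pose psi z := (quot z)^t* *m (invmx (Ep z) *m f z).
change (spectrum_lt 0 (fun z => psi z i 0)).
have cpsi z : cabs z <= 1 -> mxccts psi z.
  by move=> z1; apply: quot_adj_ccts => //; exact: df.
have cpsi1 : ccirc 1 (fun z => psi z i 0).
  by move=> t; apply: cpsi; rewrite cabs_circle_pt.
split=> // k _.
pose phi z := (z^*) ^+ k * psi z i 0.
have cphi : ccts_disc phi.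
  move=> z z1; apply: cctsM; last exact: cpsi.
  apply: (@ccts_comp _ (fun z => z ^+ k) (fun z => z^*)); last exact: ccts_conj.
  by apply: holo_ccts; exact: (@holoX C k).
have := orth _ (hardy2_monomial k i); rewrite orthogonal_psi.
have -> : (fun r : R =>
    cmean r (fun z => ((z ^+ k *: (delta_mx i 0 : 'cV[C]_p))^t* *m psi z) 0 0))
    = fun r => cmean r phi.
  apply/funext => r; apply: eq_cmean => t; rewrite adj_mul_entry (bigD1 i) //=.
  rewrite big1 ?addr0 => [|j ji]; last by rewrite !mxE (negPf ji) mulr0 rmorph0 mul0r.
  by rewrite /phi; congr (_ * _); rewrite !mxE !eqxx mulr1 rmorphXn.
move=> /cvg_cabsP lim; apply: cabs_eq0; apply/eqP.
rewrite eq_le cabs_ge0 andbT; apply/ler_addgt0Pl => e e0; rewrite addr0.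
have e2 : 0 < e / 2 by rewrite divr_gt0.
have one01 : 0 <= (1 : R) <= 1 by rewrite ler01 lexx.
have [d d0 Hd] := cmean_cts cphi one01 e2.
have [r [r0 r1 rd rl]] : exists r : R, [/\ 0 <= r, r <= 1, `|r - 1| < d &
    cabs (cmean r phi - 0) < e / 2].
  apply: (@filter_ex _ (1 : R)^'-); near=> r; split.
  - by apply: ltW; near: r; exact: nbhs_left_gt.
  - by apply: ltW; near: r; exact: nbhs_left_lt.
  - by near: r; apply: cvg_within; exact: near_dist_lt.
  - by near: r; exact: lim.
have rP : 0 <= r <= 1 by rewrite r0.
rewrite subr0 in rl; have := Hd r rP rd; rewrite -cabsN opprB => H.
rewrite -[cmean 1 phi](subrK (cmean r phi)); apply: le_trans (cabsD _ _) _.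
by rewrite [e]splitr lerD // ltW.
Unshelve. all: by end_near. Qed.

(** Multiplication by [Emi], a polynomial of degree at most [n.+1], raises
    frequencies by at most that much. *)
Lemma Emi_mul_spectrum (psi : C -> 'cV[C]_p) i :
  (forall j, spectrum_lt 0 (fun z => psi z j 0)) ->
  spectrum_lt n.+1 (fun z => (Em z *m psi z) i 0).
Proof.
move=> spsi; set s := sqrtC (1 - `|a| ^+ 2).
pose Z := zfrak G (a^*)^-1.
pose phi z := (F z *m (Z *m psi z)) i 0.
have sphi : spectrum_lt n phi.
  have -> : phi = fun z => \sum_o F z i o * (Z *m psi z) o 0.
    by apply/funext => z; rewrite /phi mxE.
  apply: spectrum_lt_sum => o.
  have sZ : spectrum_lt 0 (fun z => (Z *m psi z) o 0).
    have -> : (fun z => (Z *m psi z) o 0) = fun z => \sum_j Z o j * psi z j 0.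
      by apply/funext => z; rewrite mxE.
    by apply: spectrum_lt_sum => j; exact: spectrum_ltZ.
  have -> : (fun z => F z i o * (Z *m psi z) o 0) =
      fun z => if i == tagnat.sig2 o
               then z ^+ tagnat.sig1 o * (Z *m psi z) o 0 else 0.
    apply/funext => z; rewrite frow_entry.
    by case: (i == _); rewrite ?mul0r.
  case: (i == _); last exact: spectrum_lt0.
  have := spectrum_lt_mulX (tagnat.sig1 o) sZ; rewrite addn0.
  by apply: spectrum_ltW; rewrite -ltnS.
have -> : (fun z => (Em z *m psi z) i 0) =
    fun z => s^-1 * (z ^+ 1 * phi z + (- a) * phi z).
  apply/funext => z; rewrite /Emi -/s -scalemxAl mxE -mulmxA -/Z -/(phi z) expr1.
  by rewrite -mulrDl mulrA; congr (_ * _); rewrite mulrC.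
apply: spectrum_ltZ; apply: spectrum_ltD; first exact: spectrum_lt_mulX.
by apply: spectrum_ltZ; exact: spectrum_ltW sphi.
Qed.

(** On the circle [f = Emi *m psi], where [psi] has no frequency in the
    nonnegative range, so [f] has none beyond [n]. *)
Theorem model_space_poly (f : C -> 'cV[C]_p) :
  (forall z, mxholo f z) ->
  model_space quot (fun z => invmx (Ep z) *m f z) ->
  exists u : 'cV[C]_m, f = fun z => F z *m u.
Proof.
move=> df fmod; pose psi z := (quot z)^t* *m (invmx (Ep z) *m f z).
have spsi := @model_space_spectrum f (fun z _ => df z) fmod.
have fspec i : spectrum_lt n.+1 (fun z => f z i 0).
  apply: (@eq_spectrum_lt R n.+1 (fun z => (Em z *m psi z) i 0)).
  - by move=> t; apply: holo_ccts; exact: df.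
  - move=> t; have z1 := norm_circle_pt t; rewrite /psi.
    rewrite (quotient_adjoint Gpos Gtoe a1 a0 _ z1) mulKVmx //.
    exact: Emi_circle_unit.
  - exact: Emi_mul_spectrum.
pose c (k : nat) : 'cV[C]_p := \col_i cmean 1 (fun z => (z^*) ^+ k * f z i 0).
exists (bvec n c); apply/funext => w; rewrite frow_bvec; apply/colP => i.
rewrite summxE.
have dfi z : derivable ((fun z => f z i 0) : C^o -> C^o) z 1 by exact: df.
rewrite (@entire_coef_poly R (fun z => f z i 0) n dfi (fspec i).2 w).
by apply: eq_bigr => k _; rewrite !mxE.
Qed.

(** The denominator is invertible on the closed disc, so the boundary values exist
    everywhere, by continuity. *)
Theorem quot_inner : inner_function quot.
Proof.
split.
- by move=> z /ltW z1 i j; exact: mxholo_quotient.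
- by move=> z z1; exact: contractive_quotient.
apply: aeW => t _; exists (quot (circle_pt 1 t)).
have z1 := norm_circle_pt t; split; first exact: quotient_unitary.
move=> i j; apply/cvg_cabsP => e e0.
have cq : ccts (fun z => quot z i j) (circle_pt 1 t).
  by apply: holo_ccts; apply: mxholo_quotient; rewrite ?z1.
have /cctsP/(_ e e0)[d d0 Hd] := cq.
have [k k0 Hk] := circle_pt_near 1 t d0.
near=> r; apply: Hd; apply: Hk; last by rewrite subrr normr0.
by near: r; apply: cvg_within; exact: near_dist_lt.
Unshelve. all: by end_near. Qed.

End ModelEqualsHG.

(** * De Branges spaces and Toeplitz matrices *)

Section CircleForms.
Variable C : numClosedFieldType.

Lemma circle_expr (z : C) i j k l : `|z| = 1 -> (i + l = k + j)%N ->
  (z ^+ i)^* * z ^+ j = (z ^+ k)^* * z ^+ l.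
Proof.
move=> /circle_conjV[zV z0] ijkl; rewrite !rmorphXn /= zV !exprVn.
have e : z ^+ k * z ^+ j = z ^+ i * z ^+ l by rewrite -!exprD ijkl.
have [xi xk] := (expf_neq0 i z0, expf_neq0 k z0).
apply: (mulfI (mulf_neq0 xi xk)).
by rewrite mulrACA divff // mul1r e -mulrA [z ^+ k * _]mulrA divff // mul1r.
Qed.

Lemma scaled_form k (c d : C) (W : 'M[C]_k) (x y : 'cV[C]_k) :
  (c *: x)^t* *m W *m (d *: y) = (c^* * d) *: (x^t* *m W *m y).
Proof. by rewrite trmxCZ -!scalemxAl -scalemxAr scalerA. Qed.

End CircleForms.

Section Toeplitz.
Variables (R : realType) (p n : nat).
Local Notation C := R[i].
Local Notation m := (\sum_(j < n.+1) p)%N.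

Lemma frow_delta (z : C) (j : 'I_n.+1) (x : 'cV[C]_p) :
  frow p n z *m bvec n (fun i => if i == j :> nat then x else 0) = z ^+ j *: x.
Proof.
rewrite frow_bvec (bigD1 j) //= eqxx big1 ?addr0 // => i ij.
by rewrite val_eqE (negPf ij) scaler0.
Qed.

Lemma form_delta (G : 'M[C]_m) (i j : 'I_n.+1) (x y : 'cV[C]_p) :
  (bvec n (fun l => if l == i :> nat then y else 0))^t* *m G *m
    bvec n (fun l => if l == j :> nat then x else 0) =
  y^t* *m submxblock G i j *m x.
Proof.
rewrite form_bvec (bigD1 i) //= [X in _ + X]big1 ?addr0 => [|k ki].
  rewrite eqxx (bigD1 j) //= eqxx big1 ?addr0 // => k kj.
  by rewrite val_eqE (negPf kj) mulmx0.
rewrite big1 // => l _; rewrite val_eqE (negPf ki).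
by rewrite trmx0 map_mx0 !mul0mx.
Qed.

(** Multiplying both arguments by the coordinate does not change an integral
    over the circle. *)
Lemma deBranges_toeplitz (G : 'M[C]_m) (E : C -> 'M[C]_(p, p + p)) :
  HG_is_deBranges G E -> block_toeplitz G.
Proof.
move=> [_ inner] i j k l ijkl; apply/matrixP => s t.
have entry (i' j' : 'I_n.+1) : submxblock G i' j' s t =
    ((delta_mx s 0 : 'cV[C]_p)^t* *m submxblock G i' j' *m
      (delta_mx t 0 : 'cV[C]_p)) 0 0.
  have -> : (delta_mx s 0 : 'cV[C]_p)^t* = delta_mx 0 s.
    apply/matrixP => q r; rewrite !mxE; case: (r == s); case: (q == 0);
      by rewrite ?(rmorph0, rmorph1).
  by rewrite -rowE -colE !mxE.
rewrite !entry -!form_delta -!inner /deBranges_inner.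
congr circle_mean; apply/funext => u.
have z1 : `|expi u : C| = 1 by rewrite cabsE cabs_expi.
move: (expi u) z1 => z z1.
have FE (q : 'I_n.+1) (x : 'cV[C]_p) :
    Fpoly (bvec n (fun i => if i == q :> nat then x else 0)) z = z ^+ q *: x.
  exact: frow_delta.
have ijkl' : (i + l = k + j)%N.
  apply/eqP; rewrite -(eqr_nat int); apply/eqP; rewrite !natrD !natz.
  by apply/eqP; rewrite -subr_eq addrAC ijkl subrK.
rewrite !FE !scaled_form !entryZ; congr (_ * _).
exact: circle_expr.
Qed.

Lemma entire_poly_rep (u : 'cV[C]_m) : entire (Fpoly u).
Proof.
move=> z _ i j; have H : mxholo (Fpoly u) z by exact: mxholo_poly.
exact: H.
Qed.

End Toeplitz.

Section MainConverse.
Variables (R : realType) (p n : nat).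
Local Notation C := R[i].
Local Notation m := (\sum_(j < n.+1) p)%N.
Variable G : 'M[C]_m.
Hypotheses (Gpos : posdefmx G) (Gtoe : block_toeplitz G).
Variable a : C.
Hypotheses (a1 : `|a| < 1) (a0 : a != 0).

Lemma Eplus_E_of z : Eplus (E_of G a) z = Epl G a z.
Proof. exact: row_mxKr. Qed.

Lemma Eminus_E_of z : Eminus (E_of G a) z = Emi G a z.
Proof. exact: row_mxKl. Qed.

Lemma E_of_quot :
  (fun z => invmx (Eplus (E_of G a) z) *m Eminus (E_of G a) z) = quot G a.
Proof. by apply/funext => z; rewrite Eplus_E_of Eminus_E_of. Qed.

Lemma E_of_deBranges : deBranges_matrix (E_of G a).
Proof.
split.
- move=> z _ i j; case: (split_ordP j) => k ->.
    have -> : (fun w : C^o => E_of G a w i (lshift p k) : C^o) =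
        fun w => Emi G a w i k.
      by apply/funext => w; rewrite /E_of row_mxEl.
    have H := @mxholo_Emi C p n G a z.
    exact: H.
  have -> : (fun w : C^o => E_of G a w i (rshift p k) : C^o) =
      fun w => Epl G a w i k.
    by apply/funext => w; rewrite /E_of row_mxEr.
  have H := @mxholo_Epl C p n G a z.
  exact: H.
- move=> z z1; rewrite Eplus_E_of -unitfE -unitmxE.
  by apply: Epl_unit => //; exact: ltW.
- by rewrite E_of_quot; exact: quot_inner.
Qed.

Lemma E_of_HG : HG_is_deBranges G (E_of G a).
Proof.
have modE (f : C -> 'cV[C]_p) : (fun z => invmx (Eplus (E_of G a) z) *m f z) =
    fun z => invmx (Epl G a z) *m f z.
  by apply/funext => z; rewrite Eplus_E_of.
split.
  apply/seteqP; split=> [_ [u _ <-]|f [ef]].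
    split; first exact: entire_poly_rep.
    rewrite E_of_quot modE; exact: poly_in_model_space.
  rewrite E_of_quot modE => fmod.
  have df z : mxholo f z by move=> i j; exact: ef.
  have [u ->] := model_space_poly Gpos Gtoe a1 a0 df fmod.
  by exists u.
move=> u v; rewrite /deBranges_inner.
have H := inner_eq Gpos Gtoe a1 a0 u v.
rewrite -[RHS]H; apply: (congr1 (@circle_mean R)); apply/funext => t.
by rewrite Eplus_E_of /circle_pt mul1r.
Qed.

End MainConverse.

Theorem theorem3p3 (R : realType) (p n : nat) (hp : (1 <= p)%N) (hn : (1 <= n)%N)
    (G : 'M[R[i]]_(\sum_(j < n.+1) p)) (hG : posdefmx G) :
  ((exists E : R[i] -> 'M[R[i]]_(p, p + p),
      deBranges_matrix E /\ HG_is_deBranges G E)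
   <-> block_toeplitz G)
  /\
  (block_toeplitz G ->
   forall a : R[i], `|a| < 1 -> a != 0 ->
     deBranges_matrix (E_of G a) /\ HG_is_deBranges G (E_of G a)).
Proof.
have converse : block_toeplitz G -> forall a : R[i], `|a| < 1 -> a != 0 ->
    deBranges_matrix (E_of G a) /\ HG_is_deBranges G (E_of G a).
  by move=> tG a a1 a0; split; [exact: E_of_deBranges|exact: E_of_HG].
split=> //; split=> [[E [_ HE]]|tG]; first exact: deBranges_toeplitz HE.
have half0 : (2^-1 : R[i]) != 0 by rewrite invr_eq0 pnatr_eq0.
have half1 : `|2^-1 : R[i]| < 1.
  by rewrite normfV normr_nat invf_lt1 ?ltr0n // ltr1n.
by exists (E_of G 2^-1); exact: converse.
Qed.
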